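(* Fix a positive integer $s$ and a real number $\alpha$ with $\alpha/(2\pi)\notin\mathbb{Q}$. Let $$\Sigma=\{a=(a_{i,j})_{i,j\ge 0,\ i+j>2s}:\ a_{j,i}=\overline{a_{i,j}},\ |a_{i,j}|<1\},$$ and for $a\in\Sigma$ put $\tilde a(z,\bar z)=\sum_{i+j>2s}a_{i,j}z^i\bar z^j$, $\phi_a(z)=z\,e^{i\tilde a(z,\bar z)}$, $T(z)=z\,e^{i(\alpha+(z\bar z)^s)}$, $\tau(z)=\bar z$, and $$\varphi_a=\phi_a\circ T\circ\tau\circ\phi_a^{-1}\circ\tau,$$ a real analytic map of a neighborhood of $0$ in $\mathbb{R}^2=\mathbb{C}$ fixing $0$. Then there exists a sequence $(H_k)_{k\ge 1}$ of functionally independent power series in the variables $a_{i,j}$, each converging for $a\in\Sigma$, with the following property: if $a\in\Sigma$ is fixed and $H_k(a)\neq0$ for some $k$, then there is a closed interval $I_k$ of positive length such that for each $r\in I_k$, $\varphi_a$ has a periodic point on the circle $|z|=r$. Furthermore, for any given $\epsilon>0$, $I_k\subset(0,\epsilon)$ for all sufficiently large $k$.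
   Context: A periodic point of $\varphi_a$ is a fixed point of some iterate $\varphi_a^n$, $n\ge1$. Convergence of a power series in infinitely many variables means absolute convergence. *)

(* Defs.v *)
From HB Require Import structures.
From mathcomp Require Import all_boot all_order all_algebra.
From mathcomp Require Import all_classical all_reals all_analysis.
From mathcomp Require Import complex.

Set Implicit Arguments.
Unset Strict Implicit.
Unset Printing Implicit Defensive.

Import Order.TTheory GRing.Theory Num.Theory numFieldTopology.Exports numFieldNormedType.Exports.
Local Open Scope classical_set_scope.
Local Open Scope ring_scope.

Section Defs.
Variable R : realType.
Local Notation C := R[i].

Definition reC (z : C) : R := complex.Re z.
Definition imC (z : C) : R := complex.Im z.
Definition ofR (x : R) : C := Complex x 0.
Definition conjc (z : C) : C := Complex (complex.Re z) (- complex.Im z).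
Definition modc (z : C) : R := Num.sqrt (complex.Re z ^+ 2 + complex.Im z ^+ 2).
Definition expi (t : R) : C := Complex (cos t) (sin t).

(* The coefficient families a = (a_{i,j}), stored as a : nat -> nat -> C;
   only the entries with i + j > 2s are meaningful. *)
Definition admissible (s : nat) (i j : nat) : bool := (s.*2 < i + j)%N.

Definition Sigma (s : nat) (a : nat -> nat -> C) : Prop :=
  forall i j : nat, admissible s i j ->
    a j i = conjc (a i j) /\ modc (a i j) < 1.

Definition atil_partial (s : nat) (a : nat -> nat -> C) (z : C) (N : nat) : C :=
  \sum_(n < N) \sum_(i < n.+1)
     (if admissible s i (n - i)%N then a i (n - i)%N * z ^+ i * conjc z ^+ (n - i)%N
      else 0).

(* a~ is real-valued for a in Sigma (the terms (i,j),(j,i) are conjugate);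
   its value is the limit of the (real) partial sums. *)
Definition atil (s : nat) (a : nat -> nat -> C) (z : C) : R :=
  limn (fun N => reC (atil_partial s a z N)).

Definition phi_a (s : nat) (a : nat -> nat -> C) (z : C) : C :=
  z * expi (atil s a z).

Definition Tmap (s : nat) (alpha : R) (z : C) : C :=
  z * expi (alpha + modc z ^+ (s.*2)).

Definition tau_c (z : C) : C := conjc z.

(* phi_a is injective on the closed disc |z| <= r, r < 1 (so that the
   series a~ converges and the local inverse phi_a^{-1} makes sense there) *)
Definition inj_on_disc (s : nat) (a : nat -> nat -> C) (r : R) : Prop :=
  r < 1 /\
  forall z w : C, modc z <= r -> modc w <= r -> phi_a s a z = phi_a s a w -> z = w.

(* one step of  varphi_a = phi_a o T o tau_c o phi_a^{-1} o tau_c  inside the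
   disc of radius r: z' = varphi_a z, where u = phi_a^{-1}(tau_c z) is the
   (unique, by injectivity) preimage in the disc *)
Definition varphi_step (s : nat) (alpha : R) (a : nat -> nat -> C) (r : R)
  (z z' : C) : Prop :=
  exists u : C, modc u <= r /\ phi_a s a u = tau_c z /\
                z' = phi_a s a (Tmap s alpha (tau_c u)).

(* varphi_a is defined on the disc |z| <= r and has a periodic point
   (a fixed point of some iterate varphi_a^n, n >= 1) on the circle |z| = r *)
Definition periodic_point_on_circle (s : nat) (alpha : R)
  (a : nat -> nat -> C) (r : R) : Prop :=
  inj_on_disc s a r /\
  exists z : C, modc z = r /\
  exists n : nat, (0 < n)%N /\
  exists orb : nat -> C, orb 0%N = z /\ orb n = z /\
    forall m : nat, (m < n)%N -> varphi_step s alpha a r (orb m) (orb m.+1).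

Definition monomial := (nat * nat -> nat)%type.

Definition msupp (m : monomial) : set (nat * nat) := [set v | m v != 0%N].

Definition admissible_monomial (s : nat) (m : monomial) : Prop :=
  finite_set (msupp m) /\ forall v, m v != 0%N -> admissible s v.1 v.2.

Definition Monomials (s : nat) : set monomial := [set m | admissible_monomial s m].

Definition ipseries := (monomial -> C)%type.

Definition mono_val (a : nat -> nat -> C) (m : monomial) : C :=
  \big[*%R/1%R]_(v \in msupp m) (a v.1 v.2 ^+ m v).

Definition ps_term (c : ipseries) (a : nat -> nat -> C) (m : monomial) : C :=
  c m * mono_val a m.

Definition ps_converges (s : nat) (c : ipseries) (a : nat -> nat -> C) : Prop :=
  summable (Monomials s) (fun m => (modc (ps_term c a m))%:E).

Definition rsum (D : set monomial) (f : monomial -> R) : R :=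
  fine (\esum_(m in D) (Num.max (f m) 0)%:E) -
  fine (\esum_(m in D) (Num.max (- f m) 0)%:E).

Definition ps_val (s : nat) (c : ipseries) (a : nat -> nat -> C) : C :=
  Complex (rsum (Monomials s) (fun m => reC (ps_term c a m)))
          (rsum (Monomials s) (fun m => imC (ps_term c a m))).

Definition ps_deriv (c : ipseries) (v : nat * nat) : ipseries :=
  fun m => ((m v).+1)%:R * c (fun w => (m w + (w == v))%N).

Definition functionally_independent (s : nat) (H : nat -> ipseries) : Prop :=
  forall (n : nat) (ks : 'I_n -> nat), injective ks ->
  exists vs : 'I_n -> nat * nat,
    injective vs /\ (forall q, admissible s (vs q).1 (vs q).2) /\
    exists a : nat -> nat -> C, Sigma s a /\
      \det (\matrix_(p < n, q < n) ps_val s (ps_deriv (H (ks p)) (vs q)) a) != 0.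

End Defs.

(* Main.v *)
(* All the maps involved preserve the circles |z| = r. In the coordinates
   z = w exp (- i a~(conj w)) with w = r exp (i th), one step of varphi_a is the circle map
     th' - A (r, - th') = th + om + A (r, th + om),
   where A (r, x) = a~(r exp (i x)) = O(r^(2s+1)) and om = alpha + r^(2s).
   For a reduced fraction p/q with 2 pi p/q slightly above alpha and for th0 in
   {0, pi/q}, there is exactly one small radius r(th0) for which the orbit of th0 closes up
   after q steps with rotation number p/q. It is found by a contraction argument carried out
   inside an algebra of functions on Sigma given by absolutely convergent power series,
   so log r(th0) is itself such a series, and H_k = log r(0) - log r(pi/q).
   When H_k(a) <> 0, the twist makes the circle maps increase with r, so for r between the
   two radii the displacement of the q-th iterate minus 2 pi p has opposite signs at 0 and
   pi/q, and the intermediate value theorem gives a periodic point.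
   Taking q_k = 2^(k+k0) and p_k odd, the first-order term of H_k in the variable
   a_{q_j,0} vanishes exactly when j <> k, so that the Jacobian at a = 0 is an invertible
   diagonal matrix. *)

Require Import Defs.
From HB Require Import structures.
From mathcomp Require Import all_boot all_order all_algebra.
From mathcomp Require Import all_classical all_reals all_analysis.
From mathcomp Require Import complex finmap.
From mathcomp Require Import ring lra zify.
Import Order.TTheory GRing.Theory Num.Theory.
Import numFieldTopology.Exports numFieldNormedType.Exports.
Local Open Scope classical_set_scope.
Local Open Scope ring_scope.

Set Implicit Arguments.
Unset Strict Implicit.

(** Each H_k must be one power series converging on all of Sigma, so an implicit function theorem
    near a = 0 is too weak. As |a_ij| < 1 bounds every monomial by 1, the l1-norm of the
    coefficients controls a series on all of Sigma; products, exponentials and a~ stay in this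
    algebra, and smallness comes from the radius, not from a. The balance of powers is decisive:
    with d = rk^(2s), one orbit step perturbs the angle by O(d rk). Closing the orbit means that d
    (exp(2s zeta) - 1) is minus the mean perturbation, and division by d still leaves the small
    factor rk. Angle deviations add up over q steps to O(q d rk), which is harmless because p lies
    within 2 of q alpha / (2 pi), so that q d <= 16. The unknown zeta = log (r / rk) keeps r
    positive and turns r^(2s) into d exp(2s zeta). The starting angles 0 and pi/q are the extremes
    of cos(q th), the shape of the leading term in a_(q,0). Coefficients obtained by a fixed point
    are not explicit; the linear ones are read off the values on families where only a_(n,0) = t and
    a_(0,n) = conj t are nonzero. *)

Local Notation cj := Defs.conjc.

(** * Unordered sums of real families *)

Section UnorderedSums.
Variable R : realType.
Implicit Types T U : choiceType.

(** Same splitting into positive and negative parts as [rsum], but over a whole type: series that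
    vanish off [Monomials s] have the same value for both, which is how [represents_val] returns to
    [ps_val]. *)
Definition tsum T (f : T -> R) : R :=
  fine (\esum_(t in [set: T]) (Num.max (f t) 0)%:E) -
  fine (\esum_(t in [set: T]) (Num.max (- f t) 0)%:E).

Definition absum T (f : T -> R) : \bar R := \esum_(t in [set: T]) (`|f t|)%:E.

Lemma absum_ge0 T (f : T -> R) : (0 <= absum f)%E.
Proof. by apply: esum_ge0 => t _; rewrite lee_fin. Qed.

Lemma esum_lty_le T (f g : T -> \bar R) :
  (forall t, (f t <= g t)%E) ->
  (\esum_(t in [set: T]) g t < +oo)%E -> (\esum_(t in [set: T]) f t < +oo)%E.
Proof. by move=> fg; apply: le_lt_trans; apply: le_esum => t _; exact: fg. Qed.

Lemma maxr0_le_norm (x : R) : Num.max x 0 <= `|x|.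
Proof. by rewrite ge_max ler_norm normr_ge0. Qed.

Lemma maxr0_ge0 (x : R) : 0 <= Num.max x 0.
Proof. by rewrite le_max lexx orbT. Qed.

Lemma maxr0B (x : R) : x = Num.max x 0 - Num.max (- x) 0.
Proof.
by case: (leP x 0) => hx; case: (leP (- x) 0) => hy; lra.
Qed.

(** Any decomposition into summable nonnegative functions gives the same value. The identity is
    proved cross-added, as P + H = N + G, so that it stays among nonnegative extended reals. *)
Lemma tsumE T (f g h : T -> R) :
  (forall t, 0 <= g t) -> (forall t, 0 <= h t) ->
  (\esum_(t in [set: T]) (g t)%:E < +oo)%E ->
  (\esum_(t in [set: T]) (h t)%:E < +oo)%E ->
  (forall t, f t = g t - h t) ->
  tsum f = fine (\esum_(t in [set: T]) (g t)%:E) -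
           fine (\esum_(t in [set: T]) (h t)%:E).
Proof.
move=> g0 h0 gfin hfin fE; rewrite /tsum.
set P := (\esum_(t in _) (Num.max (f t) 0)%:E)%E.
set N := (\esum_(t in _) (Num.max (- f t) 0)%:E)%E.
set G := (\esum_(t in _) (g t)%:E)%E.
set H := (\esum_(t in _) (h t)%:E)%E.
have P0 : (0 <= P)%E by apply: esum_ge0 => t _; rewrite lee_fin maxr0_ge0.
have N0 : (0 <= N)%E by apply: esum_ge0 => t _; rewrite lee_fin maxr0_ge0.
have G0 : (0 <= G)%E by apply: esum_ge0 => t _; rewrite lee_fin.
have H0 : (0 <= H)%E by apply: esum_ge0 => t _; rewrite lee_fin.
have Pfin : (P < +oo)%E.
  apply: esum_lty_le gfin => t; rewrite lee_fin ge_max g0 andbT fE.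
  by have := h0 t; lra.
have Nfin : (N < +oo)%E.
  apply: esum_lty_le hfin => t; rewrite lee_fin ge_max h0 andbT fE.
  by have := g0 t; lra.
have e : (P + H = N + G)%E.
  rewrite -!esumD; try by move=> t _; rewrite lee_fin ?maxr0_ge0.
  apply: eq_esum => t _; rewrite -!EFinD; congr (_%:E).
  by have := maxr0B (f t); have := fE t; lra.
have fP : P \is a fin_num by rewrite ge0_fin_numE.
have fN : N \is a fin_num by rewrite ge0_fin_numE.
have fG : G \is a fin_num by rewrite ge0_fin_numE.
have fH : H \is a fin_num by rewrite ge0_fin_numE.
have : fine (P + H)%E = fine (N + G)%E by rewrite e.
by rewrite !fineD//; lra.
Qed.

Lemma esum_pos_lty T (f : T -> R) : (absum f < +oo)%E ->
  (\esum_(t in [set: T]) (Num.max (f t) 0)%:E < +oo)%E.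
Proof. by apply: esum_lty_le => t; rewrite lee_fin maxr0_le_norm. Qed.

Lemma esum_neg_lty T (f : T -> R) : (absum f < +oo)%E ->
  (\esum_(t in [set: T]) (Num.max (- f t) 0)%:E < +oo)%E.
Proof. by apply: esum_lty_le => t; rewrite lee_fin -normrN maxr0_le_norm. Qed.

Lemma esum_pos_fin T (f : T -> R) : (absum f < +oo)%E ->
  (\esum_(t in [set: T]) (Num.max (f t) 0)%:E)%E \is a fin_num.
Proof.
move=> h; rewrite ge0_fin_numE; first exact: esum_pos_lty.
by apply: esum_ge0 => t _; rewrite lee_fin maxr0_ge0.
Qed.

Lemma esum_neg_fin T (f : T -> R) : (absum f < +oo)%E ->
  (\esum_(t in [set: T]) (Num.max (- f t) 0)%:E)%E \is a fin_num.
Proof.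
move=> h; rewrite ge0_fin_numE; first exact: esum_neg_lty.
by apply: esum_ge0 => t _; rewrite lee_fin maxr0_ge0.
Qed.

Lemma eq_tsum T (f g : T -> R) : f =1 g -> tsum f = tsum g.
Proof. by move=> /funext ->. Qed.

Lemma tsumD T (f g : T -> R) : (absum f < +oo)%E -> (absum g < +oo)%E ->
  tsum (fun t => f t + g t) = tsum f + tsum g.
Proof.
move=> hf hg.
rewrite (@tsumE _ _ (fun t => Num.max (f t) 0 + Num.max (g t) 0)
  (fun t => Num.max (- f t) 0 + Num.max (- g t) 0)); first last.
- by move=> t; rewrite {1}(maxr0B (f t)) {1}(maxr0B (g t)); lra.
- under eq_esum do rewrite EFinD.
  rewrite esumD; try by move=> t _; rewrite lee_fin ?maxr0_ge0.
  by rewrite lte_add_pinfty// esum_neg_lty.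
- under eq_esum do rewrite EFinD.
  rewrite esumD; try by move=> t _; rewrite lee_fin ?maxr0_ge0.
  by rewrite lte_add_pinfty// esum_pos_lty.
- by move=> t; rewrite addr_ge0 ?maxr0_ge0.
- by move=> t; rewrite addr_ge0 ?maxr0_ge0.
under eq_esum do rewrite EFinD.
under [X in _ - fine X]eq_esum do rewrite EFinD.
rewrite !esumD; try by move=> t _; rewrite lee_fin ?maxr0_ge0.
rewrite (fineD (esum_pos_fin hf) (esum_pos_fin hg)).
by rewrite (fineD (esum_neg_fin hf) (esum_neg_fin hg)) /tsum; lra.
Qed.

Lemma tsumN T (f : T -> R) : tsum (fun t => - f t) = - tsum f.
Proof.
rewrite /tsum; under [X in _ - fine X]eq_esum do rewrite opprK.
by rewrite opprB.
Qed.

Lemma esumZ_le T (c : R) (f : T -> R) : 0 <= c -> (forall t, 0 <= f t) ->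
  (\esum_(t in [set: T]) (c * f t)%:E <= c%:E * \esum_(t in [set: T]) (f t)%:E)%E.
Proof.
move=> c0 f0; apply: ge_ereal_sup => _ [A Af <-].
under eq_fsbigr do rewrite EFinM.
rewrite -ge0_mule_fsumr; last by move=> t; rewrite lee_fin.
apply: lee_wpmul2l; first by rewrite lee_fin.
by apply: esum_ge; exists A.
Qed.

Lemma esumZ T (c : R) (f : T -> R) : 0 <= c -> (forall t, 0 <= f t) ->
  (\esum_(t in [set: T]) (c * f t)%:E = c%:E * \esum_(t in [set: T]) (f t)%:E)%E.
Proof.
move=> c0 f0; have [->|cn0] := eqVneq c 0.
  by rewrite mul0e esum1// => t _; rewrite mul0r.
apply/eqP; rewrite eq_le esumZ_le//=.
have c_gt0 : 0 < c by rewrite lt_neqAle eq_sym cn0.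
(* The reverse inequality is [esumZ_le] for the inverse constant. *)
have := @esumZ_le T c^-1 (fun t => c * f t).
rewrite invr_ge0 => /(_ c0) h.
have {}h := h (fun t => mulr_ge0 c0 (f0 t)).
have e : (\esum_(t in [set: T]) (c^-1 * (c * f t))%:E = \esum_(t in [set: T]) (f t)%:E)%E.
  by apply: eq_esum => t _; rewrite mulKf.
rewrite e in h.
apply: (le_trans (lee_wpmul2l _ h)); first by rewrite lee_fin.
by rewrite muleA -EFinM mulfV// mul1e.
Qed.

Lemma tsumZ T (c : R) (f : T -> R) : (absum f < +oo)%E ->
  tsum (fun t => c * f t) = c * tsum f.
Proof.
have pos (d : R) : 0 <= d -> (absum f < +oo)%E -> tsum (fun t => d * f t) = d * tsum f.
  move=> d0 hf.
  have hp : (\esum_(t in [set: T]) (d * Num.max (f t) 0)%:E =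
      d%:E * \esum_(t in [set: T]) (Num.max (f t) 0)%:E)%E.
    by apply: esumZ => // t; exact: maxr0_ge0.
  have hn : (\esum_(t in [set: T]) (d * Num.max (- f t) 0)%:E =
      d%:E * \esum_(t in [set: T]) (Num.max (- f t) 0)%:E)%E.
    by apply: esumZ => // t; exact: maxr0_ge0.
  have fp : (\esum_(t in [set: T]) (Num.max (f t) 0)%:E)%E \is a fin_num.
    exact: esum_pos_fin.
  have fn : (\esum_(t in [set: T]) (Num.max (- f t) 0)%:E)%E \is a fin_num.
    exact: esum_neg_fin.
  rewrite (@tsumE _ _ (fun t => d * Num.max (f t) 0)
     (fun t => d * Num.max (- f t) 0)).
  - by rewrite hp hn !fineM//= /tsum mulrBr.
  - by move=> t; rewrite mulr_ge0 ?maxr0_ge0.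
  - by move=> t; rewrite mulr_ge0 ?maxr0_ge0.
  - by rewrite hp -(fineK fp) -EFinM ltry.
  - by rewrite hn -(fineK fn) -EFinM ltry.
  - by move=> t; rewrite {1}(maxr0B (f t)) mulrBr.
move=> hf; have [c0|/ltW c0] := leP 0 c; first exact: pos.
rewrite (_ : (fun t => c * f t) = (fun t => - (- c * f t))).
  by rewrite tsumN pos ?oppr_ge0//; ring.
by apply/funext => t; ring.
Qed.

(** The upper side suffices: [modc_csum_le] first rotates a complex sum onto the positive real
    axis. *)
Lemma norm_tsum_le T (f : T -> R) (M : R) : (absum f <= M%:E)%E -> tsum f <= M.
Proof.
move=> hM; have hf : (absum f < +oo)%E by apply: le_lt_trans hM _; rewrite ltry.
have hp : (\esum_(t in [set: T]) (Num.max (f t) 0)%:E <= M%:E)%E.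
  by apply: le_trans hM; apply: le_esum => t _; rewrite lee_fin maxr0_le_norm.
have fp : (\esum_(t in [set: T]) (Num.max (f t) 0)%:E)%E \is a fin_num.
  rewrite ge0_fin_numE ?esum_pos_lty//.
  by apply: esum_ge0 => t _; rewrite lee_fin maxr0_ge0.
have h0 : 0 <= fine (\esum_(t in [set: T]) (Num.max (- f t) 0)%:E)%E.
  by apply: fine_ge0; apply: esum_ge0 => t _; rewrite lee_fin maxr0_ge0.
have : fine (\esum_(t in [set: T]) (Num.max (f t) 0)%:E)%E <= M.
  by rewrite -lee_fin fineK.
by rewrite /tsum; lra.
Qed.

Lemma esum_swap T U (f : T -> U -> \bar R) : (forall t u, (0 <= f t u)%E) ->
  (\esum_(t in [set: T]) \esum_(u in [set: U]) f t u =
   \esum_(u in [set: U]) \esum_(t in [set: T]) f t u)%E.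
Proof.
move=> f0; rewrite !esum_esum//.
rewrite (reindex_esum ([set: U] `*`` fun=> [set: T]) _ (fun x => (x.2, x.1)))//.
split => //=.
- by move=> [a b] [c d] _ _ [-> ->].
- by move=> [a b] _; exists (b, a).
Qed.

Lemma esum_prod T U (f : T -> U -> \bar R) : (forall t u, (0 <= f t u)%E) ->
  (\esum_(x in [set: T * U]) f x.1 x.2 =
   \esum_(t in [set: T]) \esum_(u in [set: U]) f t u)%E.
Proof.
move=> f0; rewrite esum_esum//; congr esum.
by apply/seteqP; split => // -[].
Qed.

Lemma fine_esumK T (f : T -> R) : (forall t, 0 <= f t) ->
  (\esum_(t in [set: T]) (f t)%:E < +oo)%E ->
  ((fine (\esum_(t in [set: T]) (f t)%:E))%:E = \esum_(t in [set: T]) (f t)%:E)%E.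
Proof.
move=> f0 h; rewrite fineK// ge0_fin_numE//.
by apply: esum_ge0 => t _; rewrite lee_fin.
Qed.

Lemma esum_le_term T (f : T -> \bar R) t : (forall t, 0 <= f t)%E ->
  (f t <= \esum_(t in [set: T]) f t)%E.
Proof.
move=> f0; apply: esum_ge; exists [set t]; last by rewrite fsbig_set1.
by split => //; exact: finite_set1.
Qed.

(** Tonelli for the positive and the negative part. The inner sums of these parts are not the
    positive and negative parts of the inner sums; [tsumE] absorbs the mismatch. *)
Lemma tsum_fubini T U (f : T * U -> R) : (absum f < +oo)%E ->
  tsum f = tsum (fun t => tsum (fun u => f (t, u))).
Proof.
move=> hf; pose p (t : T) (u : U) := Num.max (f (t, u)) 0.
pose n (t : T) (u : U) := Num.max (- f (t, u)) 0.
have p0 t u : 0 <= p t u by exact: maxr0_ge0.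
have n0 t u : 0 <= n t u by exact: maxr0_ge0.
have pE : (\esum_(x in [set: T * U]) (Num.max (f x) 0)%:E =
    \esum_(t in [set: T]) \esum_(u in [set: U]) (p t u)%:E)%E.
  rewrite -(esum_prod (f := fun t u => (p t u)%:E)); last by move=> *; rewrite lee_fin.
  by apply: eq_esum => -[].
have nE : (\esum_(x in [set: T * U]) (Num.max (- f x) 0)%:E =
    \esum_(t in [set: T]) \esum_(u in [set: U]) (n t u)%:E)%E.
  rewrite -(esum_prod (f := fun t u => (n t u)%:E)); last by move=> *; rewrite lee_fin.
  by apply: eq_esum => -[].
have pfin := esum_pos_lty hf; have nfin := esum_neg_lty hf.
rewrite pE in pfin; rewrite nE in nfin.
have ptfin t : (\esum_(u in [set: U]) (p t u)%:E < +oo)%E.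
  apply: le_lt_trans pfin; apply: (esum_le_term (f := fun t => \esum_(u in [set: U]) (p t u)%:E)%E).
  by move=> t'; apply: esum_ge0 => u _; rewrite lee_fin.
have ntfin t : (\esum_(u in [set: U]) (n t u)%:E < +oo)%E.
  apply: le_lt_trans nfin; apply: (esum_le_term (f := fun t => \esum_(u in [set: U]) (n t u)%:E)%E).
  by move=> t'; apply: esum_ge0 => u _; rewrite lee_fin.
rewrite [RHS](@tsumE _ _ (fun t => fine (\esum_(u in [set: U]) (p t u)%:E))
   (fun t => fine (\esum_(u in [set: U]) (n t u)%:E))).
- rewrite /tsum pE nE; congr (fine _ - fine _);
  by apply: eq_esum => t _; rewrite fine_esumK.
- by move=> t; apply: fine_ge0; apply: esum_ge0 => u _; rewrite lee_fin.
- by move=> t; apply: fine_ge0; apply: esum_ge0 => u _; rewrite lee_fin.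
- by under eq_esum do rewrite fine_esumK//.
- by under eq_esum do rewrite fine_esumK//.
- by [].
Qed.

Lemma absum_swap T U (f : T * U -> R) : absum (fun x => f (x.2, x.1)) = absum f.
Proof.
rewrite /absum (esum_prod (f := fun u t => (`|f (t, u)|)%:E))//.
rewrite esum_swap// -(esum_prod (f := fun t u => (`|f (t, u)|)%:E))//.
by apply: eq_esum => -[].
Qed.

Lemma tsum_swap_pair T U (f : T * U -> R) : tsum (fun x => f (x.2, x.1)) = tsum f.
Proof.
have aux (g : T * U -> R) : (forall x, 0 <= g x) ->
  (\esum_(x in [set: U * T]) (g (x.2, x.1))%:E = \esum_(x in [set: T * U]) (g x)%:E)%E.
  move=> g0; rewrite (esum_prod (f := fun u t => (g (t, u))%:E)); last by move=> *; rewrite lee_fin.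
  rewrite esum_swap; last by move=> *; rewrite lee_fin.
  rewrite -(esum_prod (f := fun t u => (g (t, u))%:E)); last by move=> *; rewrite lee_fin.
  by apply: eq_esum => -[].
rewrite /tsum; congr (fine _ - fine _).
  by rewrite (aux (fun x => Num.max (f x) 0))// => x; exact: maxr0_ge0.
by rewrite (aux (fun x => Num.max (- f x) 0))// => x; exact: maxr0_ge0.
Qed.

Lemma tsum_exchange T U (f : T -> U -> R) :
  (absum (fun x : T * U => f x.1 x.2) < +oo)%E ->
  tsum (fun t => tsum (fun u => f t u)) = tsum (fun u => tsum (fun t => f t u)).
Proof.
move=> hf; rewrite -(@tsum_fubini T U (fun x => f x.1 x.2))//.
rewrite -(@tsum_fubini U T (fun x => f x.2 x.1)).
  by rewrite -(tsum_swap_pair (fun x => f x.1 x.2)).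
by rewrite (absum_swap (fun x => f x.1 x.2)).
Qed.

Lemma esum_single T (f : T -> \bar R) (t0 : T) : (0 <= f t0)%E ->
  (forall t, t != t0 -> f t = 0%E) -> (\esum_(t in [set: T]) f t = f t0)%E.
Proof.
move=> f0 h; rewrite -(esum_set1 (a := f) (t := t0))// [RHS]esum_mkcond.
apply: eq_esum => t _; have [->|tt0] := eqVneq t t0; first by rewrite mem_set.
by rewrite memNset ?h//; exact/eqP.
Qed.

Lemma tsum_single T (f : T -> R) (t0 : T) :
  (forall t, t != t0 -> f t = 0) -> tsum f = f t0.
Proof.
move=> h; rewrite /tsum !(@esum_single _ _ t0) ?lee_fin ?maxr0_ge0//=.
- by rewrite -maxr0B.
- by move=> t /h ->; rewrite oppr0 maxxx.
- by move=> t /h ->; rewrite maxxx.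
Qed.

Lemma esum_nat_lim (f : nat -> R) : (forall n, 0 <= f n) ->
  (\esum_(n in [set: nat]) (f n)%:E < +oo)%E ->
  series f @ \oo --> fine (\esum_(n in [set: nat]) (f n)%:E).
Proof.
move=> f0 hf.
have e : ((\esum_(n in [set: nat]) (f n)%:E) = \sum_(0 <= i <oo) (f i)%:E)%E.
  by rewrite nneseries_esumT// => n; rewrite lee_fin.
have c : (\sum_(0 <= i < n) (f i)%:E)%E @[n --> \oo] --> (\esum_(n in [set: nat]) (f n)%:E)%E.
  by rewrite e; apply: is_cvg_nneseries => n _ _; rewrite lee_fin.
rewrite -(fine_esumK f0 hf) in c.
apply: cvg_trans (fine_cvg c); apply: near_eq_cvg.
by near=> n; rewrite /= sumEFin.
Unshelve. all: by end_near. Qed.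

Lemma tsum_nat (f : nat -> R) (l : R) : (absum f < +oo)%E ->
  series f @ \oo --> l -> tsum f = l.
Proof.
move=> hf cl.
have cp := esum_nat_lim (fun n => maxr0_ge0 (f n)) (esum_pos_lty hf).
have cn := esum_nat_lim (fun n => maxr0_ge0 (- f n)) (esum_neg_lty hf).
have eS n : series (fun n => Num.max (f n) 0) n - series (fun n => Num.max (- f n) 0) n
    = series f n.
  rewrite /series /= -sumrB.
  by apply: eq_bigr => k _; rewrite -maxr0B.
have cc : series f @ \oo --> tsum f.
  apply: cvg_trans (cvgB cp cn); apply: near_eq_cvg; near=> n.
  exact: eS.
exact: (cvg_unique _ cc cl).
Unshelve. all: by end_near. Qed.

End UnorderedSums.

(** * Complex numbers and unordered complex sums *)

Section Modulus.
Variable R : realType.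
Implicit Types z w : R[i].

Lemma modcE z : modc z = ComplexField.Normc.normc z.
Proof. by case: z. Qed.

Lemma modcM z w : modc (z * w) = modc z * modc w.
Proof. by rewrite !modcE ComplexField.Normc.normcM. Qed.

Lemma modcD z w : modc (z + w) <= modc z + modc w.
Proof. by rewrite !modcE le_normcD. Qed.

Lemma modcN z : modc (- z) = modc z.
Proof. by case: z => a b; rewrite /modc /= !sqrrN. Qed.

Lemma modc_ge0 z : 0 <= modc z.
Proof. exact: sqrtr_ge0. Qed.

Lemma modc0 : modc (0 : R[i]) = 0.
Proof. by rewrite /modc /= expr0n /= addr0 sqrtr0. Qed.

Lemma modc1 : modc (1 : R[i]) = 1.
Proof. by rewrite /modc /= expr0n /= addr0 expr1n sqrtr1. Qed.

Lemma modcX z n : modc (z ^+ n) = modc z ^+ n.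
Proof. by elim: n => [|n IH]; rewrite ?expr0 ?modc1// !exprS modcM IH. Qed.

Lemma modc_eq0 z : modc z = 0 -> z = 0.
Proof. by rewrite modcE => /ComplexField.Normc.eq0_normc. Qed.

Lemma modc_ofR (x : R) : modc (ofR x) = `|x|.
Proof. by rewrite /modc /= expr0n /= addr0 sqrtr_sqr. Qed.

Lemma modc_cj z : modc (cj z) = modc z.
Proof. by rewrite /modc /= sqrrN. Qed.

Lemma modc_expi (t : R) : modc (expi t) = 1.
Proof. by rewrite /modc /= cos2Dsin2 sqrtr1. Qed.

Lemma Re_le_modc z : `|reC z| <= modc z.
Proof.
rewrite -sqrtr_sqr ler_sqrt; first by rewrite lerDl sqr_ge0.
by rewrite addr_ge0 ?sqr_ge0.
Qed.

Lemma Im_le_modc z : `|imC z| <= modc z.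
Proof.
rewrite -sqrtr_sqr ler_sqrt; first by rewrite lerDr sqr_ge0.
by rewrite addr_ge0 ?sqr_ge0.
Qed.

Lemma ofRD (x y : R) : ofR (x + y) = ofR x + ofR y.
Proof. by apply/eqP; rewrite eq_complex /= addr0 !eqxx. Qed.

Lemma ofRN (x : R) : ofR (- x) = - ofR x.
Proof. by apply/eqP; rewrite eq_complex /= oppr0 !eqxx. Qed.

Lemma ofRB (x y : R) : ofR (x - y) = ofR x - ofR y.
Proof. by rewrite ofRD ofRN. Qed.

Lemma ofRM (x y : R) : ofR (x * y) = ofR x * ofR y.
Proof. by apply/eqP; rewrite eq_complex /= !(mul0r, mulr0, subr0, addr0) !eqxx. Qed.

Lemma ofR0 : ofR (0 : R) = 0.
Proof. by []. Qed.

Lemma ofR1 : ofR (1 : R) = 1.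
Proof. by []. Qed.

Lemma ofRX (x : R) n : ofR (x ^+ n) = ofR x ^+ n.
Proof. by elim: n => [|n IH]; rewrite ?expr0// !exprS ofRM IH. Qed.

Lemma ofR_sum (I : Type) (r : seq I) (P : pred I) (F : I -> R) :
  ofR (\sum_(i <- r | P i) F i) = \sum_(i <- r | P i) ofR (F i).
Proof.
by elim/big_rec2: _ => [|i x y _ <-]; rewrite ?ofR0// ofRD.
Qed.

Lemma reCD z w : reC (z + w) = reC z + reC w.
Proof. by case: z; case: w. Qed.

Lemma imCD z w : imC (z + w) = imC z + imC w.
Proof. by case: z; case: w. Qed.

Lemma reC_sum (I : Type) (r : seq I) (P : pred I) (F : I -> R[i]) :
  reC (\sum_(i <- r | P i) F i) = \sum_(i <- r | P i) reC (F i).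
Proof.
by elim/big_rec2: _ => [|i x y _ <-]; rewrite ?reCD.
Qed.

Lemma imC_sum (I : Type) (r : seq I) (P : pred I) (F : I -> R[i]) :
  imC (\sum_(i <- r | P i) F i) = \sum_(i <- r | P i) imC (F i).
Proof.
by elim/big_rec2: _ => [|i x y _ <-]; rewrite ?imCD.
Qed.

Lemma complex_eqP z w : reC z = reC w -> imC z = imC w -> z = w.
Proof. by case: z => a b; case: w => c d /= -> ->. Qed.

Lemma cjM z w : cj (z * w) = cj z * cj w.
Proof. by apply: complex_eqP; case: z => a b; case: w => c d /=; ring. Qed.

Lemma cjD z w : cj (z + w) = cj z + cj w.
Proof. by apply: complex_eqP; case: z => a b; case: w => c d /=; ring. Qed.

Lemma cjX z n : cj (z ^+ n) = cj z ^+ n.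
Proof.
elim: n => [|n IH]; last by rewrite !exprS cjM IH.
by apply: complex_eqP => //=; rewrite oppr0.
Qed.

Lemma cj_mul z : cj z * z = ofR (modc z ^+ 2).
Proof.
apply: complex_eqP; case: z => a b /=; last by ring.
rewrite /modc sqr_sqrtr ?addr_ge0 ?sqr_ge0//=.
by ring.
Qed.

Lemma cjK z : cj (cj z) = z.
Proof. by apply: complex_eqP; case: z => a b //=; rewrite opprK. Qed.

Lemma cj_ofR (x : R) : cj (ofR x) = ofR x.
Proof. by apply: complex_eqP => //=; rewrite oppr0. Qed.

Lemma cj_expi (x : R) : cj (expi x) = expi (- x).
Proof. by apply: complex_eqP => /=; rewrite ?cosN ?sinN. Qed.

Lemma cj_sum (I : Type) (r : seq I) (P : pred I) (F : I -> R[i]) :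
  cj (\sum_(i <- r | P i) F i) = \sum_(i <- r | P i) cj (F i).
Proof.
elim/big_rec2: _ => [|i x y _ <-]; rewrite ?cjD//.
by apply: complex_eqP => //=; rewrite oppr0.
Qed.

Lemma expiD (x y : R) : expi (x + y) = expi x * expi y.
Proof. by apply: complex_eqP => /=; rewrite ?cosD ?sinD; ring. Qed.

Lemma expi0 : expi (0 : R) = 1.
Proof. by apply: complex_eqP => /=; rewrite ?cos0 ?sin0. Qed.

Lemma expiX (x : R) n : expi x ^+ n = expi (n%:R * x).
Proof.
elim: n => [|n IH]; first by rewrite mul0r expi0.
by rewrite exprS IH -expiD; congr expi; rewrite -natr1; ring.
Qed.

End Modulus.

Section ComplexSums.
Variable R : realType.
Local Notation C := R[i].
Implicit Types T U : choiceType.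

Definition cabsum T (f : T -> C) : \bar R := \esum_(t in [set: T]) (modc (f t))%:E.

Definition csum T (f : T -> C) : C :=
  Complex (tsum (fun t => reC (f t))) (tsum (fun t => imC (f t))).

Lemma cabsum_ge0 T (f : T -> C) : (0 <= cabsum f)%E.
Proof. by apply: esum_ge0 => t _; rewrite lee_fin modc_ge0. Qed.

Lemma cabsum_re T (f : T -> C) : (cabsum f < +oo)%E ->
  (absum (fun t => reC (f t)) < +oo)%E.
Proof. by apply: esum_lty_le => t; rewrite lee_fin Re_le_modc. Qed.

Lemma cabsum_im T (f : T -> C) : (cabsum f < +oo)%E ->
  (absum (fun t => imC (f t)) < +oo)%E.
Proof. by apply: esum_lty_le => t; rewrite lee_fin Im_le_modc. Qed.

Lemma eq_csum T (f g : T -> C) : f =1 g -> csum f = csum g.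
Proof. by move=> /funext ->. Qed.

Lemma eq_cabsum T (f g : T -> C) : f =1 g -> cabsum f = cabsum g.
Proof. by move=> /funext ->. Qed.

Lemma cabsumZ T (c : C) (f : T -> C) :
  cabsum (fun t => c * f t) = ((modc c)%:E * cabsum f)%E.
Proof.
rewrite /cabsum -esumZ ?modc_ge0//; last by move=> t; exact: modc_ge0.
by apply: eq_esum => t _; rewrite modcM.
Qed.

Lemma absumZ_lty T (c : R) (f : T -> R) : (absum f < +oo)%E ->
  (absum (fun t => c * f t)%R < +oo)%E.
Proof.
move=> h; rewrite /absum; under eq_esum do rewrite normrM.
rewrite esumZ// -/(absum f).
have /fineK <- : absum f \is a fin_num by rewrite ge0_fin_numE ?absum_ge0.
by rewrite -EFinM ltry.
Qed.

Lemma csumZ T (c : C) (f : T -> C) : (cabsum f < +oo)%E ->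
  csum (fun t => c * f t) = c * csum f.
Proof.
move=> hf; have hr := cabsum_re hf; have hi := cabsum_im hf.
have -> : csum (fun t => c * f t) = Complex
   (tsum (fun t => reC c * reC (f t) + (- imC c) * imC (f t)))
   (tsum (fun t => reC c * imC (f t) + imC c * reC (f t))).
  by congr Complex; apply: eq_tsum => t; case: c => x y; case: (f t) => u v /=; ring.
rewrite (tsumD (absumZ_lty _ hr) (absumZ_lty _ hi)).
rewrite (tsumD (absumZ_lty _ hi) (absumZ_lty _ hr)).
rewrite !(tsumZ _ hr) !(tsumZ _ hi).
by apply: complex_eqP; case: c => x y /=; ring.
Qed.

Lemma csumD T (f g : T -> C) : (cabsum f < +oo)%E -> (cabsum g < +oo)%E ->
  csum (fun t => f t + g t) = csum f + csum g.
Proof.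
move=> hf hg.
apply: complex_eqP; rewrite ?reCD ?imCD /=.
  under eq_tsum do rewrite reCD.
  by rewrite (tsumD (cabsum_re hf) (cabsum_re hg)).
under eq_tsum do rewrite imCD.
by rewrite (tsumD (cabsum_im hf) (cabsum_im hg)).
Qed.

Lemma csum_exchange T U (f : T -> U -> C) :
  (cabsum (fun x : T * U => f x.1 x.2) < +oo)%E ->
  csum (fun t => csum (fun u => f t u)) = csum (fun u => csum (fun t => f t u)).
Proof.
move=> h; rewrite /csum /=; congr Complex.
- by rewrite (tsum_exchange (f := fun t u => reC (f t u)))//; exact: (cabsum_re h).
- by rewrite (tsum_exchange (f := fun t u => imC (f t u)))//; exact: (cabsum_im h).
Qed.

Lemma csum_fubini T U (f : T * U -> C) : (cabsum f < +oo)%E ->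
  csum f = csum (fun t => csum (fun u => f (t, u))).
Proof.
move=> h; rewrite /csum /=; congr Complex.
- by rewrite (tsum_fubini (cabsum_re h)).
- by rewrite (tsum_fubini (cabsum_im h)).
Qed.

Lemma csum_single T (f : T -> C) (t0 : T) :
  (forall t, t != t0 -> f t = 0) -> csum f = f t0.
Proof.
move=> h; rewrite /csum !(@tsum_single _ _ _ t0); first by case: (f t0).
all: by move=> t /h ->.
Qed.

Lemma csum_nat (f : nat -> C) (l : C) : (cabsum f < +oo)%E ->
  (fun N => reC (\sum_(n < N) f n)) @ \oo --> reC l ->
  (fun N => imC (\sum_(n < N) f n)) @ \oo --> imC l ->
  csum f = l.
Proof.
move=> h hr hi; apply: complex_eqP; apply: tsum_nat.
- exact: cabsum_re.
- apply: cvg_trans hr; apply: near_eq_cvg; near=> n.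
  by rewrite /series /= reC_sum big_mkord.
- exact: cabsum_im.
- apply: cvg_trans hi; apply: near_eq_cvg; near=> n.
  by rewrite /series /= imC_sum big_mkord.
Unshelve. all: by end_near. Qed.

Lemma modc_csum_le T (f : T -> C) (M : R) : (cabsum f <= M%:E)%E ->
  modc (csum f) <= M.
Proof.
move=> hM; have hf : (cabsum f < +oo)%E by apply: le_lt_trans hM _; rewrite ltry.
have [S0|Sn0] := eqVneq (modc (csum f)) 0.
  by rewrite S0 -lee_fin; apply: le_trans hM; exact: cabsum_ge0.
set S := csum f in Sn0 *.
(* The unit phase that makes [u * S] real and equal to the modulus of [S]. *)
pose u := ofR (modc S)^-1 * cj S.
have uS : u * S = ofR (modc S).
  have -> : u * S = ofR (modc S)^-1 * ofR (modc S ^+ 2).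
    by rewrite /u -mulrA cj_mul.
  by rewrite -ofRM expr2 mulKf.
have mu : modc u = 1.
  by rewrite modcM modc_ofR modc_cj ger0_norm ?invr_ge0 ?modc_ge0// mulVf.
have -> : modc S = reC (csum (fun t => u * f t)).
  by rewrite csumZ// -/S uS.
apply: norm_tsum_le; apply: le_trans hM; apply: le_esum => t _.
by rewrite lee_fin; apply: (le_trans (Re_le_modc _)); rewrite modcM mu mul1r.
Qed.

Lemma cabsum_prod T U (f : T -> U -> C) :
  cabsum (fun x : T * U => f x.1 x.2) =
  (\esum_(t in [set: T]) cabsum (f t))%E.
Proof.
by rewrite /cabsum (esum_prod (f := fun t u => (modc (f t u))%:E))// => t u; rewrite lee_fin modc_ge0.
Qed.

Lemma cabsum_prodM T U (f : T -> C) (g : U -> C) (M N : R) :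
  (cabsum f <= M%:E)%E -> (cabsum g <= N%:E)%E ->
  (cabsum (fun x : T * U => (f x.1 * g x.2)%R) <= (M * N)%:E)%E.
Proof.
move=> hf hg; rewrite (cabsum_prod (fun t u => f t * g u)).
have gfin : cabsum g \is a fin_num.
  by rewrite ge0_fin_numE ?cabsum_ge0//; apply: le_lt_trans hg _; rewrite ltry.
have N0 : 0 <= fine (cabsum g) by apply: fine_ge0; exact: cabsum_ge0.
have -> : (\esum_(t in [set: T]) cabsum (fun u => (f t * g u)%R) =
    (fine (cabsum g))%:E * cabsum f)%E.
  rewrite /cabsum -esumZ//; last by move=> t; exact: modc_ge0.
  apply: eq_esum => t _; rewrite -[LHS]/(cabsum (fun u => f t * g u)) cabsumZ.
  by rewrite -(fineK gfin) -EFinM mulrC.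
rewrite fineK// muleC EFinM; apply: lee_pmul => //; exact: cabsum_ge0.
Qed.

Lemma csum_prodM T U (f : T -> C) (g : U -> C) :
  (cabsum f < +oo)%E -> (cabsum g < +oo)%E ->
  csum (fun x : T * U => f x.1 * g x.2) = csum f * csum g.
Proof.
move=> hf hg; have ff : cabsum f \is a fin_num by rewrite ge0_fin_numE ?cabsum_ge0.
have gf : cabsum g \is a fin_num by rewrite ge0_fin_numE ?cabsum_ge0.
rewrite csum_fubini /=.
  under eq_csum do rewrite csumZ//.
  rewrite mulrC -csumZ//; apply: eq_csum => t; exact: mulrC.
apply: le_lt_trans (@cabsum_prodM _ _ f g (fine (cabsum f)) (fine (cabsum g)) _ _) _.
- by rewrite fineK.
- by rewrite fineK.
- by rewrite ltry.
Qed.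

End ComplexSums.

(** * Functions represented by power series on Sigma *)

Section Monomials.
Variable R : realType.
Local Notation C := R[i].
Variable s : nat.
Implicit Types (a : nat -> nat -> C) (m : monomial).

Definition mono1 : monomial := fun=> 0%N.
Definition monoX (v : nat * nat) : monomial := fun w => (w == v : nat).
Definition monoM m1 m2 : monomial := fun v => (m1 v + m2 v)%N.

(** [mono_val] multiplies over a support that varies with the monomial; a common finite superset
    makes two values comparable factor by factor. *)
Lemma mono_valE a m (B : set (nat * nat)) : finite_set B -> msupp m `<=` B ->
  mono_val a m = \prod_(v <- fset_set B) a v.1 v.2 ^+ m v.
Proof.
move=> fB mB; rewrite /mono_val (fsbig_widen _ B)//.
  by rewrite fsbig_finite.
move=> v [_ /= /negP]; rewrite negbK => /eqP ->.
by rewrite expr0.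
Qed.

Lemma mono_val1 a : mono_val a mono1 = 1.
Proof.
by rewrite (@mono_valE _ _ set0)// fset_set0 big_seq_fset0.
Qed.

Lemma msupp_monoX v : msupp (monoX v) `<=` [set v].
Proof. by move=> w; rewrite /msupp /monoX /=; case: (eqVneq w v). Qed.

Lemma mono_valX a v : mono_val a (monoX v) = a v.1 v.2.
Proof.
rewrite (@mono_valE _ _ [set v])//; last exact: msupp_monoX.
by rewrite fset_set1 big_seq_fset1 /monoX eqxx expr1.
Qed.

Lemma msupp_monoM m1 m2 : msupp (monoM m1 m2) `<=` msupp m1 `|` msupp m2.
Proof.
move=> v; rewrite /msupp /monoM /= addn_eq0 negb_and => /orP[]; by [left|right].
Qed.

Lemma admissible_mono1 : Monomials s mono1.
Proof.
split=> //; rewrite (_ : msupp mono1 = set0)//.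
by apply/seteqP; split => v.
Qed.

Lemma admissible_monoX v : admissible s v.1 v.2 -> Monomials s (monoX v).
Proof.
move=> av; split; first exact: sub_finite_set (@msupp_monoX v) (finite_set1 _).
by move=> w; rewrite /monoX; case: (eqVneq w v) => // ->.
Qed.

Lemma admissible_monoM m1 m2 : Monomials s m1 -> Monomials s m2 ->
  Monomials s (monoM m1 m2).
Proof.
move=> [f1 a1] [f2 a2]; split.
  apply: sub_finite_set (@msupp_monoM m1 m2) _; by rewrite finite_setU.
by move=> v; rewrite /monoM addn_eq0 negb_and => /orP[]; [exact: a1|exact: a2].
Qed.

Lemma mono_valM a m1 m2 : Monomials s m1 -> Monomials s m2 ->
  mono_val a (monoM m1 m2) = mono_val a m1 * mono_val a m2.
Proof.
move=> [f1 _] [f2 _].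
have fB : finite_set (msupp m1 `|` msupp m2) by rewrite finite_setU.
rewrite !(@mono_valE _ _ (msupp m1 `|` msupp m2))//.
- by rewrite -big_split /=; apply: eq_bigr => v _; rewrite exprD.
- exact: msupp_monoM.
Qed.

(** This is why summable coefficients alone give convergence everywhere on Sigma. *)
Lemma modc_mono_val_le1 a m : Sigma s a -> Monomials s m -> modc (mono_val a m) <= 1.
Proof.
move=> Sa [fm am]; rewrite (@mono_valE _ _ (msupp m))//.
rewrite big_seq; elim/big_rec: _ => [|v x]; first by rewrite modc1.
rewrite in_fset_set// => /set_mem mv hx; rewrite modcM modcX.
have [_ /ltW h] := Sa _ _ (am _ mv).
by rewrite -[leRHS]mulr1; apply: ler_pM => //; rewrite ?exprn_ge0 ?modc_ge0// exprn_ile1 ?modc_ge0.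
Qed.

(** The first clause lets all sums run over the type [monomial]. The function is constrained only on
    Sigma, so equalities that use the symmetry of [a] are allowed. *)
Definition represents (M : R) (c : ipseries R) (f : (nat -> nat -> C) -> C) : Prop :=
  [/\ forall m, ~ Monomials s m -> c m = 0,
      (cabsum c <= M%:E)%E &
      forall a, Sigma s a -> f a = csum (fun m => c m * mono_val a m)].

(* [M] bounds the l1-norm of the coefficients and plays the role of a Banach algebra norm. *)
Definition rep (M : R) (f : (nat -> nat -> C) -> C) : Prop := exists c, represents M c f.

Lemma cabsum_term_le (T : choiceType) (c : T -> C) (mu : T -> monomial) a : Sigma s a ->
  (forall t, c t != 0 -> Monomials s (mu t)) ->
  (cabsum (fun t => (c t * mono_val a (mu t))%R) <= cabsum c)%E.
Proof.
move=> Sa adm; apply: le_esum => t _; rewrite lee_fin modcM.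
have [->|/adm h] := eqVneq (c t) 0; first by rewrite modc0 mul0r.
by rewrite -[leRHS]mulr1 ler_wpM2l ?modc_ge0// modc_mono_val_le1.
Qed.

Lemma rep_ext M f g : (forall a, Sigma s a -> f a = g a) -> rep M f -> rep M g.
Proof.
move=> fg [c [c0 cM cf]]; exists c; split => // a Sa.
by rewrite -fg// cf.
Qed.

Lemma rep_le M N f : M <= N -> rep M f -> rep N f.
Proof.
move=> MN [c [c0 cM cf]]; exists c; split => //.
by apply: (le_trans cM); rewrite lee_fin.
Qed.

Lemma rep_ge0 M f : rep M f -> 0 <= M.
Proof.
by move=> [c [_ cM _]]; rewrite -lee_fin; apply: le_trans cM; exact: cabsum_ge0.
Qed.

Lemma rep_bound M f a : rep M f -> Sigma s a -> modc (f a) <= M.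
Proof.
move=> [c [c0 cM cf]] Sa; rewrite cf//; apply: modc_csum_le.
apply: le_trans cM; apply: cabsum_term_le => // m cm.
by apply: contrapT => /c0 h; rewrite h eqxx in cm.
Qed.

(* Terms carrying the same monomial are collected by exchanging the order of summation. *)
Lemma rep_collect (T : choiceType) (c : T -> C) (mu : T -> monomial) M f :
  (forall t, c t != 0 -> Monomials s (mu t)) ->
  (cabsum c <= M%:E)%E ->
  (forall a, Sigma s a -> f a = csum (fun t => c t * mono_val a (mu t))) ->
  rep M f.
Proof.
move=> adm cM cf.
pose d (m : monomial) (t : T) : C := if mu t == m then c t else 0.
have dsingle t m : m != mu t -> d m t = 0.
  by rewrite /d eq_sym; case: eqP.
have dabs t : (\esum_(m in [set: monomial]) (modc (d m t))%:E = (modc (c t))%:E)%E.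
  rewrite (@esum_single _ _ _ (mu t)) ?lee_fin ?modc_ge0//.
    by rewrite /d eqxx.
  by move=> m /dsingle ->; rewrite modc0.
have dtot : (\esum_(m in [set: monomial]) cabsum (d m) = cabsum c)%E.
  rewrite /cabsum (esum_swap (f := fun m t => (modc (d m t))%:E)).
    by apply: eq_esum => t _; rewrite dabs.
  by move=> m t; rewrite lee_fin modc_ge0.
have cfin : (cabsum c < +oo)%E by apply: le_lt_trans cM _; rewrite ltry.
have dfin m : (cabsum (d m) < +oo)%E.
  apply: le_lt_trans cfin; rewrite -dtot.
  by apply: (esum_le_term (f := fun m => cabsum (d m))) => m'; exact: cabsum_ge0.
exists (fun m => csum (d m)); split.
- move=> m nm; rewrite (_ : d m = fun=> 0).
    by apply: complex_eqP => /=; rewrite /tsum oppr0 maxxx subrr.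
  apply/funext => t; rewrite /d; case: eqP => // e.
  apply/eqP; apply: contrapT => /negP /adm; by rewrite e.
- apply: le_trans cM; rewrite -dtot; apply: le_esum => m _.
  have fin_d : cabsum (d m) \is a fin_num by rewrite ge0_fin_numE ?cabsum_ge0.
  by rewrite -(fineK fin_d) lee_fin; apply: modc_csum_le; rewrite fineK.
- move=> a Sa; rewrite cf//.
  have e m : csum (d m) * mono_val a m = csum (fun t => d m t * mono_val a (mu t)).
    rewrite mulrC -csumZ//; apply: eq_csum => t; rewrite /d; case: eqP => [->|_].
      exact: mulrC.
    by rewrite mul0r mulr0.
  under [RHS]eq_csum do rewrite e.
  rewrite (csum_exchange (f := fun m t => d m t * mono_val a (mu t))).
    apply: eq_csum => t; rewrite (@csum_single _ _ _ (mu t)); last first.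
      by move=> m /dsingle ->; rewrite mul0r.
    by rewrite /d eqxx.
  rewrite (cabsum_prod (fun m t => d m t * mono_val a (mu t))).
  apply: le_lt_trans cfin; rewrite -dtot; apply: le_esum => m _.
  apply: cabsum_term_le => // t; rewrite /d; case: (mu t =P m) => [_|_ /negP[]//].
  exact: adm.
Qed.

Lemma rep_const (z : C) : rep (modc z) (fun=> z).
Proof.
apply: (@rep_collect unit (fun=> z) (fun=> mono1)).
- by move=> *; exact: admissible_mono1.
- by rewrite /cabsum (@esum_single _ _ _ tt) ?lee_fin ?modc_ge0// => -[].
- move=> a _; rewrite (@csum_single _ _ _ tt); first by rewrite mono_val1 mulr1.
  by case.
Qed.

Lemma rep_var i j : admissible s i j -> rep 1 (fun a => a i j).
Proof.
move=> aij; apply: (@rep_collect unit (fun=> 1) (fun=> monoX (i, j))).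
- by move=> *; exact: admissible_monoX.
- by rewrite /cabsum (@esum_single _ _ _ tt) ?lee_fin ?modc_ge0// ?modc1// => -[].
- move=> a _; rewrite (@csum_single _ _ _ tt); first by rewrite mono_valX mul1r.
  by case.
Qed.

Lemma rep_supp M (c : monomial -> C) : (cabsum c <= M%:E)%E -> (cabsum c < +oo)%E.
Proof. by move=> cM; apply: le_lt_trans cM _; rewrite ltry. Qed.

Lemma rep_mul M N f g : rep M f -> rep N g -> rep (M * N) (fun a => f a * g a).
Proof.
move=> [c [c0 cM cf]] [d [d0 dM df]].
have c0' m : c m != 0 -> Monomials s m.
  by move=> cm; apply: contrapT => /c0 h; rewrite h eqxx in cm.
have d0' m : d m != 0 -> Monomials s m.
  by move=> dm; apply: contrapT => /d0 h; rewrite h eqxx in dm.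
apply: (@rep_collect (monomial * monomial)%type (fun x => c x.1 * d x.2)
   (fun x => monoM x.1 x.2)).
- move=> [m1 m2] /=; rewrite mulf_eq0 negb_or => /andP[/c0' h1 /d0' h2].
  exact: admissible_monoM.
- exact: cabsum_prodM.
- move=> a Sa; rewrite cf// df// -csum_prodM.
  + apply: eq_csum => -[m1 m2] /=.
    have [->|/c0' h1] := eqVneq (c m1) 0; first by rewrite !mul0r.
    have [->|/d0' h2] := eqVneq (d m2) 0; first by rewrite mul0r !mulr0 mul0r.
    by rewrite mono_valM//; ring.
  + apply: le_lt_trans (rep_supp cM); exact: cabsum_term_le.
  + apply: le_lt_trans (rep_supp dM); exact: cabsum_term_le.
Qed.

(** Completeness of the algebra: norms must be summable, but the sum itself need only be identified
    pointwise on Sigma. The double family of coefficients is regrouped by [rep_collect]. *)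
Lemma rep_series (M : nat -> R) (K : R) (f : nat -> (nat -> nat -> C) -> C) g :
  (forall n, rep (M n) (f n)) ->
  (forall N, \sum_(n < N) M n <= K) ->
  (forall a, Sigma s a ->
    (fun N => reC (\sum_(n < N) f n a)) @ \oo --> reC (g a) /\
    (fun N => imC (\sum_(n < N) f n a)) @ \oo --> imC (g a)) ->
  rep K g.
Proof.
move=> rf MK cg.
have [c cP] := choice rf.
have c0' n m : c n m != 0 -> Monomials s m.
  have [c0 _ _] := cP n.
  by move=> cm; apply: contrapT => /c0 h; rewrite h eqxx in cm.
have M0 n : 0 <= M n by exact: rep_ge0 (rf n).
have cK : (cabsum (fun x : nat * monomial => c x.1 x.2) <= K%:E)%E.
  rewrite (cabsum_prod c); apply: (@le_trans _ _ (\esum_(n in [set: nat]) (M n)%:E)%E).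
    by apply: le_esum => n _; have [] := cP n.
  rewrite -nneseries_esumT; last by move=> n; rewrite lee_fin.
  apply: lime_le.
    by apply: is_cvg_nneseries => n _ _; rewrite lee_fin.
  by apply: nearW => N; rewrite sumEFin lee_fin big_mkord.
apply: (@rep_collect (nat * monomial)%type (fun x => c x.1 x.2) (fun x => x.2)) => //.
  by move=> [n m] /=; exact: c0'.
move=> a Sa.
have h1 : (cabsum (fun x : nat * monomial => (c x.1 x.2 * mono_val a x.2)%R) < +oo)%E.
  apply: le_lt_trans (_ : _ < +oo)%E; last first.
    by apply: le_lt_trans cK _; rewrite ltry.
  by apply: cabsum_term_le => // -[n m] /=; exact: c0'.
rewrite csum_fubini//=; have [cre cim] := cg _ Sa.
have e n : csum (fun m => c n m * mono_val a m) = f n a by have [_ _ ->] := cP n.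
apply/esym; apply: csum_nat.
- under eq_cabsum do rewrite e.
  apply: le_lt_trans (_ : _ <= \esum_(n in [set: nat]) (M n)%:E)%E _.
    by apply: le_esum => n _; rewrite lee_fin; exact: rep_bound.
  rewrite -nneseries_esumT; last by move=> n; rewrite lee_fin.
  apply: (@le_lt_trans _ _ K%:E); last by rewrite ltry.
  apply: lime_le.
    by apply: is_cvg_nneseries => n _ _; rewrite lee_fin.
  by apply: nearW => N; rewrite sumEFin lee_fin big_mkord.
- by under eq_cvg do under eq_bigr do rewrite e.
- by under eq_cvg do under eq_bigr do rewrite e.
Qed.

Lemma rep0 : rep 0 (fun=> 0).
Proof. by rewrite -(modc0 R); exact: rep_const. Qed.

Lemma rep_add M N f g : rep M f -> rep N g -> rep (M + N) (fun a => f a + g a).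
Proof.
move=> rf rg.
(* A sum of two functions is the series f, g, 0, 0, ..., so regrouping of coefficients is done only
   once. *)
pose h (n : nat) := match n with 0 => f | 1 => g | _ => fun=> 0 end.
pose H (n : nat) := match n with 0 => M | 1 => N | _ => 0 end.
have tail (V : nmodType) (u : nat -> V) k : (forall n, u n.+2 = 0) ->
    \sum_(n < k.+2) u n = u 0%N + u 1%N.
  move=> u0; rewrite big_ord_recl big_ord_recl /= big1 ?addr0// .
apply: (@rep_series H (M + N) h).
- by case=> [|[|n]] //=; exact: rep0.
- have M0 := rep_ge0 rf; have N0 := rep_ge0 rg.
  case=> [|[|n]].
  + by rewrite big_ord0 addr_ge0.
  + by rewrite big_ord1 /= lerDl.
  + by rewrite (tail _ H).
- move=> a _; split; apply: cvg_near_cst; exists 2%N => // -[|[|k]] //= _;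
  by rewrite (tail _ (fun n => h n a)).
Qed.

Lemma rep_scale M f (z : C) : rep M f -> rep (modc z * M) (fun a => z * f a).
Proof. by move=> rf; apply: (rep_mul (rep_const z) rf). Qed.

Lemma rep_opp M f : rep M f -> rep M (fun a => - f a).
Proof.
move=> rf; apply: (@rep_ext _ (fun a => (-1) * f a)).
  by move=> a _; rewrite mulN1r.
by have := rep_scale (-1) rf; rewrite modcN modc1 mul1r.
Qed.

Lemma rep_sum n (M : nat -> R) (f : nat -> (nat -> nat -> C) -> C) :
  (forall i, (i < n)%N -> rep (M i) (f i)) ->
  rep (\sum_(i < n) M i) (fun a => \sum_(i < n) f i a).
Proof.
elim: n => [|n IH] h.
  by rewrite big_ord0; apply: rep_ext rep0 => a _; rewrite big_ord0.
rewrite big_ord_recr /=; apply: (@rep_ext _ (fun a => \sum_(i < n) f i a + f n a)).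
  by move=> a _; rewrite big_ord_recr.
apply: rep_add; last exact: h.
by apply: IH => i /ltnW hi; apply: h.
Qed.

Lemma rep_exp M f n : rep M f -> rep (M ^+ n) (fun a => f a ^+ n).
Proof.
move=> rf; elim: n => [|n IH].
  rewrite expr0 -(modc1 R); apply: rep_ext (rep_const 1) => a _.
  by rewrite expr0.
by rewrite exprS; apply: rep_ext (rep_mul rf IH) => a _; rewrite exprS.
Qed.

(** Mean value estimate for powers, by f^(n+1) - g^(n+1) = f (f^n - g^n) + (f - g) g^n. For n = 0
    the truncated exponent is multiplied by 0. *)
Lemma rep_exp_sub M E f g n : rep M f -> rep M g -> rep E (fun a => f a - g a) ->
  rep (n%:R * M ^+ n.-1 * E) (fun a => f a ^+ n - g a ^+ n).
Proof.
move=> rf rg rfg; elim: n => [|n IH].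
  by rewrite !mul0r; apply: rep_ext rep0 => a _; rewrite !expr0 subrr.
apply: (@rep_ext _ (fun a => f a * (f a ^+ n - g a ^+ n) + (f a - g a) * g a ^+ n)).
  by move=> a _; rewrite !exprS; ring.
apply: rep_le (rep_add (rep_mul rf IH) (rep_mul rfg (rep_exp n rg))).
case: n {IH} => [|n] /=; first by rewrite !(mul0r, mulr0, expr0, mul1r, mulr1) add0r.
have -> : M * (n.+1%:R * M ^+ n * E) + E * M ^+ n.+1 = n.+2%:R * M ^+ n.+1 * E.
  by rewrite -!natr1 exprS; ring.
exact: lexx.
Qed.

Lemma represents_val M c f a : represents M c f -> Sigma s a ->
  ps_converges s c a /\ f a = ps_val s c a.
Proof.
move=> [c0 cM cf] Sa.
have c0' m : c m != 0 -> Monomials s m.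
  by move=> cm; apply: contrapT => /c0 h; rewrite h eqxx in cm.
split.
  rewrite /ps_converges /summable.
  apply: le_lt_trans (rep_supp cM).
  apply: le_trans (cabsum_term_le Sa c0').
  rewrite esum_mkcond; apply: le_esum => m _.
  case: ifP => _; last by rewrite lee_fin modc_ge0.
  by rewrite gee0_abs ?lee_fin ?modc_ge0.
rewrite cf// /csum /ps_val /rsum /tsum /ps_term.
have aux (h : C -> R) : h 0 = 0 ->
  (\esum_(m in Monomials s) (Num.max (h (c m * mono_val a m)) 0)%:E =
   \esum_(m in [set: monomial]) (Num.max (h (c m * mono_val a m)) 0)%:E)%E.
  move=> h0; rewrite esum_mkcond; apply: eq_esum => m _.
  case: ifPn => // /negP nm; rewrite (c0 m) ?mul0r ?h0 ?maxxx// => mm.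
  by apply: nm; exact: mem_set.
have e1 := aux (@reC R) erefl.
have e2 := aux (fun z => - reC z) (oppr0 _).
have e3 := aux (@imC R) erefl.
have e4 := aux (fun z => - imC z) (oppr0 _).
by rewrite e1 e2 e3 e4.
Qed.

End Monomials.

(** * Exponentials, and composition with the series a~ *)

(** From exp(-x) >= 1 - x one gets exp(x) (1 - x) <= 1, and 1 <= (1 + x + 2x^2) (1 - x) when x <=
    1/2. *)
Lemma expR_sub1_le (R : realType) (x : R) : x <= 1 / 2 -> expR x - 1 - x <= 2 * x ^+ 2.
Proof.
move=> x1; have h := expR_ge1Dx (- x); have e0 := expR_gt0 x.
have : expR x * (1 - x) <= 1.
  by have := ler_wpM2l (ltW e0) h; rewrite expRxMexpNx_1.
move=> h2.
have h3 : 1 <= (1 + x + 2 * x ^+ 2) * (1 - x).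
  have -> : (1 + x + 2 * x ^+ 2) * (1 - x) = 1 + x ^+ 2 * (1 - 2 * x) by ring.
  by rewrite lerDl mulr_ge0 ?sqr_ge0//; lra.
have h4 : expR x * (1 - x) <= (1 + x + 2 * x ^+ 2) * (1 - x) by apply: le_trans h3.
rewrite ler_pM2r in h4; last by lra.
by lra.
Qed.

Section Exponentials.
Variable R : realType.
Local Notation C := R[i].
Variable s : nat.

Lemma exp_coeff_partial_le (x : R) N : 0 <= x ->
  \sum_(n < N) x ^+ n / n`!%:R <= expR x.
Proof.
move=> x0; have := @nondecreasing_cvgn_le _ (series (exp_coeff x)).
rewrite /expR => /(_ _ _ N); rewrite /series /= big_mkord; apply.
- by apply: nondecreasing_series => n _ _; exact: exp_coeff_ge0.
- exact: is_cvg_series_exp_coeff.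
Qed.

Section OneParameterGroup.
Variables (E : R -> C) (kappa : C).
Hypothesis kappa1 : modc kappa = 1.
Hypothesis E_add : forall x y, E (x + y) = E x * E y.
Hypothesis E_series : forall x,
  (fun N => reC (\sum_(n < N) ofR (n`!%:R)^-1 * (kappa * ofR x) ^+ n)) @ \oo --> reC (E x) /\
  (fun N => imC (\sum_(n < N) ofR (n`!%:R)^-1 * (kappa * ofR x) ^+ n)) @ \oo --> imC (E x).

(** The pair [E], [kappa] covers both [expR] (kappa = 1) and [expi] (kappa = i). The terms of degree
    at least two have total norm at most [expR M - 1 - M]. *)
Lemma rep_E2 M (u : (nat -> nat -> C) -> R) : rep s M (fun a => ofR (u a)) -> M <= 1 / 2 ->
  rep s (2 * M ^+ 2) (fun a => E (u a) - 1 - kappa * ofR (u a)).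
Proof using kappa1 E_add E_series.
move=> ru M1; have M0 := rep_ge0 ru.
have rku : rep s M (fun a => kappa * ofR (u a)).
  by have := rep_scale kappa ru; rewrite kappa1 mul1r.
apply: rep_le (expR_sub1_le M1) _.
have split2 (V : nmodType) (g : nat -> V) N :
    \sum_(n < N.+2) g n = g 0%N + g 1%N + \sum_(n < N) g n.+2.
  by rewrite big_ord_recl big_ord_recl addrA.
apply: (@rep_series _ _ (fun n => (n.+2`!%:R)^-1 * M ^+ n.+2) _
   (fun n a => ofR (n.+2`!%:R)^-1 * (kappa * ofR (u a)) ^+ n.+2)).
- move=> n; have := rep_scale (ofR (n.+2`!%:R)^-1) (rep_exp n.+2 rku).
  by rewrite modc_ofR ger0_norm ?invr_ge0 ?ler0n.
- move=> N; have := exp_coeff_partial_le N.+2 M0.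
  rewrite (split2 _ (fun n => M ^+ n / n`!%:R)).
  rewrite expr0 expr1 fact0 divr1 (_ : (1`!%:R : R) = 1)// divr1.
  rewrite (eq_bigr (fun n : 'I_N => (n.+2`!%:R)^-1 * M ^+ n.+2)); first by lra.
  by move=> n _; rewrite mulrC.
- move=> a Sa; have [cr ci] := E_series (u a).
  have e N : \sum_(n < N) ofR (n.+2`!%:R)^-1 * (kappa * ofR (u a)) ^+ n.+2 =
      \sum_(n < N + 2) ofR (n`!%:R)^-1 * (kappa * ofR (u a)) ^+ n - 1 - kappa * ofR (u a).
    rewrite addn2 (split2 _ (fun n => ofR (n`!%:R)^-1 * (kappa * ofR (u a)) ^+ n)).
    by rewrite expr0 expr1 fact0 invr1 ?invr1 ofR1; ring.
  split.
  + under eq_cvg do rewrite e !reCD.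
    rewrite !reCD; apply: cvgD; last exact: cvg_cst.
    apply: cvgD; last exact: cvg_cst.
    by move: cr; rewrite -(cvg_shiftn 2).
  + under eq_cvg do rewrite e !imCD.
    rewrite !imCD; apply: cvgD; last exact: cvg_cst.
    apply: cvgD; last exact: cvg_cst.
    by move: ci; rewrite -(cvg_shiftn 2).
Qed.

Lemma rep_E1 M (u : (nat -> nat -> C) -> R) : rep s M (fun a => ofR (u a)) -> M <= 1 / 2 ->
  rep s (2 * M) (fun a => E (u a) - 1).
Proof using kappa1 E_add E_series.
move=> ru M1; have M0 := rep_ge0 ru.
have := rep_add (rep_E2 ru M1) (rep_scale kappa ru); rewrite kappa1 mul1r.
move=> h; apply: (@rep_le _ _ (2 * M ^+ 2 + M)); first by nra.
by apply: rep_ext h => a _; ring.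
Qed.

Lemma rep_E M (u : (nat -> nat -> C) -> R) : rep s M (fun a => ofR (u a)) -> M <= 1 / 2 ->
  rep s 2 (fun a => E (u a)).
Proof using kappa1 E_add E_series.
move=> ru M1; have := rep_add (rep_E1 ru M1) (rep_const s 1); rewrite modc1 => h.
apply: (@rep_le _ _ (2 * M + 1)); first by lra.
by apply: rep_ext h => a _; ring.
Qed.

(** E(u) - E(v) = E(v) (E(u - v) - 1), so the estimate is linear in the size of the difference. *)
Lemma rep_E_sub M e (u v : (nat -> nat -> C) -> R) :
  rep s M (fun a => ofR (v a)) -> M <= 1 / 2 ->
  rep s e (fun a => ofR (u a - v a)) -> e <= 1 / 2 ->
  rep s (4 * e) (fun a => E (u a) - E (v a)).
Proof using kappa1 E_add E_series.
move=> rv M1 ruv e1; have := rep_mul (rep_E rv M1) (rep_E1 ruv e1) => h.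
apply: (@rep_le _ _ (2 * (2 * e))); first by lra.
apply: rep_ext h => a _; rewrite mulrBr -E_add mulr1.
by congr (E _ - _); ring.
Qed.

End OneParameterGroup.

Lemma expR_series (x : R) :
  (fun N => reC (\sum_(n < N) ofR (n`!%:R)^-1 * (1 * ofR x) ^+ n)) @ \oo --> reC (ofR (expR x)) /\
  (fun N => imC (\sum_(n < N) ofR (n`!%:R)^-1 * (1 * ofR x) ^+ n)) @ \oo --> imC (ofR (expR x)).
Proof.
have e N : \sum_(n < N) ofR (n`!%:R)^-1 * (1 * ofR x) ^+ n = ofR (series (exp_coeff x) N).
  rewrite /series /= big_mkord ofR_sum; apply: eq_bigr => n _.
  by rewrite mul1r -ofRX -ofRM mulrC.
split; under eq_cvg do rewrite e; last exact: cvg_cst.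
exact: is_cvg_series_exp_coeff.
Qed.

(** The parity factors are those in [cos_coeff] and [sin_coeff]. *)
Lemma iX (y : R) n : (Complex 0 1 * ofR y) ^+ n =
  Complex ((~~ odd n)%:R * (-1) ^+ n./2 * y ^+ n) ((odd n)%:R * (-1) ^+ n.-1./2 * y ^+ n).
Proof.
elim: n => [|n IH].
  by rewrite !expr0 /= !mul1r mul0r mul0r.
rewrite exprS IH; apply: complex_eqP => /=.
  rewrite exprS; case: n {IH} => [|n] /=; first by ring.
  by case: (odd n); rewrite /= ?exprS; ring.
by rewrite exprS; case: (odd n) => /=; ring.
Qed.

Lemma expi_series (x : R) :
  (fun N => reC (\sum_(n < N) ofR (n`!%:R)^-1 * (Complex 0 1 * ofR x) ^+ n)) @ \oo --> reC (expi x) /\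
  (fun N => imC (\sum_(n < N) ofR (n`!%:R)^-1 * (Complex 0 1 * ofR x) ^+ n)) @ \oo --> imC (expi x).
Proof.
split.
- have e N : reC (\sum_(n < N) ofR (n`!%:R)^-1 * (Complex 0 1 * ofR x) ^+ n) =
      series (cos_coeff x) N.
    rewrite /series /= big_mkord reC_sum; apply: eq_bigr => n _.
    by rewrite iX /cos_coeff /= -exprnP; ring.
  under eq_cvg do rewrite e.
  by rewrite /= cos.unlock; exact: is_cvg_series_cos_coeff.
- have e N : imC (\sum_(n < N) ofR (n`!%:R)^-1 * (Complex 0 1 * ofR x) ^+ n) =
      series (sin_coeff x) N.
    rewrite /series /= big_mkord imC_sum; apply: eq_bigr => n _.
    by rewrite iX /sin_coeff /=; ring.
  under eq_cvg do rewrite e.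
  by rewrite /= sin.unlock; exact: is_cvg_series_sin_coeff.
Qed.

Lemma modc_i : modc (Complex 0 1 : C) = 1.
Proof. by rewrite /modc /= expr0n /= add0r expr1n sqrtr1. Qed.

Lemma ofR_expRD (x y : R) : ofR (expR (x + y)) = ofR (expR x) * ofR (expR y).
Proof. by rewrite expRD ofRM. Qed.

Definition rep_expR2 := rep_E2 (modc1 R) ofR_expRD expR_series.
Definition rep_expR1 := rep_E1 (modc1 R) ofR_expRD expR_series.
Definition rep_expR := rep_E (modc1 R) ofR_expRD expR_series.
Definition rep_expR_sub := rep_E_sub (modc1 R) ofR_expRD expR_series.
Definition rep_expi1 := rep_E1 modc_i (@expiD R) expi_series.
Definition rep_expi := rep_E modc_i (@expiD R) expi_series.
Definition rep_expi_sub := rep_E_sub modc_i (@expiD R) expi_series.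

End Exponentials.

(** * Homogeneous layers of a~ and their Lipschitz bounds *)

Section Atil.
Variable R : realType.
Local Notation C := R[i].
Variable s : nat.
Implicit Types (a : nat -> nat -> C) (z w : C).

Definition atil_layer a z (n : nat) : C :=
  \sum_(i < n.+1)
     (if admissible s i (n - i)%N then a i (n - i)%N * z ^+ i * cj z ^+ (n - i)%N else 0).

(** The reflection of [i] to [n - i] exchanges each term with its conjugate. *)
Lemma atil_layer_real a z n : Sigma s a -> atil_layer a z n = ofR (reC (atil_layer a z n)).
Proof.
move=> Sa; suff e : cj (atil_layer a z n) = atil_layer a z n.
  apply: complex_eqP => //=.
  by have := congr1 (@imC R) e; rewrite /imC /=; lra.
rewrite /atil_layer cj_sum (reindex_inj rev_ord_inj) /=; apply: eq_bigr => i _.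
have le_in : (i <= n)%N by rewrite -ltnS.
rewrite subSS subKn// /admissible addnC; case: ifP => [adm|_]; last first.
  by apply: complex_eqP => //=; rewrite oppr0.
have adm' : admissible s (n - i) i by rewrite /admissible addnC.
have [e _] := Sa (n - i)%N i adm'.
by rewrite !cjM !cjX cjK -e; ring.
Qed.

Lemma sum_layer_real a z N : Sigma s a ->
  \sum_(n < N) atil_layer a z n = ofR (reC (\sum_(n < N) atil_layer a z n)).
Proof.
move=> Sa; rewrite reC_sum (ofR_sum (index_enum 'I_N)).
by apply: eq_bigr => n _; exact: atil_layer_real.
Qed.

Lemma natr_quad_le (n : nat) : (n * n.+1 <= 2 ^ n.+1)%N.
Proof.
elim: n => // n IH; rewrite expnS; have := ltn_expl n (isT : 1 < 2)%N.
by rewrite expnS in IH *; nia.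
Qed.

(** Degree n contributes n + 1 terms of Lipschitz constant n rho^(n-1). The bound n (n+1) <= 2^(n+1)
    turns the total into a geometric sequence, starting at degree 2s + 1. *)
Definition layer_bound (rho e : R) (n : nat) : R :=
  if (n <= s.*2)%N then 0 else 4 * (2 * rho) ^+ n.-1 * e.

Lemma sum_layer_bound rho e N : 0 <= rho -> rho <= 1 / 4 -> 0 <= e ->
  \sum_(n < N) layer_bound rho e n <= 8 * 4 ^+ s * rho ^+ s.*2 * e.
Proof.
move=> r0 r1 e0.
have x0 : 0 <= 2 * rho by lra.
(* The subtracted tail makes the induction close: with ratio 2 rho <= 1/2, a new term X satisfies X
   + 2 (2 rho) X <= 2 X. *)
have aux j : \sum_(n < s.*2.+1 + j) layer_bound rho e n <=
    4 * e * (2 * (2 * rho) ^+ s.*2 - 2 * (2 * rho) ^+ (s.*2 + j)).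
  elim: j => [|j IH].
    rewrite !addn0 subrr mulr0 big1// => i _.
    by rewrite /layer_bound -ltnS ltn_ord.
  rewrite addnS big_ord_recr /= /layer_bound leqNgt addSn ltnS leq_addr /=.
  apply: le_trans (lerD IH (lexx _)) _.
  rewrite addnS [in leRHS]exprS.
  have := exprn_ge0 (s.*2 + j) x0.
  set X := (2 * rho) ^+ (s.*2 + j) => X0; set Y := _ ^+ s.*2.
  have : X * (2 * rho) <= X * (1 / 2) by rewrite ler_wpM2l//; lra.
  by nra.
have B0 n : 0 <= layer_bound rho e n.
  by rewrite /layer_bound; case: ifP => // _; rewrite !mulr_ge0 ?exprn_ge0.
apply: (@le_trans _ _ (\sum_(n < s.*2.+1 + N) layer_bound rho e n)).
  by rewrite addnC big_split_ord /= lerDl sumr_ge0.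
apply: le_trans (aux N) _.
have := exprn_ge0 (s.*2 + N) x0.
have -> : (2 * rho) ^+ s.*2 = 4 ^+ s * rho ^+ s.*2.
  by rewrite exprMn; congr (_ * _); rewrite -mul2n exprM; congr (_ ^+ _); rewrite expr2; ring.
set X := (2 * rho) ^+ _; set Y := 4 ^+ s * _ => X0.
have -> : 8 * 4 ^+ s * rho ^+ s.*2 * e = 8 * e * Y by rewrite /Y; ring.
by nra.
Qed.

(** Conjugates are carried as separate hypotheses; on orbits [cj_point] supplies them, since the
    conjugate of a point is again a point. *)
Lemma rep_layer_sub rho e (z z' : (nat -> nat -> C) -> C) n :
  rep s rho z -> rep s rho (fun a => cj (z a)) ->
  rep s rho z' -> rep s rho (fun a => cj (z' a)) ->
  rep s e (fun a => z a - z' a) -> rep s e (fun a => cj (z a) - cj (z' a)) ->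
  rep s (layer_bound rho e n) (fun a => atil_layer a (z a) n - atil_layer a (z' a) n).
Proof.
move=> rz rzb rz' rzb' rd rdb; have r0 := rep_ge0 rz; have e0 := rep_ge0 rd.
rewrite /layer_bound; case: ifPn => [sn|]; last rewrite -ltnNge => sn.
  apply: rep_ext (rep0 _ _) => a _; rewrite /atil_layer !big1 ?subrr// => i _;
  rewrite /admissible subnKC ?ltnNge ?sn//; by rewrite -ltnS.
(* The holomorphic and the antiholomorphic factor change one at a time; their constants,
   proportional to n - i and i, add up to n. *)
pose f (i : nat) (a : nat -> nat -> C) : C := a i (n - i)%N *
  (z a ^+ i * (cj (z a) ^+ (n - i) - cj (z' a) ^+ (n - i)) +
   (z a ^+ i - z' a ^+ i) * cj (z' a) ^+ (n - i)).
have rf (i : nat) : (i < n.+1)%N -> rep s (n%:R * rho ^+ n.-1 * e) (f i).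
  move=> hi; rewrite ltnS in hi.
  have rv : rep s 1 (fun a : nat -> nat -> C => a i (n - i)%N).
    by apply: rep_var; rewrite /admissible subnKC.
  apply: rep_le (rep_mul rv (rep_add
     (rep_mul (rep_exp i rz) (rep_exp_sub (n - i) rzb rzb' rdb))
     (rep_mul (rep_exp_sub i rz rz' rd) (rep_exp (n - i) rzb')))).
  rewrite mul1r.
  have [j nE] : exists j, n = (i + j)%N by exists (n - i)%N; rewrite subnKC.
  rewrite nE addKn; case: i j {rv hi f nE} => [|i] [|j] /=.
  + by rewrite addn0 !mulr0n !mul0r mulr0 addr0.
  + by rewrite add0n !mulr0n !mul0r addr0 expr0 mul1r.
  + by rewrite !addn0 !mulr0n !mul0r mulr0 add0r expr0 mulr1.
  + rewrite (addnS i j) natrD !exprS exprD -!natr1.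
    by rewrite le_eqVlt; apply/orP; left; apply/eqP; ring.
have := rep_sum rf.
rewrite sumr_const card_ord => h.
apply: (@rep_ext _ _ _ (fun a => \sum_(i < n.+1) f i a)).
  move=> a _; rewrite /atil_layer -sumrB; apply: eq_bigr => i _.
  rewrite /admissible subnKC ?sn; last by rewrite -ltnS.
  by rewrite /f; ring.
apply: rep_le h; case: n sn {rf f} => // n _ /=.
have := natr_quad_le n.+1; rewrite -(ler_nat R) natrM natrX => h.
rewrite exprMn -[leLHS]mulr_natl.
have p0 : 0 <= rho ^+ n * e by rewrite mulr_ge0 ?exprn_ge0.
have -> : n.+2%:R * (n.+1%:R * rho ^+ n * e) = (n.+1%:R * n.+2%:R) * (rho ^+ n * e) by ring.
have -> : 4 * (2 ^+ n * rho ^+ n) * e = 2 ^+ n.+2 * (rho ^+ n * e) by rewrite !exprS; ring.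
exact: ler_wpM2r.
Qed.

Lemma atil_partialE a z N : atil_partial s a z N = \sum_(n < N) atil_layer a z n.
Proof. by []. Qed.

(** Numerical bounds are read off the algebra bounds by feeding them constant functions of [a]; here
    z is compared with 0. [atil_lip] below works in the same way. *)
Lemma modc_layer_le a z n : Sigma s a ->
  modc (atil_layer a z n) <= layer_bound (modc z) (modc z) n.
Proof.
move=> Sa; have rz := rep_const s z.
have rzb : rep s (modc z) (fun=> cj z) by rewrite -(modc_cj z); exact: rep_const.
have r0 : rep s (modc z) (fun=> 0 : C).
  by apply: rep_le (rep0 _ _); exact: modc_ge0.
have r0b : rep s (modc z) (fun=> cj 0 : C).
  by apply: rep_ext r0 => b _; apply: complex_eqP => //=; rewrite oppr0.
have rd : rep s (modc z) (fun=> z - 0) by apply: rep_ext rz => b _; rewrite subr0.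
have rdb : rep s (modc z) (fun=> cj z - cj 0).
  apply: rep_ext rzb => b _; rewrite (_ : cj 0 = 0) ?subr0//.
  by apply: complex_eqP => //=; rewrite oppr0.
have h := rep_bound (rep_layer_sub n rz rzb r0 r0b rd rdb) Sa.
have [ns|ns] := leqP n s.*2.
  rewrite [X in modc X](_ : _ = 0) ?modc0.
    by rewrite /layer_bound ns.
  rewrite /atil_layer big1// => i _.
  rewrite /admissible subnKC ?ltnNge ?ns//; by rewrite -ltnS.
rewrite [atil_layer a 0 n](_ : _ = 0) ?subr0// in h.
rewrite /atil_layer big1// => i _; case: ifP => // _.
have -> : cj 0 = 0 :> C by apply: complex_eqP => //=; rewrite oppr0.
have [i0|i0] := posnP i; last by rewrite [X in _ * X * _]expr0n gtn_eqF// mulr0 mul0r.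
rewrite i0 subn0 [X in _ * _ * X]expr0n gtn_eqF ?mulr0//.
exact: leq_ltn_trans ns.
Qed.

Lemma atil_cvg a z : Sigma s a -> modc z <= 1 / 4 ->
  (fun N => reC (\sum_(n < N) atil_layer a z n)) @ \oo --> atil s a z.
Proof.
move=> Sa z1.
suff h : cvgn (series (fun n => reC (atil_layer a z n))).
  rewrite /atil.
  have -> : (fun N => reC (atil_partial s a z N)) = series (fun n => reC (atil_layer a z n)).
    by apply/funext => N; rewrite atil_partialE reC_sum /series /= big_mkord.
  exact: h.
apply: normed_cvg; apply: nondecreasing_is_cvgn.
  by apply: nondecreasing_series => n _ _; exact: normr_ge0.
exists (8 * 4 ^+ s * modc z ^+ s.*2 * modc z) => _ [N _ <-].
apply: (@le_trans _ _ (\sum_(0 <= n < N) `|reC (atil_layer a z n)|)); first exact: lexx.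
rewrite big_mkord; apply: le_trans (sum_layer_bound N (modc_ge0 z) z1 (modc_ge0 z)).
apply: ler_sum => n _; apply: (le_trans (Re_le_modc _)); exact: modc_layer_le.
Qed.

(** The factor rho^(2s) is what matters: it has the order of the twist, and the difference of the
    points brings one more power of the radius. *)
Lemma rep_atil_sub rho e (z z' : (nat -> nat -> C) -> C) :
  rho <= 1 / 4 ->
  rep s rho z -> rep s rho (fun a => cj (z a)) ->
  rep s rho z' -> rep s rho (fun a => cj (z' a)) ->
  rep s e (fun a => z a - z' a) -> rep s e (fun a => cj (z a) - cj (z' a)) ->
  rep s (8 * 4 ^+ s * rho ^+ s.*2 * e) (fun a => ofR (atil s a (z a) - atil s a (z' a))).
Proof.
move=> r1 rz rzb rz' rzb' rd rdb; have r0 := rep_ge0 rz; have e0 := rep_ge0 rd.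
apply: (rep_series (fun n => rep_layer_sub n rz rzb rz' rzb' rd rdb)).
  by move=> N; exact: sum_layer_bound.
move=> a Sa.
have mz : modc (z a) <= 1 / 4 by apply: le_trans r1; exact: rep_bound rz Sa.
have mz' : modc (z' a) <= 1 / 4 by apply: le_trans r1; exact: rep_bound rz' Sa.
have e1 N : \sum_(n < N) (atil_layer a (z a) n - atil_layer a (z' a) n) =
    ofR (reC (\sum_(n < N) atil_layer a (z a) n) - reC (\sum_(n < N) atil_layer a (z' a) n)).
  by rewrite sumrB ofRB -(sum_layer_real (z a) N Sa) -(sum_layer_real (z' a) N Sa).
split; under eq_cvg do rewrite e1; last exact: cvg_cst.
exact: cvgB (atil_cvg Sa mz) (atil_cvg Sa mz').
Qed.

Lemma atil0 a : Sigma s a -> atil s a 0 = 0.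
Proof.
move=> Sa; have m0 : modc (0 : C) <= 1 / 4 by rewrite modc0; lra.
have h : (fun N => reC (\sum_(n < N) atil_layer a 0 n)) @ \oo --> (0 : R).
  apply: cvg_near_cst; apply: nearW => N.
  rewrite big1// => n _; apply: modc_eq0; apply/le_anti; rewrite modc_ge0 andbT.
  apply: (le_trans (modc_layer_le 0 n Sa)).
  by rewrite modc0 /layer_bound; case: ifP => // _; rewrite mulr0.
exact: cvg_unique (atil_cvg Sa m0) h.
Qed.

Lemma atil_lip a z w rho : Sigma s a -> rho <= 1 / 4 -> modc z <= rho -> modc w <= rho ->
  `|atil s a z - atil s a w| <= 8 * 4 ^+ s * rho ^+ s.*2 * modc (z - w).
Proof.
move=> Sa r1 mz mw.
have rz : rep s rho (fun=> z) by apply: rep_le mz (rep_const _ _).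
have rzb : rep s rho (fun=> cj z) by apply: rep_le (rep_const _ _); rewrite modc_cj.
have rw : rep s rho (fun=> w) by apply: rep_le mw (rep_const _ _).
have rwb : rep s rho (fun=> cj w) by apply: rep_le (rep_const _ _); rewrite modc_cj.
have rd := rep_const s (z - w).
have rdb : rep s (modc (z - w)) (fun=> cj z - cj w).
  have -> : cj z - cj w = cj (z - w).
    by apply: complex_eqP; case: z {mz rz rzb rd} => ? ?; case: w {mw rw rwb} => ? ? /=; ring.
  by rewrite -(modc_cj (z - w)); exact: rep_const.
have := rep_bound (rep_atil_sub r1 rz rzb rw rwb rd rdb) Sa.
by rewrite modc_ofR.
Qed.

End Atil.

(** * Fixed points in the algebra of power series *)

Section RealRep.
Variable R : realType.
Local Notation C := R[i].
Variable s : nat.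
Local Notation Par := (nat -> nat -> C).
Implicit Types u v : Par -> R.

Definition rrep (M : R) (u : Par -> R) : Prop := rep s M (fun a => ofR (u a)).

Lemma rrep_ext M u v : (forall a, Sigma s a -> u a = v a) -> rrep M u -> rrep M v.
Proof. by move=> uv; apply: rep_ext => a /uv ->. Qed.

Lemma rrep_le M N u : M <= N -> rrep M u -> rrep N u.
Proof. exact: rep_le. Qed.

Lemma rrep_ge0 M u : rrep M u -> 0 <= M.
Proof. exact: rep_ge0. Qed.

Lemma rrep_bound M u a : rrep M u -> Sigma s a -> `|u a| <= M.
Proof. by move=> ru Sa; have := rep_bound ru Sa; rewrite modc_ofR. Qed.

Lemma rrep0 : rrep 0 (fun=> 0).
Proof. exact: rep0. Qed.

Lemma rrep_add M N u v : rrep M u -> rrep N v -> rrep (M + N) (fun a => u a + v a).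
Proof.
by move=> ru rv; apply: rep_ext (rep_add ru rv) => a _; rewrite ofRD.
Qed.

Lemma rrep_scale M u (c : R) : rrep M u -> rrep (`|c| * M) (fun a => c * u a).
Proof.
move=> ru; have := rep_scale (ofR c) ru; rewrite modc_ofR.
by apply: rep_ext => a _; rewrite ofRM.
Qed.

Lemma rrep_opp M u : rrep M u -> rrep M (fun a => - u a).
Proof.
by move=> ru; apply: rep_ext (rep_opp ru) => a _; rewrite ofRN.
Qed.

Lemma rrep_sub M N u v : rrep M u -> rrep N v -> rrep (M + N) (fun a => u a - v a).
Proof. by move=> ru /rrep_opp; exact: rrep_add. Qed.

Lemma rrep_sum n (b : R) (f : nat -> Par -> R) :
  (forall i, (i < n)%N -> rrep b (f i)) ->
  rrep (n%:R * b) (fun a => \sum_(i < n) f i a).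
Proof.
move=> h; have := rep_sum h; rewrite sumr_const card_ord -[b *+ n]mulr_natl.
by apply: rep_ext => a _; rewrite (ofR_sum (index_enum 'I_n)).
Qed.

Lemma rrep_series (M : nat -> R) (K : R) (f : nat -> Par -> R) g :
  (forall n, rrep (M n) (f n)) -> (forall N, \sum_(n < N) M n <= K) ->
  (forall a, Sigma s a -> (fun N => \sum_(n < N) f n a) @ \oo --> g a) ->
  rrep K g.
Proof.
move=> rf MK cg; apply: (rep_series rf MK) => a Sa.
have e N : \sum_(n < N) ofR (f n a) = ofR (\sum_(n < N) f n a).
  by rewrite (ofR_sum (index_enum 'I_N)).
split; under eq_cvg do rewrite e; last exact: cvg_cst.
exact: cg.
Qed.

Lemma half_gt0 n : 0 < (1 / 2 : R) ^+ n.
Proof. by rewrite exprn_gt0//; lra. Qed.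

Lemma sum_half m N : \sum_(n < N) (1 / 2 : R) ^+ (m + n).+1 = (1 / 2) ^+ m - (1 / 2) ^+ (m + N).
Proof.
elim: N => [|N IH]; first by rewrite big_ord0 addn0 subrr.
by rewrite big_ord_recr /= IH addnS [in RHS]exprS exprS; lra.
Qed.

Lemma le_half_eq0 (x K : R) : (forall n, `|x| <= K * (1 / 2) ^+ n) -> x = 0.
Proof.
move=> h; apply/eqP; rewrite -normr_le0.
have c : geometric K (1 / 2 : R) @ \oo --> 0.
  by apply: cvg_geometric; rewrite ger0_norm; lra.
rewrite -(cvg_lim _ c)//; apply: limr_ge; first by apply/cvg_ex; exists 0.
by apply: nearW => n; rewrite /geometric /=; exact: h.
Qed.

(** Contraction principle phrased through the norm bounds [rrep] only: the limit is taken pointwise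
    in [a], and its membership in the algebra comes from [rrep_series] applied to the telescoping
    differences, uniformly in the index j. *)
Lemma picard (eta : R) (Phi : (nat -> Par -> R) -> nat -> Par -> R) :
  0 < eta ->
  (forall j, rrep (eta / 2) (Phi (fun _ _ => 0) j)) ->
  (forall x x' e, e <= eta -> (forall j, rrep eta (x j)) -> (forall j, rrep eta (x' j)) ->
     (forall j, rrep e (fun a => x j a - x' j a)) ->
     forall j, rrep (e / 2) (fun a => Phi x j a - Phi x' j a)) ->
  exists x, (forall j, rrep eta (x j)) /\
    forall a, Sigma s a -> forall j, Phi x j a = x j a.
Proof.
move=> eta0 Phi0 PhiL.
pose X n := iter n Phi (fun _ _ => 0).
have hh n : (1 / 2 : R) ^+ n.+1 = (1 / 2) ^+ n / 2 by rewrite exprS; lra.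
(* The radii are the partial sums of the successive differences, so no iterate leaves the ball where
   [PhiL] applies. *)
have P n : (forall j, rrep (eta * (1 - (1 / 2) ^+ n)) (X n j)) /\
    (forall j, rrep (eta * (1 / 2) ^+ n.+1) (fun a => X n.+1 j a - X n j a)).
  elim: n => [|n [IH1 IH2]].
    split=> j; first by rewrite expr0 subrr mulr0; exact: rrep0.
    rewrite expr1 mul1r; apply: rrep_ext (Phi0 j) => a _.
    by rewrite subr0.
  have IH1' j : rrep (eta * (1 - (1 / 2) ^+ n.+1)) (X n.+1 j).
    apply: rrep_le (rrep_ext _ (rrep_add (IH1 j) (IH2 j))).
      by rewrite hh; lra.
    by move=> a _; rewrite addrC subrK.
  have leta m : eta * (1 - (1 / 2) ^+ m) <= eta.
    by rewrite -[leRHS]mulr1 ler_wpM2l ?ltW//; have := half_gt0 m; lra.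
  split=> // j.
  have := PhiL (X n.+1) (X n) (eta * (1 / 2) ^+ n.+1).
  rewrite (hh n.+1) mulrA; apply => //.
  - rewrite -[leRHS]mulr1 ler_wpM2l ?(ltW eta0)// exprn_ile1//; lra.
  - by move=> i; exact: rrep_le (leta _) (IH1' i).
  - by move=> i; exact: rrep_le (leta _) (IH1 i).
have tele m j a N : \sum_(n < N) (X (m + n).+1 j a - X (m + n)%N j a) = X (m + N)%N j a - X m j a.
  elim: N => [|N IH]; first by rewrite big_ord0 addn0 subrr.
  by rewrite big_ord_recr IH /= addnS addrC addrA subrK.
have cX j a : Sigma s a -> cvgn (fun n => X n j a).
  move=> Sa.
  have -> : (fun n => X n j a) = series (fun n => X n.+1 j a - X n j a).
    apply/funext => N; rewrite /series /= big_mkord.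
    by have := tele 0%N j a N; rewrite add0n subr0 => <-; apply: eq_bigr.
  apply: normed_cvg; apply: nondecreasing_is_cvgn.
    by apply: nondecreasing_series => n _ _; exact: normr_ge0.
  exists eta => _ [N _ <-].
  apply: (@le_trans _ _ (\sum_(0 <= n < N) `|X n.+1 j a - X n j a|)); first exact: lexx.
  rewrite big_mkord; apply: (@le_trans _ _ (\sum_(n < N) eta * (1 / 2) ^+ (0 + n).+1)).
    by apply: ler_sum => n _; have [_ h] := P n; exact: (rrep_bound (h j) Sa).
  rewrite -mulr_sumr sum_half -[leRHS]mulr1 ler_wpM2l ?ltW//.
  by rewrite expr0; have := half_gt0 (0 + N); lra.
pose x j a := limn (fun n => X n j a).
have tail m j : rrep (eta * (1 / 2) ^+ m) (fun a => x j a - X m j a).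
  apply: (@rrep_series (fun n => eta * (1 / 2) ^+ (m + n).+1) _
    (fun n a => X (m + n).+1 j a - X (m + n)%N j a)).
  - by move=> n; have [_ h] := P (m + n)%N; exact: h.
  - move=> N; rewrite -mulr_sumr sum_half ler_wpM2l ?ltW//.
    by have := half_gt0 (m + N); lra.
  - move=> a Sa; under eq_cvg do rewrite tele addnC.
    apply: cvgB; last exact: cvg_cst.
    have := cX j a Sa; rewrite -/(x j a) => h.
    by rewrite -(cvg_shiftn m (fun n => X n j a)) in h.
have xeta j : rrep eta (x j).
  have := tail 0%N j; rewrite expr0 mulr1.
  by apply: rrep_ext => a _; rewrite subr0.
exists x; split => // a Sa j.
(* The defect is (Phi x - Phi X_m) - (x - X_(m+1)), and each part is at most eta / 2^(m+1). *)
apply/eqP; rewrite -subr_eq0; apply/eqP; apply: (@le_half_eq0 _ eta) => m.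
have Xeta i : rrep eta (X m i).
  have [h _] := P m; apply: rrep_le (h i).
  by rewrite -[leRHS]mulr1 ler_wpM2l ?ltW//; have := half_gt0 m; lra.
have em : eta * (1 / 2) ^+ m <= eta.
  by rewrite -[leRHS]mulr1 ler_wpM2l ?(ltW eta0)// exprn_ile1//; lra.
have h1 := rrep_bound (PhiL x (X m) _ em xeta Xeta (tail m) j) Sa.
have h2 := rrep_bound (tail m.+1 j) Sa.
rewrite [in X in _ <= X]/= in h2.
have -> : Phi x j a - x j a = (Phi x j a - Phi (X m) j a) - (x j a - X m.+1 j a).
  by rewrite [X m.+1]/= ; ring.
apply: (le_trans (ler_normB _ _)).
by move: h2; rewrite hh; lra.
Qed.

End RealRep.

(** * The equation of a closed orbit *)

Section OrbitEquation.
Variable R : realType.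
Local Notation C := R[i].
Local Notation Par := (nat -> nat -> C).
Variables (s q : nat) (beta d rk th0 : R).
Hypotheses (s_gt0 : (0 < s)%N) (q_gt0 : (0 < q)%N) (rk_gt0 : 0 < rk) (d_gt0 : 0 < d).

(* [orbit_const] is the Lipschitz constant, divided by [d * rk], of one step of the
   orbit equation; [orbit_radius] is the radius of the ball on which [Phi] contracts. *)
Definition orbit_const : R := 384 * 64 ^+ s.
Definition orbit_radius : R := (48 * s%:R)^-1.
Hypothesis rkd : rk ^+ s.*2 = d.
Hypothesis qd : q%:R * d <= 16.
Hypothesis rk_small : 64 * orbit_const * rk <= orbit_radius.

Local Notation eta := orbit_radius.
Local Notation K1 := orbit_const.

(* In a family [x], [x 0] is log (r / rk), where r is the unknown radius, and for l > 0
   [x l] is the deviation of the l-th angle of the orbit from the rigid rotation [angle l]. *)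
Definition angle (l : nat) : R := th0 + beta * l%:R.
Definition point (zeta u : Par -> R) (c : R) (a : Par) : C :=
  ofR (rk * expR (zeta a)) * expi (c + u a).
(** This is r^(2s) - d for r = rk exp(zeta): the excess of the rotation angle over [beta] when alpha
    = beta - d. *)
Definition nu (zeta : Par -> R) (a : Par) : R := d * (expR (2 * s%:R * zeta a) - 1).
(** The orbit starts exactly at [th0], which frees slot 0 of the family for the radius. *)
Definition dev (x : nat -> Par -> R) (l : nat) : Par -> R := if l == 0%N then fun=> 0 else x l.
(** A(r, th + om) + A(r, -th'), the contribution of a~ to one step. [angle l.+1] occurs in both
    terms because th + om already contains the rotation by [beta]. The dependence on [dev x l.+1] is
    implicit and is resolved by the same fixed point. *)
Definition incr (x : nat -> Par -> R) (l : nat) (a : Par) : R :=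
  atil s a (point (x 0%N) (fun a => dev x l a + nu (x 0%N) a) (angle l.+1) a) +
  atil s a (point (x 0%N) (fun a => - dev x l.+1 a) (- angle l.+1) a).
Definition quad (x : nat -> Par -> R) (a : Par) : R :=
  expR (2 * s%:R * x 0%N a) - 1 - 2 * s%:R * x 0%N a.
Definition mean (B : nat -> Par -> R) (a : Par) : R := - (q%:R^-1 * \sum_(l < q) B l a).
(** Summing the steps gives x_l = l nu + sum of the increments, and closing after q steps forces nu
    = [mean B]. Slot 0 solves d (2s zeta + P) = [mean B] for zeta, where P is the nonlinear part of
    the exponential. [Psi] is linear in the pair B, P, so differences are estimated by [rrep_Psi]
    too. *)
Definition Psi (B : nat -> Par -> R) (P : Par -> R) (j : nat) (a : Par) : R :=
  if j == 0%N then (2 * s%:R)^-1 * (d^-1 * mean B a - P a)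
  else if (j <= q)%N then j%:R * mean B a + \sum_(m < j) B m a else 0.
Definition Phi (x : nat -> Par -> R) : nat -> Par -> R := Psi (incr x) (quad x).

Lemma orbit_constants :
  [/\ (1 : R) <= s%:R, 0 < s%:R :> R & 0 < q%:R :> R] /\
  [/\ 48 * s%:R * eta = 1, 0 < eta & eta <= 1 / 48] /\
  [/\ 384 <= K1, 64 * 384 * rk <= eta, d <= rk & 8 * s%:R * d <= 1].
Proof.
have sR : (1 : R) <= s%:R by rewrite ler1n.
have s0 : (0 : R) < s%:R by lra.
have q0 : (0 : R) < q%:R by rewrite ltr0n.
have etaE : 48 * s%:R * eta = 1.
  by rewrite /orbit_radius mulfV//; apply: lt0r_neq0; lra.
have eta0 : 0 < eta by rewrite invr_gt0; lra.
have eta1 : eta <= 1 / 48.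
  have : 1 * eta <= s%:R * eta by rewrite ler_wpM2r// ltW.
  by lra.
have K1_ge : 384 <= K1.
  have : (1 : R) <= 64 ^+ s by apply: exprn_ege1; lra.
  by rewrite /orbit_const; set X := _ ^+ s => X1; lra.
have rk1 : 64 * 384 * rk <= eta.
  have : 384 * rk <= K1 * rk by rewrite ler_wpM2r// ltW.
  by have := rk_small; lra.
have d_le_rk : d <= rk.
  rewrite -rkd -[leRHS]expr1; apply: ler_wiXn2l; rewrite ?(ltW rk_gt0)//; last by rewrite double_gt0.
  by lra.
have sd : 8 * s%:R * d <= 1.
  have : s%:R * d <= s%:R * eta by rewrite ler_wpM2l//; lra.
  by lra.
by [].
Qed.

Ltac constants :=
  have [[sR s0 q0] [[etaE eta0 eta1] [K1_ge rk1 d_le_rk sd]]] := orbit_constants;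
  have rk_pos := rk_gt0; have d_pos := d_gt0.

Lemma rep_scale1 M (z : C) f : modc z <= 1 -> rep s M f -> rep s M (fun a => z * f a).
Proof.
move=> z1 rf; apply: rep_le (rep_scale z rf).
by rewrite -[leRHS]mul1r ler_wpM2r// (rep_ge0 rf).
Qed.

Lemma rep_point (zeta u : Par -> R) c : rrep s eta zeta -> rrep s (1 / 2) u ->
  rep s (4 * rk) (point zeta u c).
Proof.
constants.
move=> rz ru.
have h1 : rep s (rk * 2) (fun a => ofR rk * ofR (expR (zeta a))).
  have eta2 : eta <= 1 / 2 by lra.
  by have := rep_scale (ofR rk) (rep_expR rz eta2); rewrite modc_ofR ger0_norm// ltW.
have h2 : rep s 2 (fun a => expi c * expi (u a)).
  by apply: rep_scale1; [rewrite modc_expi|apply: rep_expi ru _].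
apply: rep_le (rep_ext _ (rep_mul h1 h2)); first by lra.
by move=> a _; rewrite /point expiD ofRM.
Qed.

Lemma cj_point zeta u c a : cj (point zeta u c a) = point zeta (fun a => - u a) (- c) a.
Proof. by rewrite /point cjM cj_ofR cj_expi opprD. Qed.

Lemma rep_cj_point (zeta u : Par -> R) c : rrep s eta zeta -> rrep s (1 / 2) u ->
  rep s (4 * rk) (fun a => cj (point zeta u c a)).
Proof.
move=> rz /rrep_opp ru; apply: rep_ext (rep_point (- c) rz ru) => a _.
by rewrite cj_point.
Qed.

Lemma rep_point_sub (zeta zeta' u u' : Par -> R) c e e' :
  rrep s eta zeta -> rrep s eta zeta' -> rrep s (1 / 2) u -> rrep s (1 / 2) u' ->
  rrep s e (fun a => zeta a - zeta' a) -> e <= 1 / 2 ->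
  rrep s e' (fun a => u a - u' a) -> e' <= 1 / 2 ->
  rep s (8 * rk * (e + e')) (fun a => point zeta u c a - point zeta' u' c a).
Proof.
constants.
move=> rz rz' ru ru' rdz e1 rdu e1'.
have eta2 : eta <= 1 / 2 by lra.
have h1 : rep s (4 * e) (fun a => ofR (expR (zeta a)) - ofR (expR (zeta' a))).
  exact: rep_expR_sub rz' eta2 rdz e1.
have h2 : rep s (4 * e') (fun a => expi (u a) - expi (u' a)).
  exact: rep_expi_sub ru' (lexx _) rdu e1'.
have h3 := rep_expi ru (lexx _).
have h4 := rep_expR rz' eta2.
have ec : modc (expi c) <= 1 by rewrite modc_expi.
have h5 := rep_scale (ofR rk) (rep_scale1 ec (rep_add (rep_mul h1 h3) (rep_mul h4 h2))).
rewrite modc_ofR (ger0_norm (ltW rk_gt0)) in h5.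
apply: rep_le (rep_ext _ h5); first by lra.
move=> a _; rewrite /point !expiD !ofRM; ring.
Qed.

Lemma rep_cj_point_sub (zeta zeta' u u' : Par -> R) c e e' :
  rrep s eta zeta -> rrep s eta zeta' -> rrep s (1 / 2) u -> rrep s (1 / 2) u' ->
  rrep s e (fun a => zeta a - zeta' a) -> e <= 1 / 2 ->
  rrep s e' (fun a => u a - u' a) -> e' <= 1 / 2 ->
  rep s (8 * rk * (e + e')) (fun a => cj (point zeta u c a) - cj (point zeta' u' c a)).
Proof.
constants.
move=> rz rz' ru ru' rdz e1 rdu e1'.
have := rep_point_sub (- c) rz rz' (rrep_opp ru) (rrep_opp ru') rdz e1 (e' := e').
move=> h; apply: rep_ext (h _ e1'); first by move=> a _; rewrite !cj_point.
by apply: rrep_ext (rrep_opp rdu) => a _; ring.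
Qed.

Lemma const_4rk : (4 * rk) ^+ s.*2 = 16 ^+ s * d.
Proof. by rewrite exprMn rkd; congr (_ * _); rewrite -mul2n exprM; congr (_ ^+ _); rewrite expr2; ring. Qed.

Lemma const_pow : 384 * 64 ^+ s = 384 * (4 ^+ s * 16 ^+ s) :> R.
Proof. by rewrite -exprMn; congr (_ * _ ^+ _); ring. Qed.

Lemma rrep_atil_point_sub (zeta zeta' u u' : Par -> R) c e :
  rrep s eta zeta -> rrep s eta zeta' -> rrep s (1 / 2) u -> rrep s (1 / 2) u' ->
  rrep s e (fun a => zeta a - zeta' a) -> e <= 1 / 4 ->
  rrep s (2 * e) (fun a => u a - u' a) ->
  rrep s (K1 * d * rk * e / 2) (fun a => atil s a (point zeta u c a) - atil s a (point zeta' u' c a)).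
Proof.
constants.
move=> rz rz' ru ru' rdz e1 rdu.
have e2 : e <= 1 / 2 by lra.
have e3 : 2 * e <= 1 / 2 by lra.
have rk4 : 4 * rk <= 1 / 4 by lra.
have h := rep_atil_sub rk4 (rep_point c rz ru) (rep_cj_point c rz ru) (rep_point c rz' ru')
   (rep_cj_point c rz' ru') (rep_point_sub c rz rz' ru ru' rdz e2 rdu e3)
   (rep_cj_point_sub c rz rz' ru ru' rdz e2 rdu e3).
(* 8 4^s (4 rk)^(2s) times 8 rk (e + 2e) equals 192 64^s d rk e. A step contains two values of a~,
   hence the 384 in [orbit_const]. *)
apply: rep_le h; rewrite const_4rk /orbit_const const_pow.
by rewrite le_eqVlt; apply/orP; left; apply/eqP; field.
Qed.

Lemma rrep_two_s M (x : Par -> R) : rrep s M x ->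
  rrep s (2 * s%:R * M) (fun a => 2 * s%:R * x a).
Proof. constants; by move=> rx; have := rrep_scale (2 * s%:R) rx; rewrite ger0_norm//; lra. Qed.

Lemma rrep_nu_sub (x x' : Par -> R) e : rrep s eta x -> rrep s eta x' ->
  rrep s e (fun a => x a - x' a) -> e <= eta ->
  rrep s e (fun a => nu x a - nu x' a).
Proof.
constants.
move=> rx rx' rd e1; have e0 := rrep_ge0 rd.
have b1 : 2 * s%:R * eta <= 1 / 2 by lra.
have b2 : 2 * s%:R * e <= 1 / 2.
  by apply: le_trans b1; rewrite ler_wpM2l//; lra.
have rd2 : rrep s (2 * s%:R * e) (fun a => 2 * s%:R * x a - 2 * s%:R * x' a).
  by apply: rrep_ext (rrep_two_s rd) => a _; rewrite mulrBr.
have h := rep_scale (ofR d) (rep_expR_sub (rrep_two_s rx') b1 rd2 b2).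
rewrite modc_ofR ger0_norm ?ltW// in h.
(* The norm obtained is 8 s d e, and 8 s d <= 1. *)
apply: rep_le (rep_ext _ h); first by nra.
by move=> a _; rewrite /nu -ofRB -ofRM; congr ofR; ring.
Qed.

Lemma rrep_nu (x : Par -> R) : rrep s eta x -> rrep s eta (nu x).
Proof.
constants.
move=> rx; have b1 : 2 * s%:R * eta <= 1 / 2 by lra.
have h := rep_scale (ofR d) (rep_expR1 (rrep_two_s rx) b1).
rewrite modc_ofR ger0_norm ?ltW// in h.
apply: rep_le (rep_ext _ h); first by have := eta0; nra.
by move=> a _; rewrite /nu -ofR1 -ofRB -ofRM.
Qed.

Lemma rrep_dev M x l : 0 <= M -> (forall j, rrep s M (x j)) -> rrep s M (dev x l).
Proof.
move=> M0 rx; rewrite /dev; case: ifP => _; last exact: rx.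
exact: rrep_le M0 (rrep0 _ _).
Qed.

Lemma rrep_dev_sub e x x' l : 0 <= e -> (forall j, rrep s e (fun a => x j a - x' j a)) ->
  rrep s e (fun a => dev x l a - dev x' l a).
Proof.
move=> e0 rx; rewrite /dev; case: ifP => _; last exact: rx.
by apply: rrep_le e0 (rrep_ext _ (rrep0 _ _)) => a _; rewrite subrr.
Qed.

Lemma rrep_incr_sub x x' e l : e <= eta ->
  (forall j, rrep s eta (x j)) -> (forall j, rrep s eta (x' j)) ->
  (forall j, rrep s e (fun a => x j a - x' j a)) ->
  rrep s (K1 * d * rk * e) (fun a => incr x l a - incr x' l a).
Proof.
constants.
move=> e1 rx rx' rd; have e0 := rrep_ge0 (rd 0%N).
have eta2 : eta + eta <= 1 / 2 by lra.
have eta3 : eta <= 1 / 2 by lra.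
have e4 : e <= 1 / 4 by lra.
have hu y (ry : forall j, rrep s eta (y j)) : rrep s (1 / 2) (fun a => dev y l a + nu (y 0%N) a).
  by apply: rrep_le eta2 (rrep_add (rrep_dev _ (ltW eta0) ry) (rrep_nu (ry 0%N))).
have hv y (ry : forall j, rrep s eta (y j)) : rrep s (1 / 2) (fun a => - dev y l.+1 a).
  by apply: rrep_le eta3 (rrep_opp (rrep_dev _ (ltW eta0) ry)).
have du : rrep s (2 * e) (fun a => (dev x l a + nu (x 0%N) a) - (dev x' l a + nu (x' 0%N) a)).
  have := rrep_add (rrep_dev_sub l e0 rd) (rrep_nu_sub (rx 0%N) (rx' 0%N) (rd 0%N) e1).
  move=> h; apply: rrep_le (rrep_ext _ h); first by lra.
  by move=> a _; ring.
have dv : rrep s (2 * e) (fun a => - dev x l.+1 a - - dev x' l.+1 a).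
  apply: rrep_le (rrep_ext _ (rrep_opp (rrep_dev_sub l.+1 e0 rd))); first by lra.
  by move=> a _; ring.
have h1 := rrep_atil_point_sub (angle l.+1) (rx 0%N) (rx' 0%N) (hu x rx) (hu x' rx') (rd 0%N) e4 du.
have h2 := rrep_atil_point_sub (- angle l.+1) (rx 0%N) (rx' 0%N) (hv x rx) (hv x' rx') (rd 0%N) e4 dv.
apply: rrep_le (rrep_ext _ (rrep_add h1 h2)); first by lra.
by move=> a _; rewrite addrACA -opprD.
Qed.

(** The 48 in [orbit_radius] comes from here: the two remainders have norms 16 s e (s eta) and 8 s e
    (s e), together at most 24 s e / 48. The quadratic part thus uses half of the contraction budget
    s e of the radius equation. *)
Lemma rrep_quad_sub x x' e : e <= eta ->
  rrep s eta (x 0%N) -> rrep s eta (x' 0%N) ->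
  rrep s e (fun a => x 0%N a - x' 0%N a) ->
  rrep s (s%:R * e / 2) (fun a => quad x a - quad x' a).
Proof.
constants.
move=> e1 rx rx' rd; have e0 := rrep_ge0 rd.
have b1 : 2 * s%:R * eta <= 1 / 2 by lra.
have e2 : 2 * s%:R * e <= 2 * s%:R * eta by rewrite ler_wpM2l//; lra.
have b2 : 2 * s%:R * e <= 1 / 2 by lra.
have rd2 : rrep s (2 * s%:R * e) (fun a => 2 * s%:R * x 0%N a - 2 * s%:R * x' 0%N a).
  by apply: rrep_ext (rrep_two_s rd) => a _; rewrite mulrBr.
have h1 := rep_expR1 (rrep_two_s rx') b1.
have h2 := rep_expR1 rd2 b2.
have h3 := rep_expR2 rd2 b2.
have h := rep_add (rep_mul h1 h2) h3.
apply: rep_le (rep_ext _ h); last first.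
  move=> a _; rewrite /quad.
  have -> : expR (2 * s%:R * x 0%N a) = expR (2 * s%:R * x' 0%N a) *
     expR (2 * s%:R * x 0%N a - 2 * s%:R * x' 0%N a).
    by rewrite -expRD; congr expR; ring.
  by rewrite !(ofRB, ofRM, ofR1); ring.
have -> : 2 * (2 * s%:R * eta) * (2 * (2 * s%:R * e)) = 16 * s%:R * e * (s%:R * eta) by ring.
have -> : 2 * (2 * s%:R * e) ^+ 2 = 8 * s%:R * e * (s%:R * e) by ring.
have f1 : s%:R * eta = 1 / 48 by lra.
have f2 : s%:R * e <= 1 / 48 by rewrite -f1 ler_wpM2l// ltW.
rewrite f1.
have f3 : 8 * s%:R * e * (s%:R * e) <= 8 * s%:R * e * (1 / 48).
  by rewrite ler_wpM2l// !mulr_ge0// ltW.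
have f4 : 0 <= s%:R * e by rewrite mulr_ge0// ltW.
by lra.
Qed.

Lemma rrep_mean B b : (forall l, (l < q)%N -> rrep s b (B l)) -> rrep s b (mean B).
Proof.
constants.
move=> rB; have := rrep_opp (rrep_scale q%:R^-1 (rrep_sum rB)).
by rewrite ger0_norm ?invr_ge0 ?ltW// mulKf// lt0r_neq0.
Qed.

(** The first inequality serves the radius, where b is divided by the twist; the second serves the
    angles, where the multiple of the mean and the partial sum each cost at most q b. *)
Lemma rrep_Psi B P (b c M : R) : (forall l, (l < q)%N -> rrep s b (B l)) -> rrep s c P ->
  b / d + c <= 2 * s%:R * M -> 2 * q%:R * b <= M ->
  forall j, rrep s M (Psi B P j).
Proof.
constants.
move=> rB rP h1 h2 j; rewrite /Psi; have rN := rrep_mean rB.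
have b0 : 0 <= b := rrep_ge0 rN.
case: (j == 0%N).
  have := rrep_scale (2 * s%:R)^-1 (rrep_sub (rrep_scale d^-1 rN) rP).
  rewrite !ger0_norm ?invr_ge0; try lra.
  apply: rrep_le; rewrite ler_pdivrMl; last by lra.
  by rewrite [d^-1 * b]mulrC.
case: (leqP j q) => [jq|_]; last first.
  by apply: rrep_le (rrep0 _ _); apply: le_trans h2; rewrite !mulr_ge0// ltW.
have rS : rrep s (j%:R * b) (fun a => \sum_(m < j) B m a).
  by apply: rrep_sum => i ij; apply: rB; exact: leq_trans jq.
have := rrep_add (rrep_scale j%:R rN) rS; rewrite ger0_norm ?ler0n//.
apply: rrep_le; apply: le_trans h2.
have : j%:R * b <= q%:R * b by rewrite ler_wpM2r// ler_nat.
by lra.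
Qed.

Lemma Psi_sub B B' P P' j a :
  Psi B P j a - Psi B' P' j a = Psi (fun l a => B l a - B' l a) (fun a => P a - P' a) j a.
Proof.
rewrite /Psi /mean; case: ifP => _; first by rewrite sumrB; ring.
by case: ifP => _; rewrite ?subrr// !sumrB; ring.
Qed.

(** Accumulation over q steps costs only the bounded factor q d; the remaining factor K1 rk is
    small. *)
Lemma bound_aux e : 0 <= e -> 2 * q%:R * (K1 * d * rk * e) <= e / 2.
Proof.
constants.
move=> e0.
have f1 : (q%:R * d) * (K1 * rk) <= 16 * (K1 * rk).
  by rewrite ler_wpM2r// mulr_ge0// ltW//; lra.
have f2 : 2 * q%:R * (K1 * d * rk * e) = 2 * ((q%:R * d) * (K1 * rk)) * e by ring.
rewrite f2 mulrC ler_wpM2l//.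
have := rk_small; have := eta1; lra.
Qed.

Lemma Phi_contraction x x' e : e <= eta ->
  (forall j, rrep s eta (x j)) -> (forall j, rrep s eta (x' j)) ->
  (forall j, rrep s e (fun a => x j a - x' j a)) ->
  forall j, rrep s (e / 2) (fun a => Phi x j a - Phi x' j a).
Proof.
constants.
move=> e1 rx rx' rd j; have e0 := rrep_ge0 (rd 0%N).
have h := @rrep_Psi (fun l a => incr x l a - incr x' l a) (fun a => quad x a - quad x' a)
  (K1 * d * rk * e) (s%:R * e / 2) (e / 2).
apply: rrep_ext (h _ _ _ _ j).
- by move=> a _; rewrite /Phi Psi_sub.
- by move=> l _; exact: rrep_incr_sub.
- exact: rrep_quad_sub.
- have -> : K1 * d * rk * e / d = (K1 * rk) * e by field; exact: lt0r_neq0.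
  have : (K1 * rk) * e <= (1 / 64) * e by rewrite ler_wpM2r//; have := rk_small; lra.
  have : e <= s%:R * e by rewrite -{1}(mul1r e) ler_wpM2r.
  by lra.
- exact: bound_aux.
Qed.

Lemma rrep_incr0 l : rrep s (K1 * d * rk) (incr (fun _ _ => 0) l).
Proof.
constants.
have rz : rrep s eta (fun=> 0) := rrep_le (ltW eta0) (rrep0 R s).
have aux (u : Par -> R) c : (forall a, u a = 0) ->
    rrep s (K1 * d * rk / 2) (fun a => atil s a (point (fun=> 0) u c a)).
  move=> u0; have ru : rrep s (1 / 2) u.
    by apply: rrep_le (rrep_ext _ (rrep0 R s)) => [|a _]; rewrite ?u0//; lra.
  have pE a : point (fun=> 0) u c a = ofR rk * expi c.
    by rewrite /point u0 expR0 mulr1 addr0.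
  have rk0 : 0 <= 4 * rk by lra.
  have r0 : rep s (4 * rk) (fun=> 0 : C) := rep_le rk0 (rep0 R s).
  have cj0 : cj 0 = 0 :> C by apply: complex_eqP => //=; rewrite oppr0.
  have r0' : rep s (4 * rk) (fun=> cj 0 : C) by rewrite cj0.
  have m1 : modc (ofR rk * expi c) = rk.
    by rewrite modcM modc_ofR modc_expi mulr1 ger0_norm// ltW.
  have rd : rep s rk (fun a => point (fun=> 0) u c a - 0).
    apply: rep_ext (_ : rep s rk (fun=> ofR rk * expi c)).
      by move=> a _; rewrite pE subr0.
    by rewrite -{1}m1; exact: rep_const.
  have rdb : rep s rk (fun a => cj (point (fun=> 0) u c a) - cj 0).
    apply: rep_ext (_ : rep s rk (fun=> cj (ofR rk * expi c))).
      by move=> a _; rewrite pE cj0 subr0.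
    by rewrite -{1}m1 -modc_cj; exact: rep_const.
  have rk4 : 4 * rk <= 1 / 4 by lra.
  have h := rep_atil_sub rk4 (rep_point c rz ru) (rep_cj_point c rz ru) r0 r0' rd rdb.
  apply: rrep_le (rrep_ext _ h); last by move=> a Sa; rewrite atil0// subr0.
  rewrite const_4rk /orbit_const const_pow.
  have : 0 <= 4 ^+ s * 16 ^+ s * (d * rk) by rewrite !mulr_ge0 ?exprn_ge0// ltW.
  by lra.
apply: rrep_le (rrep_add (aux _ (angle l.+1) _) (aux _ (- angle l.+1) _)).
- by lra.
- by move=> a; rewrite /dev /nu; case: ifP => _; rewrite mulr0 expR0 subrr mulr0 addr0.
- by move=> a; rewrite /dev /= oppr0.
Qed.

Lemma Phi_zero j : rrep s (eta / 2) (Phi (fun _ _ => 0) j).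
Proof.
constants.
apply: (@rrep_Psi _ _ (K1 * d * rk) 0).
- by move=> l _; exact: rrep_incr0.
- apply: rrep_ext (rrep0 _ _) => a _; by rewrite /quad !mulr0 expR0 !subrr.
- have -> : K1 * d * rk / d = K1 * rk by field; exact: lt0r_neq0.
  have : eta <= s%:R * eta by rewrite -{1}(mul1r eta) ler_wpM2r// ltW.
  by have := rk_small; have := eta0; lra.
- have f1 : (q%:R * d) * (K1 * rk) <= 16 * (K1 * rk).
    by rewrite ler_wpM2r// mulr_ge0// ltW//; lra.
  have -> : 2 * q%:R * (K1 * d * rk) = 2 * ((q%:R * d) * (K1 * rk)) by ring.
  by have := rk_small; have := eta0; lra.
Qed.

(* One step of varphi_a on the circle of radius r, for the angle of the coordinate w
   such that z = w exp (- i a~(conj w)). *)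
Definition orbit_step (a : Par) (r alpha th th' : R) : Prop :=
  th' - atil s a (ofR r * expi (- th')) =
  th + (alpha + r ^+ s.*2) + atil s a (ofR r * expi (th + (alpha + r ^+ s.*2))).

(** The orbit steps and the closing condition give the periodic orbit at the resonant radius. The
    last two identities record the fixed-point equations for use in the first-order expansion. *)
Lemma orbit_exists : exists x : nat -> Par -> R,
  (forall j, rrep s eta (x j)) /\
  forall a, Sigma s a ->
    [/\ forall l, (l < q)%N -> orbit_step a (rk * expR (x 0%N a)) (beta - d)
              (angle l + dev x l a) (angle l.+1 + dev x l.+1 a),
        dev x q a = 0,
        nu (x 0%N) a = mean (incr x) a &
        forall l, (0 < l <= q)%N -> x l a = l%:R * nu (x 0%N) a + \sum_(m < l) incr x m a].
Proof.
constants.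
have [x [xeta xfix]] := picard eta0 Phi_zero Phi_contraction.
exists x; split => // a Sa.
have nuE : nu (x 0%N) a = mean (incr x) a.
  have := xfix a Sa 0%N; rewrite /Phi /Psi eqxx /quad /nu => h.
  have nz : 2 * s%:R != 0 :> R by apply: lt0r_neq0; lra.
  have h2 := congr1 (fun t => 2 * s%:R * t) h; rewrite /= mulVKf// in h2.
  have -> : mean (incr x) a = d * (d^-1 * mean (incr x) a).
    by rewrite mulVKf// lt0r_neq0.
  by congr (_ * _); lra.
have xl l : (0 < l <= q)%N -> x l a = l%:R * nu (x 0%N) a + \sum_(m < l) incr x m a.
  move=> /andP[l0 lq]; have := xfix a Sa l.
  by rewrite /Phi /Psi gtn_eqF// lq -nuE => ->.
have devE l : (l <= q)%N -> dev x l a = l%:R * nu (x 0%N) a + \sum_(m < l) incr x m a.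
  case: l => [|l] lq; last by rewrite /dev /= xl.
  by rewrite /dev eqxx mul0r big_ord0 addr0.
have rE : (rk * expR (x 0%N a)) ^+ s.*2 = d + nu (x 0%N) a.
  rewrite exprMn rkd -expRM_natl -mul2n natrM /nu.
  by ring.
split => //.
- move=> l lq; have e1 := devE _ lq; have e2 := devE _ (ltnW lq).
  rewrite big_ord_recr /= -natr1 mulrDl mul1r in e1.
  have e3 : dev x l.+1 a = dev x l a + nu (x 0%N) a + incr x l a by rewrite e1 e2; ring.
  rewrite /orbit_step rE.
  have aE : angle l + dev x l a + (beta - d + (d + nu (x 0%N) a)) =
      angle l.+1 + (dev x l a + nu (x 0%N) a).
    by rewrite /angle -natr1; ring.
  rewrite opprD {2}aE.
  set A2 := atil s a (ofR _ * expi (_ - _)); set A1 := atil s a (ofR _ * _).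
  have iE : incr x l a = A1 + A2 by [].
  rewrite iE in e3; clearbody A1 A2; lra.
- rewrite devE// nuE /mean mulrN mulrA mulfV ?mul1r ?addNr//.
  exact: lt0r_neq0.
Qed.

End OrbitEquation.

(** * Twist maps of the circle and periodic points *)

Lemma lipschitz_cont (R : realType) (f : R -> R) (M : R) :
  (forall x y, `|f x - f y| <= M * `|x - y|) -> continuous f.
Proof.
move=> lf x; apply/cvgrPdist_lt => e e0.
have M0 : 0 < `|M| + 1 by rewrite ltr_wpDl.
near=> y; apply: (le_lt_trans (lf x y)).
have h : `|x - y| < e / (`|M| + 1).
  near: y; apply: cvgr_dist_lt => //; exact: divr_gt0.
apply: (@le_lt_trans _ _ ((`|M| + 1) * `|x - y|)).
  by rewrite ler_wpM2r//; have := ler_norm M; lra.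
by rewrite mulrC -ltr_pdivlMr.
Unshelve. all: by end_near. Qed.

Section TwistMap.
Variable R : realType.
Variables (s : nat) (alpha K : R) (A : R -> R -> R).
Hypothesis s_gt0 : (0 < s)%N.

Definition small_radius (r : R) : Prop := 0 < r /\ 16 * K * r <= 1.
Definition twist_step (r th th' : R) : Prop :=
  th' - A r (- th') = th + (alpha + r ^+ s.*2) + A r (th + (alpha + r ^+ s.*2)).

Hypothesis K_ge : 8 <= K.
Hypothesis A_lip : forall r r' x x', 0 <= r -> r <= r' -> r' <= 1 / 4 ->
  `|A r' x' - A r x| <= K * r' ^+ s.*2 * ((r' - r) + 4 * r' * `|x' - x|).
Hypothesis A_le1 : forall r x, small_radius r -> `|A r x| <= 1.

Lemma small_radius_le r : small_radius r -> r <= 1 / 128.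
Proof.
move=> [r0 h]; have : 8 * r <= K * r by rewrite ler_wpM2r ?K_ge// ltW.
by lra.
Qed.

Lemma small_radiusS r r' : small_radius r' -> 0 < r -> r <= r' -> small_radius r.
Proof.
move=> [r0 h] r0' rr'; split=> //; apply: le_trans h.
by rewrite ler_wpM2l//; have := K_ge; lra.
Qed.

(** Raising the radius raises the rotation by at least r'^(2s-1) (r' - r), while it changes [A] by
    at most K r' <= 1/16 times that; the slope of [A] in the angle is at most 1/16 as well. An
    inversion th' > ph' would contradict these margins. *)
Lemma twist_step_mono (r r' th ph th' ph' : R) : 0 < r -> r <= r' -> small_radius r' ->
  th <= ph -> twist_step r th th' -> twist_step r' ph ph' ->
  th' <= ph'.
Proof.
move=> r0 rr' sr' thph st st'; rewrite leNgt; apply/negP => lt.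
have r1 := small_radius_le sr'; have [r0' h] := sr'.
rewrite /twist_step in st st'.
set om := alpha + r ^+ s.*2 in st; set om' := alpha + r' ^+ s.*2 in st'.
have r4 : r' <= 1 / 4 by lra.
have [m mE] : exists m, s.*2 = m.+1.
  by exists s.*2.-1; rewrite prednK// double_gt0.
have X0 : 0 <= r' ^+ m by rewrite exprn_ge0// ltW.
have X1 : r' ^+ m <= 1 by rewrite exprn_ile1 ?(ltW r0')//; lra.
have kE : K * r' ^+ s.*2 = K * r' * r' ^+ m by rewrite mE exprS mulrA.
set X := r' ^+ m in X0 X1 kE.
(* One factor of the radius is split off, so that the twist is measured against the same power X
   that appears in the Lipschitz bound for [A]. *)
have tw : X * (r' - r) <= r' ^+ s.*2 - r ^+ s.*2.
  rewrite mE !exprS -/X.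
  have : r * r ^+ m <= r * X by rewrite ler_wpM2l ?(ltW r0)//; apply: lerXn2r; rewrite ?nnegrE ?(ltW r0) ?(ltW r0').
  by lra.
have l1 := A_lip (th + om) (ph + om') (ltW r0) rr' r4.
have l2 := A_lip (- th') (- ph') (ltW r0) rr' r4.
have D0 : X * (r' - r) <= (ph + om') - (th + om) by rewrite /om /om'; lra.
have XD : 0 <= X * (r' - r) by rewrite mulr_ge0// subr_ge0.
rewrite (ger0_norm (x := ph + om' - (th + om))) in l1; last by lra.
rewrite (ger0_norm (x := - ph' - - th')) in l2; last by lra.
move: l1 l2; rewrite !ler_norml kE => /andP[l1 _] /andP[l2 _].
set D := ph + om' - (th + om) in D0 l1.
have kr : 16 * (K * r') <= 1 by lra.
have k0 : 0 <= K * r' by rewrite mulr_ge0 ?(ltW r0')//; have := K_ge; lra.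
set k := K * r' in kr k0 l1 l2.
have e1 : k * X * (r' - r + 4 * r' * D) = k * (X * (r' - r)) + 4 * r' * (k * X) * D by ring.
have e2 : k * X * (r' - r + 4 * r' * (- ph' - - th')) =
   k * (X * (r' - r)) + 4 * r' * (k * X) * (th' - ph') by ring.
have b1 : k * (X * (r' - r)) <= (1 / 16) * (X * (r' - r)) by rewrite ler_wpM2r//; lra.
have kX : k * X <= 1 / 16 by rewrite -[leRHS]mulr1; apply: ler_pM => //; lra.
have b0 : 4 * r' * (k * X) <= 1 / 16.
  have : r' * (k * X) <= r' * (1 / 16) by rewrite ler_wpM2l// ltW.
  by lra.
have b2 : 4 * r' * (k * X) * D <= (1 / 16) * D by rewrite ler_wpM2r//; lra.
have b3 : 4 * r' * (k * X) * (th' - ph') <= (1 / 16) * (th' - ph') by rewrite ler_wpM2r//; lra.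
rewrite e1 in l1; rewrite e2 in l2.
have DE : D = ph + om' - (th + om) by [].
by clearbody D k X om om'; lra.
Qed.

(** Both [A] terms have slope at most 1/4, so 3/4 of the new distance is at most 5/4 of the old one.
    This gives continuity of the step map, which is only obtained by choice. *)
Lemma twist_step_lip (r th ph th' ph' : R) : small_radius r ->
  twist_step r th th' -> twist_step r ph ph' ->
  `|th' - ph'| <= 2 * `|th - ph|.
Proof.
move=> sr st st'; have r1 := small_radius_le sr; have [r0 h] := sr.
rewrite /twist_step in st st'.
set om := alpha + r ^+ s.*2 in st st'.
have r4 : r <= 1 / 4 by lra.
have l1 := A_lip (ph + om) (th + om) (ltW r0) (lexx r) r4.
have l2 := A_lip (- ph') (- th') (ltW r0) (lexx r) r4.
rewrite subrr add0r in l1; rewrite subrr add0r in l2.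
have X1 : r ^+ s.*2 <= 1 by rewrite exprn_ile1 ?(ltW r0)//; lra.
have kr : 16 * (K * r) <= 1 by lra.
have k0 : 0 <= K * r by rewrite mulr_ge0 ?(ltW r0)//; have := K_ge; lra.
have c1 : K * r ^+ s.*2 * (4 * r) <= 1 / 4.
  have -> : K * r ^+ s.*2 * (4 * r) = 4 * ((K * r) * r ^+ s.*2) by ring.
  have : K * r * r ^+ s.*2 <= K * r * 1 by rewrite ler_wpM2l.
  by lra.
have e1 : th + om - (ph + om) = th - ph by ring.
have e2 : - th' - - ph' = - (th' - ph') by ring.
rewrite e1 mulrA in l1; rewrite e2 normrN mulrA in l2.
have b1 : K * r ^+ s.*2 * (4 * r) * `|th - ph| <= (1 / 4) * `|th - ph| by rewrite ler_wpM2r.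
have b2 : K * r ^+ s.*2 * (4 * r) * `|th' - ph'| <= (1 / 4) * `|th' - ph'| by rewrite ler_wpM2r.
have := le_trans l1 b1; have := le_trans l2 b2.
have e3 : th' - ph' = (th - ph) + (A r (th + om) - A r (ph + om)) +
   (A r (- th') - A r (- ph')) by lra.
move=> u2 u1.
have : `|th' - ph'| <= `|th - ph| + (1 / 4) * `|th - ph| + (1 / 4) * `|th' - ph'|.
  rewrite {1}e3; apply: (le_trans (ler_normD _ _)); apply: lerD => //.
  by apply: (le_trans (ler_normD _ _)); apply: lerD.
have := normr_ge0 (th - ph); lra.
Qed.

Lemma twist_step_exists r th : small_radius r -> exists th', twist_step r th th'.
Proof.
move=> sr; have r1 := small_radius_le sr; have [r0 h] := sr.
pose c := th + (alpha + r ^+ s.*2) + A r (th + (alpha + r ^+ s.*2)).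
pose f y := y - A r (- y).
have r4 : r <= 1 / 4 by lra.
have cf : continuous f.
  apply: (@lipschitz_cont _ _ (1 + K * r ^+ s.*2 * (4 * r))) => x y.
  have l := A_lip (- y) (- x) (ltW r0) (lexx r) r4.
  have -> : f x - f y = (x - y) - (A r (- x) - A r (- y)) by rewrite /f; ring.
  apply: (le_trans (ler_normB _ _)); rewrite mulrDl mul1r lerD2l.
  apply: (le_trans l); rewrite subrr add0r -opprD normrN mulrA.
  by rewrite !mulrA.
have b x := A_le1 x sr.
(* Since |A| <= 1, f lies below c at the left end and above c at the right end. *)
have [y _ fy] : exists2 y, y \in `[c - 1, c + 1] & f y = c.
  apply: IVT.
  - by lra.
  - exact: continuous_subspaceT.
  - have := b (- (c - 1)); have := b (- (c + 1)); rewrite !ler_norml => /andP[u1 u2] /andP[u3 u4].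
    rewrite ge_min le_max /f; apply/andP; split; apply/orP; [left|right]; lra.
by exists y.
Qed.

Lemma twist_map_exists r : small_radius r -> exists F : R -> R,
  forall th, twist_step r th (F th).
Proof.
by move=> sr; have [F FP] := choice (fun th => twist_step_exists th sr); exists F.
Qed.

Lemma iter_twist_map_lip (r : R) (F : R -> R) (n : nat) x y : small_radius r ->
  (forall th, twist_step r th (F th)) ->
  `|iter n F x - iter n F y| <= 2 ^+ n * `|x - y|.
Proof.
move=> sr FP; elim: n => [|n IH]; first by rewrite expr0 mul1r.
rewrite exprS -mulrA; apply: (le_trans (twist_step_lip sr (FP _) (FP _))).
by rewrite ler_wpM2l.
Qed.

Lemma twist_periodic_between (r0 r1 r c : R) (th ph : nat -> R) (q : nat) :
  0 < r0 -> r0 <= r -> r <= r1 -> small_radius r1 ->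
  (forall l, (l < q)%N -> twist_step r0 (th l) (th l.+1)) -> th q = th 0%N + c ->
  (forall l, (l < q)%N -> twist_step r1 (ph l) (ph l.+1)) -> ph q = ph 0%N + c ->
  exists x : nat -> R, (forall l, twist_step r (x l) (x l.+1)) /\ x q = x 0%N + c.
Proof.
move=> r00 r0r rr1 sr1 st0 thq st1 phq.
have rgt0 : 0 < r by apply: lt_le_trans r0r.
have sr : small_radius r by exact: small_radiusS sr1 _ _.
have [F FP] := twist_map_exists sr.
(* At the intermediate radius, iterates from [th 0] stay above the inner orbit and those from [ph 0]
   stay below the outer one. *)
have lo l : (l <= q)%N -> th l <= iter l F (th 0%N).
  elim: l => [|l IH] lq //=.
  exact: twist_step_mono r00 r0r sr (IH (ltnW lq)) (st0 _ lq) (FP _).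
have hi l : (l <= q)%N -> iter l F (ph 0%N) <= ph l.
  elim: l => [|l IH] lq //=.
  exact: twist_step_mono rgt0 rr1 sr1 (IH (ltnW lq)) (FP _) (st1 _ lq).
pose G x := iter q F x - x.
have cG : continuous G.
  apply: (@lipschitz_cont _ _ (2 ^+ q + 1)) => x y.
  have -> : G x - G y = (iter q F x - iter q F y) - (x - y) by rewrite /G; ring.
  apply: (le_trans (ler_normB _ _)); rewrite mulrDl mul1r lerD2r.
  exact: iter_twist_map_lip sr FP.
have h0 : c <= G (th 0%N) by have := lo q (leqnn q); rewrite /G; lra.
have h1 : G (ph 0%N) <= c by have := hi q (leqnn q); rewrite /G; lra.
have [x Gx] : exists x, G x = c.
  have [le|/ltW le] := leP (th 0%N) (ph 0%N).
  - have [x _ Gx] : exists2 x, x \in `[th 0%N, ph 0%N] & G x = c.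
      apply: IVT => //; first exact: continuous_subspaceT.
      by rewrite ge_min le_max h0 h1 orbT.
    by exists x.
  - have [x _ Gx] : exists2 x, x \in `[ph 0%N, th 0%N] & G x = c.
      apply: IVT => //; first exact: continuous_subspaceT.
      by rewrite ge_min le_max h0 h1 orbT.
    by exists x.
exists (fun l => iter l F x); split; first by move=> l; exact: FP.
by rewrite /= -Gx /G addrC subrK.
Qed.

End TwistMap.

Lemma modc_polar (R : realType) (r x : R) : 0 <= r -> modc (ofR r * expi x) = r.
Proof. by move=> r0; rewrite modcM modc_ofR modc_expi mulr1 ger0_norm. Qed.

Lemma expi_int (R : realType) (p : int) : expi (2 * pi * p%:~R) = 1 :> R[i].
Proof.
have h (n : nat) : expi (2 * pi * n%:R) = 1   :> R[i].
  have -> : 2 * pi * n%:R = n%:R * (2 * pi) :> R by ring.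
  rewrite -expiX; have -> : expi (2 * pi) = 1   :> R[i].
    have -> : 2 * pi = pi *+ 2 :> R by rewrite mulr_natl.
    by apply: complex_eqP => /=; rewrite ?cos2pi ?sin2pi.
  by rewrite expr1n.
case: p => n; first exact: h.
rewrite NegzE mulrNz mulrN -cj_expi -[n.+1%:~R]/(n.+1%:R) h.
by apply: complex_eqP => //=; rewrite oppr0.
Qed.

(** * From closed angle sequences to periodic points of varphi_a *)

Section CircleDynamics.
Variable R : realType.
Local Notation C := R[i].
Variables (s : nat) (alpha : R) (a : nat -> nat -> C).
Hypotheses (s_gt0 : (0 < s)%N) (Sa : Sigma s a).

Definition atil_lip_const : R := 8 * 4 ^+ s.
Local Notation K := atil_lip_const.

Definition atil_polar (r x : R) : R := atil s a (ofR r * expi x).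

Lemma K_ge : 8 <= K.
Proof.
have : (1 : R) <= 4 ^+ s by apply: exprn_ege1; lra.
by rewrite /atil_lip_const; set X := _ ^+ s => X1; lra.
Qed.

Lemma expi_lip (x y : R) : modc (expi x - expi y) <= 4 * `|x - y|.
Proof.
have e : expi x - expi y = expi y * (expi (x - y) - 1).
  by rewrite mulrBr -expiD mulr1; congr (expi _ - _); ring.
rewrite e modcM modc_expi mul1r.
have [h|h] := leP `|x - y| (1 / 2).
  (* The algebra estimate is applied to a constant function and evaluated at [a]. For larger
     differences the trivial bound 2 is at most 4 |x - y|. *)
  have ru : rrep s `|x - y| (fun=> x - y).
    by rewrite -modc_ofR; exact: rep_const.
  apply: (le_trans (rep_bound (rep_expi1 ru h) Sa)).
  by have := normr_ge0 (x - y); lra.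
apply: (le_trans (modcD _ _)); rewrite modcN modc1 modc_expi.
by lra.
Qed.

Lemma atil_polar_lip (r r' x x' : R) : 0 <= r -> r <= r' -> r' <= 1 / 4 ->
  `|atil_polar r' x' - atil_polar r x| <= K * r' ^+ s.*2 * ((r' - r) + 4 * r' * `|x' - x|).
Proof.
move=> r0 rr' r1; have r0' : 0 <= r' by lra.
have m1 : modc (ofR r' * expi x') <= r' by rewrite modc_polar.
have m2 : modc (ofR r * expi x) <= r' by rewrite modc_polar.
apply: (le_trans (atil_lip Sa r1 m1 m2)); rewrite ler_wpM2l//.
  by rewrite !mulr_ge0 ?exprn_ge0.
have -> : ofR r' * expi x' - ofR r * expi x =
    ofR (r' - r) * expi x + ofR r' * (expi x' - expi x).
  by rewrite ofRB; ring.
apply: (le_trans (modcD _ _)); rewrite !modcM !modc_ofR modc_expi mulr1.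
have dr : 0 <= r' - r by rewrite subr_ge0.
rewrite (ger0_norm dr) (ger0_norm r0') lerD2l.
have -> : 4 * r' * `|x' - x| = r' * (4 * `|x' - x|) by ring.
by rewrite ler_wpM2l// expi_lip.
Qed.

Lemma atil_polar_le r x : small_radius K r -> `|atil_polar r x| <= 1.
Proof.
move=> sr; have r1 := small_radius_le K_ge sr; have [r0 h] := sr.
have r4 : r <= 1 / 4 by lra.
have m1 : modc (ofR r * expi x) <= r by rewrite modc_polar// ltW.
have m2 : modc (0 : C) <= r by rewrite modc0 ltW.
have := atil_lip Sa r4 m1 m2; rewrite (atil0 Sa) !subr0 modc_polar ?(ltW r0)//.
move=> h2; apply: (le_trans h2).
have p1 : r ^+ s.*2 <= 1 by rewrite exprn_ile1 ?(ltW r0)//; lra.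
have : K * r ^+ s.*2 * r <= K * 1 * r.
  by rewrite ler_wpM2r ?(ltW r0)// ler_wpM2l//; have := K_ge; lra.
have h4 : 0 <= K * r by rewrite mulr_ge0 ?(ltW r0)//; have := K_ge; lra.
by move=> h3; rewrite /atil_lip_const in h h3 h4; lra.
Qed.

(** Equal images give z - w = w (exp(i (a~(w) - a~(z))) - 1), whose modulus is at most |z - w| /
    4. *)
Lemma phi_a_inj r : small_radius K r -> inj_on_disc s a r.
Proof.
move=> sr; have r1 := small_radius_le K_ge sr; have [r0 h] := sr.
split; first by lra.
move=> z w mz mw e; rewrite /phi_a in e.
have r4 : r <= 1 / 4 by lra.
have zE : z - w = w * (expi (atil s a w - atil s a z) - expi 0).
  rewrite expi0 mulrBr mulr1 expiD mulrA -e -mulrA -expiD addrN expi0 mulr1.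
  by [].
have := atil_lip Sa r4 mw mz => l.
have m1 : modc (z - w) <= r * (4 * (K * r ^+ s.*2 * modc (z - w))).
  rewrite {1}zE modcM; apply: ler_pM; rewrite ?modc_ge0//.
  apply: (le_trans (expi_lip _ _)); rewrite subr0 ler_wpM2l//.
  apply: (le_trans l); rewrite -(modcN (w - z)) opprB.
  exact: lexx.
have X1 : r ^+ s.*2 <= 1 by rewrite exprn_ile1 ?(ltW r0)//; lra.
have k0 : 0 <= K * r by rewrite mulr_ge0 ?(ltW r0)//; have := K_ge; lra.
have m2 : r * (4 * (K * r ^+ s.*2 * modc (z - w))) <= (1 / 4) * modc (z - w).
  have -> : r * (4 * (K * r ^+ s.*2 * modc (z - w))) =
     (4 * ((K * r) * r ^+ s.*2)) * modc (z - w) by ring.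
  rewrite ler_wpM2r ?modc_ge0//.
  have : K * r * r ^+ s.*2 <= K * r * 1 by rewrite ler_wpM2l.
  by lra.
have mzw : modc (z - w) = 0 by have := modc_ge0 (z - w); lra.
by apply/eqP; rewrite -subr_eq0; apply/eqP; exact: modc_eq0.
Qed.

(** With orb_l = tau phi_a tau w_l, the preimage in [varphi_step] is u = tau w_l. So varphi_a maps
    orb_l to phi_a(T w_l), and [orbit_step] says that this has the angle of orb_(l+1). *)
Lemma periodic_orbit r (th : nat -> R) q (p : int) : small_radius K r -> (0 < q)%N ->
  (forall l, (l < q)%N -> orbit_step s a r alpha (th l) (th l.+1)) ->
  th q = th 0%N + 2 * pi * p%:~R ->
  periodic_point_on_circle s alpha a r.
Proof.
move=> sr q_gt0 st thq; have r1 := small_radius_le K_ge sr; have [r0 h] := sr.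
split; first exact: phi_a_inj.
pose w l : C := ofR r * expi (th l).
have cjw l : cj (w l) = ofR r * expi (- th l) by rewrite /w cjM cj_ofR cj_expi.
pose orb l := cj (phi_a s a (cj (w l))).
have orbE l : orb l = ofR r * expi (th l - atil_polar r (- th l)).
  by rewrite /orb /phi_a cjM cjK cj_expi cjw /w expiD mulrA.
have mw l : modc (w l) = r by rewrite modc_polar// ltW.
exists (orb 0%N); split; first by rewrite orbE modc_polar// ltW.
exists q; split; first by [].
exists orb; split; first exact: erefl.
split.
  rewrite !orbE thq.
  have -> : atil_polar r (- (th 0%N + 2 * pi * p%:~R)) = atil_polar r (- th 0%N).
    by rewrite /atil_polar opprD expiD -mulrN -mulrNz expi_int mulr1.
  by rewrite [th 0%N + _ - _]addrAC (expiD (th 0%N - _)) expi_int mulr1.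
move=> m mq; exists (cj (w m)); split; first by rewrite modc_cj mw.
split; first by rewrite /orb /tau_c cjK.
rewrite /tau_c cjK orbE /Tmap mw.
have -> : w m * expi (alpha + r ^+ s.*2) = ofR r * expi (th m + (alpha + r ^+ s.*2)).
  by rewrite /w -mulrA -expiD.
rewrite /phi_a -mulrA -expiD; congr (_ * expi _).
exact: st m mq.
Qed.

Lemma periodic_interval (r0 r1 r : R) (th ph : nat -> R) q (p : int) :
  (0 < q)%N -> 0 < r0 -> r0 <= r -> r <= r1 -> small_radius K r1 ->
  (forall l, (l < q)%N -> orbit_step s a r0 alpha (th l) (th l.+1)) ->
  th q = th 0%N + 2 * pi * p%:~R ->
  (forall l, (l < q)%N -> orbit_step s a r1 alpha (ph l) (ph l.+1)) ->
  ph q = ph 0%N + 2 * pi * p%:~R ->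
  periodic_point_on_circle s alpha a r.
Proof.
move=> q_gt0 r00 r0r rr1 sr1 st0 thq st1 phq.
have sr : small_radius K r by apply: small_radiusS sr1 _ rr1; [exact: K_ge|lra].
have [x [xs xq]] := twist_periodic_between s_gt0 K_ge atil_polar_lip
  atil_polar_le r00 r0r rr1 sr1 st0 thq st1 phq.
by apply: (periodic_orbit sr q_gt0 _ xq) => l _; exact: xs.
Qed.

End CircleDynamics.

(** * Linear coefficients of a power series *)

Section Coefficients.
Variable R : realType.
Local Notation C := R[i].
Variables (s n : nat).
Hypothesis sn : (s.*2 < n)%N.

Local Notation v := (n, 0)%N.
Local Notation v' := (0, n)%N.

(** The reality condition of Sigma ties a_(0,n) to a_(n,0), so the coefficient cannot move alone. *)
Definition axis_param (t : C) : nat -> nat -> C := fun i j =>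
  if (i, j) == v then t else if (i, j) == v' then cj t else 0.

Lemma axis_neq : v != v'.
Proof. by rewrite xpair_eqE negb_and gtn_eqF// (leq_ltn_trans _ sn). Qed.

Lemma axis_v t : axis_param t n 0 = t.
Proof. by rewrite /axis_param eqxx. Qed.

Lemma axis_v' t : axis_param t 0 n = cj t.
Proof. by rewrite /axis_param eq_sym (negbTE axis_neq) eqxx. Qed.

Lemma cj0 : cj 0 = 0 :> C.
Proof. by apply: complex_eqP => //=; rewrite oppr0. Qed.

Lemma Sigma_axis t : modc t < 1 -> Sigma s (axis_param t).
Proof.
move=> t1 i j _; rewrite /axis_param !xpair_eqE; split.
  have n0 : n != 0%N by rewrite gtn_eqF// (leq_ltn_trans _ sn).
  have [->|_] := eqVneq i n; have [->|_] := eqVneq j n;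
    rewrite ?(negbTE n0) ?andbF ?andbT ?andFb ?andTb /= ?cj0 ?cjK//;
    rewrite ?(eq_sym 0%N n) ?(negbTE n0) //=;
    by case: eqP => //= _; rewrite ?cjK ?cj0 //; case: eqP => //=; rewrite ?cjK ?cj0.
by case: ifP => // _; case: ifP => _; rewrite ?modc_cj// modc0.
Qed.

(** Any other variable makes the monomial vanish; otherwise it is a monomial in t and conj t of
    degree at least two. *)
Lemma mono_val_axis t (m : monomial) : modc t < 1 -> Monomials s m ->
  m != mono1 -> m != monoX v -> m != monoX v' ->
  modc (mono_val (axis_param t) m) <= modc t ^+ 2.
Proof.
move=> t1 [fm am] m1 mv mv'.
have [[w [mw wv wv']]|no] := pselect (exists w, [/\ m w != 0%N, w != v & w != v']).
  rewrite (mono_valE _ fm (@subset_refl _ _)).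
  have win : w \in fset_set (msupp m) by rewrite in_fset_set//; apply: mem_set.
  rewrite (big_fsetD1 w)//= /axis_param -surjective_pairing (negbTE wv) (negbTE wv').
  by rewrite expr0n (negbTE mw) mul0r modc0 sqr_ge0.
have sub : msupp m `<=` [set v] `|` [set v'].
  move=> w mw; have [->|wv] := eqVneq w v; first by left.
  have [->|wv'] := eqVneq w v'; first by right.
  by exfalso; apply: no; exists w.
have fB : finite_set ([set v] `|` [set v']) by rewrite finite_setU; split; exact: finite_set1.
rewrite (mono_valE _ fB sub) fset_setU//; try exact: finite_set1.
rewrite !fset_set1 big_fsetU1; last by rewrite inE axis_neq.
rewrite big_seq_fset1 /= axis_v axis_v' modcM !modcX modc_cj -exprD.
have out w : w != v -> w != v' -> m w = 0%N.
  move=> wv wv'; apply/eqP; apply: contrapT => /negP mw.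
  by apply: no; exists w.
have : (1 < m v + m v')%N.
  rewrite ltnNge; apply/negP; rewrite leq_eqVlt ltnS leqn0 addn_eq0 => /orP[|/andP[/eqP a0 /eqP b0]].
    rewrite addn_eq1 => /orP[/andP[/eqP a1 /eqP b0]|/andP[/eqP a0 /eqP b1]].
      move/eqP: mv; apply; apply/funext => w; rewrite /monoX.
      have [->|wv] := eqVneq w v; first by rewrite a1.
      have [->|wv'] := eqVneq w v'; first by rewrite b0.
      by rewrite out.
    move/eqP: mv'; apply; apply/funext => w; rewrite /monoX.
    have [->|wv'] := eqVneq w v'; first by rewrite b1.
    have [->|wv] := eqVneq w v; first by rewrite a0.
    by rewrite out.
  move/eqP: m1; apply; apply/funext => w; rewrite /mono1.
  have [->|wv] := eqVneq w v; first by rewrite a0.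
  have [->|wv'] := eqVneq w v'; first by rewrite b0.
  by rewrite out.
move=> h; apply: ler_wiXn2l => //; [exact: modc_ge0|exact: ltW].
Qed.

Lemma csum_remove (T : choiceType) (e : T -> C) t0 : (cabsum e < +oo)%E ->
  csum e = e t0 + csum (fun t => if t == t0 then 0 else e t).
Proof.
move=> he; pose e0 t := if t == t0 then e t else 0.
rewrite (_ : e t0 = csum e0); last first.
  by rewrite (@csum_single _ _ _ t0) /e0 ?eqxx// => t /negbTE ->.
rewrite -csumD; last 2 first.
- by apply: esum_lty_le he => t; rewrite /e0; case: ifP => _; rewrite lee_fin ?modc0 ?modc_ge0.
- by apply: esum_lty_le he => t; case: ifP => _; rewrite lee_fin ?modc0 ?modc_ge0.
by apply: eq_csum => t; rewrite /e0; case: ifP => _; rewrite ?addr0 ?add0r.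
Qed.

Lemma axis_expansion M (c : ipseries R) f t :
  represents s M c f ->
  modc t < 1 ->
  modc (f (axis_param t) - (c mono1 + c (monoX v) * t + c (monoX v') * cj t)) <= M * modc t ^+ 2.
Proof.
move=> [c0 cM cf] t1; have Sa := Sigma_axis t1.
have c0' m : c m != 0 -> Monomials s m.
  by move=> cm; apply: contrapT => /c0 h; rewrite h eqxx in cm.
pose e m := c m * mono_val (axis_param t) m.
have he : (cabsum e < +oo)%E.
  by apply: le_lt_trans (rep_supp cM); exact: (cabsum_term_le (mu := fun m => m) Sa c0').
have lty (g : monomial -> C) m0 : (cabsum g < +oo)%E ->
    (cabsum (fun m => if m == m0 then 0%R else g m) < +oo)%E.
  by apply: esum_lty_le => m; case: ifP => _; rewrite lee_fin ?modc0 ?modc_ge0.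
have X01 : monoX v != mono1.
  by apply/eqP => /(congr1 (fun m => m v)); rewrite /monoX /mono1 eqxx.
have X02 : monoX v' != mono1.
  by apply/eqP => /(congr1 (fun m => m v')); rewrite /monoX /mono1 eqxx.
have X12 : monoX v' != monoX v.
  apply/eqP => /(congr1 (fun m => m v)); rewrite /monoX eqxx.
  by rewrite (negbTE axis_neq).
rewrite cf// -/e (csum_remove mono1 he).
rewrite (csum_remove (monoX v) (lty _ mono1 he)) (negbTE X01).
rewrite (csum_remove (monoX v') (lty _ (monoX v) (lty _ mono1 he))) (negbTE X12) (negbTE X02).
rewrite {1 2 3}/e mono_val1 mulr1 !mono_valX /= axis_v axis_v'.
set S := csum _.
have -> : c mono1 + (c (monoX v) * t + (c (monoX v') * cj t + S)) -
   (c mono1 + c (monoX v) * t + c (monoX v') * cj t) = S by ring.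
apply: modc_csum_le.
apply: (@le_trans _ _ ((modc t ^+ 2)%:E * cabsum c)%E); last first.
  have -> : (M * modc t ^+ 2)%:E = ((modc t ^+ 2)%:E * M%:E)%E by rewrite -EFinM mulrC.
  by apply: lee_wpmul2l; rewrite ?lee_fin ?sqr_ge0.
rewrite /cabsum -esumZ ?sqr_ge0//; last by move=> m; exact: modc_ge0.
apply: le_esum => m _; rewrite lee_fin.
have p0 : 0 <= modc t ^+ 2 * modc (c m) by rewrite mulr_ge0 ?sqr_ge0 ?modc_ge0.
case: ifPn => [_|n1]; first by rewrite modc0.
case: ifPn => [_|n2]; first by rewrite modc0.
case: ifPn => [_|n3]; first by rewrite modc0.
rewrite /e modcM mulrC; have [->|/c0' am] := eqVneq (c m) 0.
  by rewrite modc0 !mulr0.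
by rewrite ler_wpM2r ?modc_ge0// mono_val_axis.
Qed.

(** Real t isolates A + B and purely imaginary t isolates A - B, so t and its conjugate act as
    independent variables to first order. *)
Lemma linear_zero (A B D : C) (K e : R) : 0 < e ->
  (forall t, modc t < e -> modc (D + A * t + B * cj t) <= K * modc t ^+ 2) -> A = 0.
Proof.
move=> e0 h.
have D0 : D = 0.
  apply: modc_eq0; apply/le_anti; rewrite modc_ge0 andbT.
  have := h 0; rewrite modc0 mulr0 cj0 mulr0 !addr0 expr0n mulr0; exact.
have aux (P : C) (w : C) : modc w = 1 ->
    (forall x : R, 0 < x -> x < e -> modc (P * ofR x) <= K * x ^+ 2) -> P = 0.
  move=> _ hP; apply: modc_eq0; apply/eqP; rewrite eq_le modc_ge0 andbT.
  rewrite leNgt; apply/negP => P0.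
  pose x := Num.min (e / 2) (modc P / (2 * (`|K| + 1))).
  have K0 : 0 < 2 * (`|K| + 1) by rewrite mulr_gt0// ltr_wpDl.
  have x0 : 0 < x by rewrite lt_min !divr_gt0.
  have xe : x < e by apply: (@le_lt_trans _ _ (e / 2)); [rewrite ge_min lexx|lra].
  have xP : x <= modc P / (2 * (`|K| + 1)) by rewrite ge_min lexx orbT.
  have := hP x x0 xe; rewrite modcM modc_ofR (ger0_norm (ltW x0)) expr2 mulrA ler_pM2r//.
  rewrite ler_pdivlMr// in xP.
  have : K * x <= `|K| * x by rewrite ler_wpM2r ?(ltW x0)// ler_norm.
  by have := normr_ge0 K; nra.
have AB : A + B = 0.
  apply: (aux _ 1); first exact: modc1.
  move=> x x0 xe; have := h (ofR x); rewrite modc_ofR (ger0_norm (ltW x0)) D0 cj_ofR add0r -mulrDl.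
  exact.
have AB' : (A - B) * Complex 0 1 = 0.
  apply: (aux _ 1); first exact: modc1.
  move=> x x0 xe; have := h (Complex 0 1 * ofR x).
  rewrite modcM modc_i mul1r modc_ofR (ger0_norm (ltW x0)) D0 cjM cj_ofR add0r.
  have -> : cj (Complex 0 1) = - Complex 0 1 :> C by apply: complex_eqP => //=; rewrite oppr0.
  have -> : A * (Complex 0 1 * ofR x) + B * (- Complex 0 1 * ofR x) =
     (A - B) * Complex 0 1 * ofR x by ring.
  exact.
have AmB : A - B = 0.
  move/eqP: AB'; rewrite mulf_eq0 => /orP[/eqP//|/eqP h1].
  by have := modc_i R; rewrite h1 modc0 => /eqP; rewrite eq_sym oner_eq0.
have A2 : A * 2 = 0 by rewrite -[RHS](addr0 0) -{1}AB -AmB; ring.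
by move/eqP: A2; rewrite mulf_eq0 pnatr_eq0 orbF => /eqP.
Qed.

Lemma coef_axis M (c : ipseries R) f (lam : C) K e :
  represents s M c f ->
  0 < e -> e <= 1 ->
  (forall t, modc t < e -> modc (f (axis_param t) - lam * (t + cj t)) <= K * modc t ^+ 2) ->
  c (monoX v) = lam.
Proof.
move=> cP e0 e1 h; apply/eqP; rewrite -subr_eq0; apply/eqP.
apply: (@linear_zero _ (c (monoX v') - lam) (c mono1) (M + K) e e0) => t te.
have t1 : modc t < 1 by apply: lt_le_trans te e1.
set P := c mono1 + c (monoX v) * t + c (monoX v') * cj t.
have -> : c mono1 + (c (monoX v) - lam) * t + (c (monoX v') - lam) * cj t =
    (f (axis_param t) - lam * (t + cj t)) + - (f (axis_param t) - P) by rewrite /P; ring.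
apply: (le_trans (modcD _ _)); rewrite modcN addrC [leRHS]mulrDl.
exact: lerD (axis_expansion cP t1) (h t te).
Qed.

Lemma atil_axis t z : modc t < 1 -> modc z <= 1 / 4 ->
  atil s (axis_param t) z = 2 * reC (t * z ^+ n).
Proof.
move=> t1 z1; have Sa := Sigma_axis t1.
have n0 : (0 < n)%N by apply: leq_ltn_trans sn.
have layer m : atil_layer s (axis_param t) z m =
    if m == n then t * z ^+ n + cj (t * z ^+ n) else 0.
  case: eqP => [->|mn].
    have d : (ord0 : 'I_n.+1) != ord_max by apply/eqP => /(congr1 val) /= e; rewrite -e in n0.
    rewrite /atil_layer (bigD1 ord_max)//= (bigD1 ord0)//= big1.
      rewrite /admissible subn0 subnn addn0 add0n sn axis_v axis_v' !expr0 !mulr1 addr0.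
      by rewrite cjM cjX.
    move=> i /andP[i1 i2]; case: ifP => // _; rewrite /axis_param !xpair_eqE.
    have -> : (val i == n) = false by apply: contraNF i1 => /eqP h; apply/eqP; apply: val_inj.
    have -> : (val i == 0)%N = false by apply: contraNF i2 => /eqP h; apply/eqP; apply: val_inj.
    by rewrite /= !mul0r.
  rewrite /atil_layer big1// => i _; case: ifP => // _; rewrite /axis_param !xpair_eqE.
  have im : (i <= m)%N by rewrite -ltnS.
  have -> : (nat_of_ord i == n) && (m - i == 0)%N = false.
    by apply/negP => /andP[/eqP h1 /eqP h2]; apply: mn; lia.
  have -> : (nat_of_ord i == 0%N) && (m - i == n)%N = false.
    by apply/negP => /andP[/eqP h1 /eqP h2]; apply: mn; lia.
  by rewrite !mul0r.
have h : (fun N => reC (\sum_(m < N) atil_layer s (axis_param t) z m)) @ \oo --> 2 * reC (t * z ^+ n).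
  apply: cvg_near_cst; exists n.+1 => // N /= nN.
  rewrite (bigD1 (Ordinal nN))//= big1 ?addr0.
    by rewrite layer eqxx; case: (t * z ^+ n) => x y /=; ring.
  move=> i iN; rewrite layer; case: eqP => // e.
  by move/eqP: iN; case; apply: val_inj.
exact: cvg_unique (atil_cvg Sa z1) h.
Qed.

End Coefficients.

(** * First-order expansion of the resonant radius *)

Section FirstOrder.
Variable R : realType.
Local Notation C := R[i].
Local Notation Par := (nat -> nat -> C).

Lemma power_sub_le (z w : C) n : modc z <= 1 -> modc w <= 1 ->
  modc (z ^+ n - w ^+ n) <= n%:R * modc (z - w).
Proof.
move=> z1 w1; elim: n => [|n IH]; first by rewrite !expr0 subrr modc0 mul0r.
have -> : z ^+ n.+1 - w ^+ n.+1 = z * (z ^+ n - w ^+ n) + (z - w) * w ^+ n.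
  by rewrite !exprS; ring.
apply: (le_trans (modcD _ _)); rewrite !modcM modcX -natr1 mulrDl mul1r.
apply: lerD.
  apply: le_trans IH; rewrite -[leRHS]mul1r ler_wpM2r ?modc_ge0//.
by rewrite -[leRHS]mulr1 ler_wpM2l ?modc_ge0// exprn_ile1 ?modc_ge0.
Qed.

Lemma norm_sum_le l (f : nat -> R) (b : R) : (forall m, (m < l)%N -> `|f m| <= b) ->
  `|\sum_(m < l) f m| <= l%:R * b.
Proof.
move=> fb; apply: (le_trans (ler_norm_sum _ _ _)).
have -> : l%:R * b = \sum_(m < l) b by rewrite sumr_const card_ord -[b *+ l]mulr_natl.
by apply: ler_sum => m _; exact: fb.
Qed.

(** The middle inequality goes backwards: it bounds 2s zeta by exp(2s zeta) - 1, which is nu / d. *)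
Lemma expR_sub1_abs (x : R) : `|x| <= 1 / 2 ->
  `|expR x - 1| <= 2 * `|x| /\ `|x| <= 2 * `|expR x - 1| /\ `|expR x - 1 - x| <= 2 * x ^+ 2.
Proof.
move=> x1; have l := expR_ge1Dx x.
have u : expR x - 1 - x <= 2 * x ^+ 2.
  by apply: expR_sub1_le; have := ler_norm x; lra.
have q : `|expR x - 1 - x| <= 2 * x ^+ 2.
  by rewrite ger0_norm//; lra.
split=> //; last split => //; last first.
- move: x1; rewrite ler_norml => /andP[x2 x3].
  have [x0|x0] := leP 0 x.
    by rewrite (ger0_norm x0) ger0_norm; lra.
  have y0 := ltW x0.
  rewrite (ler0_norm y0) -normrN ger0_norm; last by have := expR_le1 x; rewrite y0 => e; lra.
  have : 2 * x ^+ 2 <= - x / 1 by nra.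
  have h := expR_ge1Dx (- x); have e0 := expR_gt0 x.
  have h2 : expR x * (1 - x) <= 1.
    by have := ler_wpM2l (ltW e0) h; rewrite expRxMexpNx_1.
  by nra.
- have -> : expR x - 1 = (expR x - 1 - x) + x by ring.
  apply: (le_trans (ler_normD _ _)).
  have : 2 * x ^+ 2 <= `|x|.
    rewrite -(real_normK (num_real x)) expr2 mulrA -[leRHS]mul1r ler_wpM2r//; lra.
  by lra.
Qed.

Variables (s q : nat) (beta d rk th0 : R).
Hypotheses (s_gt0 : (0 < s)%N) (q_gt0 : (0 < q)%N) (rk_gt0 : 0 < rk) (d_gt0 : 0 < d).
Hypothesis rkd : rk ^+ s.*2 = d.
Hypothesis rk_small : 64 * orbit_const R s * rk <= orbit_radius R s.

Variable n : nat.
Hypothesis sn : (s.*2 < n)%N.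

Definition mean_cos : R :=
  q%:R^-1 * \sum_(l < q) cos (n%:R * angle beta th0 l.+1).

(** On the axis a~ is linear in t, so increments, nu, deviations and log radius are all O(|t|).
    Hence replacing orbit points by those of the rigid rotation of radius [rk] costs O(|t|^2), and
    the mean of the increments becomes a cosine average. *)
Lemma orbit_first_order (x : nat -> Par -> R) :
  (forall j, rrep s (orbit_radius R s) (x j)) ->
  (forall a, Sigma s a ->
     [/\ dev x q a = 0,
         nu s d (x 0%N) a = mean q (incr s beta d rk th0 x) a &
         forall l, (0 < l <= q)%N ->
           x l a = l%:R * nu s d (x 0%N) a + \sum_(m < l) incr s beta d rk th0 x m a]) ->
  exists K : R, forall t, modc t < 1 ->
    `|x 0%N (axis_param n t) + (s%:R * d)^-1 * rk ^+ n * mean_cos * (2 * reC t)| <= K * modc t ^+ 2.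
Proof.
move=> xeta xfix.
have [[sR s0 q0] [[etaE eta0 eta1] [K1_ge rk1 d_le_rk sd]]] :=
  orbit_constants s_gt0 q_gt0 rk_gt0 rkd rk_small.
have rk_pos := rk_gt0; have d_pos := d_gt0.
(* Displacement of an orbit point per unit of |t|: 16/d comes from the radius, the rest from the
   deviation and nu in the angle. *)
pose C1 : R := 16 / d + 4 * (8 * q%:R + 4).
exists ((4 * n%:R * C1 / d + 128 / d ^+ 2) / (2 * s%:R)) => t t1.
set a := axis_param n t.
have Sa : Sigma s a by exact: Sigma_axis.
have [dq nuE xlE] := xfix a Sa.
set N := nu s d (x 0%N) a in nuE xlE.
pose tau := modc t; have tau0 : 0 <= tau by exact: modc_ge0.
set z := x 0%N a.
have zeta : `|z| <= orbit_radius R s by exact: rrep_bound (xeta 0%N) Sa.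
have z1 : `|z| <= 1 / 2 by lra.
have [ez1 [_ _]] := expR_sub1_abs z1.
have rkz : rk * expR z <= 1 / 4.
  have : expR z <= 2.
    have := ler_norm (expR z - 1); lra.
  move=> h; have : rk * expR z <= rk * 2 by rewrite ler_wpM2l// ltW.
  by lra.
have rkz0 : 0 <= rk * expR z by rewrite mulr_ge0 ?expR_ge0// ltW.
have mp u c : modc (point rk (x 0%N) u c a) = rk * expR z.
  by rewrite /point modcM modc_ofR modc_expi mulr1 ger0_norm.
have At w : modc w <= 1 / 4 -> atil s a w = 2 * reC (t * w ^+ n).
  by move=> hw; exact: atil_axis.
have Abound w : modc w <= 1 / 4 -> `|atil s a w| <= 2 * tau.
  move=> hw; rewrite At// normrM ger0_norm// ler_wpM2l//.
  apply: (le_trans (Re_le_modc _)); rewrite modcM modcX -[leRHS]mulr1.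
  by rewrite ler_wpM2l// exprn_ile1 ?modc_ge0//; lra.
have Bb l : `|incr s beta d rk th0 x l a| <= 4 * tau.
  apply: (le_trans (ler_normD _ _)).
  have h1 := Abound (point rk (x 0%N) (fun a => dev x l a + nu s d (x 0%N) a) (angle beta th0 l.+1) a).
  have h2 := Abound (point rk (x 0%N) (fun a => - dev x l.+1 a) (- angle beta th0 l.+1) a).
  rewrite !mp in h1 h2; have -> : 4 * tau = 2 * tau + 2 * tau by ring.
  exact: lerD (h1 rkz) (h2 rkz).
have Nb : `|N| <= 4 * tau.
  rewrite nuE /mean normrN normrM ger0_norm ?invr_ge0 ?(ltW q0)// ler_pdivrMl//.
  by apply: (norm_sum_le (f := fun l => incr s beta d rk th0 x l a)) => l _.
have xlb l : (l <= q)%N -> `|dev x l a| <= 8 * q%:R * tau.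
  case: l => [|l] lq.
    by rewrite /dev /= normr0 !mulr_ge0// ltW.
  rewrite /dev /= xlE//; apply: (le_trans (ler_normD _ _)).
  rewrite normrM (ger0_norm (ler0n _ _)).
  have h1 : l.+1%:R * `|N| <= l.+1%:R * (4 * tau) by rewrite ler_wpM2l.
  have h2 := norm_sum_le (l := l.+1) (f := fun l => incr s beta d rk th0 x l a) (fun m _ => Bb m).
  have h3 : l.+1%:R * (4 * tau) <= q%:R * (4 * tau).
    by rewrite ler_wpM2r ?ler_nat// mulr_ge0.
  by lra.
have y1 : `|2 * s%:R * z| <= 1 / 2.
  rewrite normrM (ger0_norm (x := 2 * s%:R)); last by lra.
  have : 2 * s%:R * `|z| <= 2 * s%:R * orbit_radius R s by rewrite ler_wpM2l//; lra.
  by lra.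
have [_ [ey2 ey3]] := expR_sub1_abs y1.
set y := 2 * s%:R * z in y1 ey2 ey3.
have Ny : expR y - 1 = N / d.
  rewrite /N /nu -/z -/y; field; exact: lt0r_neq0.
rewrite Ny in ey2 ey3.
have Ndb : `|N / d| <= 4 * tau / d.
  by rewrite normrM normfV (gtr0_norm d_gt0) ler_wpM2r// invr_ge0 ltW.
have yb : `|y| <= 8 * tau / d by lra.
have zb : `|z| <= 8 * tau / d.
  apply: le_trans yb; rewrite /y normrM ler_peMl// ger0_norm; lra.
have pt u c : `|u a| <= 8 * q%:R * tau + 4 * tau ->
    modc (point rk (x 0%N) u c a - ofR rk * expi c) <= C1 * tau.
  move=> ub.
  have -> : point rk (x 0%N) u c a - ofR rk * expi c =
      expi c * (ofR (rk * expR z) * (expi (u a) - expi 0) + ofR (rk * (expR z - 1))).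
    by rewrite /point -/z expiD expi0 !(ofRM, ofRB, ofR1); ring.
  rewrite modcM modc_expi mul1r; apply: (le_trans (modcD _ _)).
  rewrite modcM !modc_ofR (ger0_norm rkz0) normrM (ger0_norm (ltW rk_gt0)).
  have h1 := expi_lip Sa (u a) 0; rewrite subr0 in h1.
  have h2 : rk * expR z * modc (expi (u a) - expi 0) <= 1 * (4 * `|u a|).
    by apply: ler_pM => //; [exact: modc_ge0|lra].
  have h3 : rk * `|expR z - 1| <= 1 * (2 * `|z|) by apply: ler_pM => //; lra.
  have -> : C1 * tau = 2 * (8 * tau / d) + 4 * (8 * q%:R * tau + 4 * tau).
    by rewrite /C1; field; exact: lt0r_neq0.
  by lra.
have At0 (u : Par -> R) c : `|u a| <= 8 * q%:R * tau + 4 * tau ->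
    `|atil s a (point rk (x 0%N) u c a) - 2 * reC (t * (ofR rk * expi c) ^+ n)| <=
    2 * n%:R * C1 * tau ^+ 2.
  move=> ub; rewrite At ?mp// -mulrBr normrM ger0_norm//.
  have -> : reC (t * point rk (x 0%N) u c a ^+ n) - reC (t * (ofR rk * expi c) ^+ n) =
      reC (t * (point rk (x 0%N) u c a ^+ n - (ofR rk * expi c) ^+ n)).
    by rewrite mulrBr; case: (t * _) => ? ?; case: (t * _) => ? ?.
  have -> : 2 * n%:R * C1 * tau ^+ 2 = 2 * (tau * (n%:R * (C1 * tau))) by ring.
  rewrite ler_wpM2l//; apply: (le_trans (Re_le_modc _)); rewrite modcM ler_wpM2l//.
  apply: (le_trans (power_sub_le _ _ _)).
  - by rewrite mp; lra.
  - by rewrite modc_polar ?(ltW rk_gt0)//; lra.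
  - by rewrite ler_wpM2l// pt.
(* The two values of a~ are taken at opposite angles, so the imaginary part of t cancels and only
   the cosine remains. *)
pose B0 l : R := 4 * reC t * rk ^+ n * cos (n%:R * angle beta th0 l.+1).
have Bd l : (l < q)%N -> `|incr s beta d rk th0 x l a - B0 l| <= 4 * n%:R * C1 * tau ^+ 2.
  move=> lq.
  have h1 := At0 (fun a => dev x l a + nu s d (x 0%N) a) (angle beta th0 l.+1).
  have h2 := At0 (fun a => - dev x l.+1 a) (- angle beta th0 l.+1).
  have u1 : `|dev x l a + nu s d (x 0%N) a| <= 8 * q%:R * tau + 4 * tau.
    by apply: (le_trans (ler_normD _ _)); apply: lerD => //; exact: xlb (ltnW lq).
  have u2 : `|- dev x l.+1 a| <= 8 * q%:R * tau + 4 * tau.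
    by rewrite normrN; have := xlb _ lq; lra.
  have := lerD (h1 u1) (h2 u2).
  have eB : B0 l = 2 * reC (t * (ofR rk * expi (angle beta th0 l.+1)) ^+ n) +
     2 * reC (t * (ofR rk * expi (- angle beta th0 l.+1)) ^+ n).
    rewrite !exprMn !expiX -!ofRX mulrN /B0.
    set w := n%:R * _; case: (t) => t1' t2' /=; rewrite cosN sinN; ring.
  move=> h; have := le_trans (ler_normD _ _) h; rewrite eB.
  set A1 := atil s a _; set A2 := atil s a _; set D1 := reC _; set D2 := reC _.
  have -> : A1 - 2 * D1 + (A2 - 2 * D2) =
     incr s beta d rk th0 x l a - (2 * D1 + 2 * D2).
    have -> : incr s beta d rk th0 x l a = A1 + A2 by [].
    clearbody A1 A2 D1 D2; ring.
  have -> : 4 * n%:R * C1 * tau ^+ 2 = 2 * n%:R * C1 * tau ^+ 2 + 2 * n%:R * C1 * tau ^+ 2 by ring.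
  exact.
have ND : `|N + 4 * reC t * rk ^+ n * mean_cos| <= 4 * n%:R * C1 * tau ^+ 2.
  have -> : N + 4 * reC t * rk ^+ n * mean_cos =
     - (q%:R^-1 * \sum_(l < q) (incr s beta d rk th0 x l a - B0 l)).
    rewrite nuE /mean /mean_cos sumrB mulrBr /B0 -mulr_sumr; ring.
  rewrite normrN normrM ger0_norm ?invr_ge0 ?(ltW q0)// ler_pdivrMl//.
  exact: (norm_sum_le (f := fun l => incr s beta d rk th0 x l a - B0 l) Bd).
have -> : z + (s%:R * d)^-1 * rk ^+ n * mean_cos * (2 * reC t) =
   (2 * s%:R)^-1 * (- (N / d - y) + (N + 4 * reC t * rk ^+ n * mean_cos) / d).
  by rewrite /y; field; rewrite !lt0r_neq0.
rewrite normrM ger0_norm ?invr_ge0; last by lra.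
rewrite -/tau; set E := 4 * n%:R * C1 / d + 128 / d ^+ 2.
have -> : E / (2 * s%:R) * tau ^+ 2 = (2 * s%:R)^-1 * (E * tau ^+ 2) by ring.
apply: ler_wpM2l; first by rewrite invr_ge0; lra.
rewrite /E; apply: (le_trans (ler_normD _ _)); rewrite normrN.
have -> : (4 * n%:R * C1 / d + 128 / d ^+ 2) * tau ^+ 2 =
  2 * (8 * tau / d) ^+ 2 + 4 * n%:R * C1 * tau ^+ 2 / d.
  by field; exact: lt0r_neq0.
apply: lerD.
  apply: (le_trans ey3); rewrite ler_wpM2l// -(real_normK (num_real y)).
  have td0 : 0 <= 8 * tau / d by rewrite divr_ge0 ?mulr_ge0// ltW.
  by apply: lerXn2r; rewrite ?nnegrE.
by rewrite normrM normfV (gtr0_norm d_gt0) ler_wpM2r// invr_ge0 ltW.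
Qed.

End FirstOrder.

(** * Resonances at dyadic rotation numbers *)

Section Cosines.
Variable R : realType.

Lemma cos_period (x : R) (m : int) : cos (x + 2 * pi * m%:~R) = cos x.
Proof.
have := congr1 (@reC R) (expiD x (2 * pi * m%:~R)).
by rewrite expi_int mulr1.
Qed.

Lemma sum_alternating (f : nat -> R) h N : (forall l, f (l + h)%N = - f l) ->
  \sum_(l < N * (h + h)) f l = 0.
Proof.
elim: N f => [|N IH] f fh; first by rewrite mul0n big_ord0.
rewrite mulSn big_split_ord /= (IH (fun l => f (h + h + l)%N)); last first.
  by move=> l; rewrite addnA fh.
rewrite addr0 big_split_ord /= -big_split /= big1// => i _.
by rewrite addnC fh addrN.
Qed.

Lemma dyadic_above (x : R) : exists i : int, x < (2 * i + 1)%:~R /\ (2 * i + 1)%:~R <= x + 2.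
Proof.
exists (Num.floor ((x + 1) / 2)).
have h1 := floor_le ((x + 1) / 2); have h2 := floorD1_gt ((x + 1) / 2).
by move: h1 h2; rewrite !rmorphD /= rmorphM /=; split; lra.
Qed.

Lemma pow2_large (x : R) : exists K : nat, forall k, (K <= k)%N -> x < 2 ^+ k.
Proof.
exists (Num.bound `|x|) => k Kk.
apply: (le_lt_trans (ler_norm x)); apply: (lt_le_trans (archi_boundP (normr_ge0 x))).
rewrite -natrX ler_nat; apply: (leq_trans Kk); exact: ltnW (ltn_expl k _).
Qed.

End Cosines.

Section Resonance.
Variable R : realType.
Local Notation C := R[i].
Local Notation Par := (nat -> nat -> C).
Variables (s : nat) (alpha : R).
Hypothesis s_gt0 : (0 < s)%N.

(** The largest [rk] for which the contraction condition [rk_small] holds. *)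
Definition max_radius : R := orbit_radius R s / (64 * orbit_const R s).

Lemma orbit_const_ge : 384 * 4 ^+ s <= orbit_const R s.
Proof.
have : (4 : R) ^+ s <= 64 ^+ s by apply: lerXn2r; rewrite ?nnegrE; lra.
by rewrite /orbit_const; set X := 4 ^+ s; set Y := 64 ^+ s => h; lra.
Qed.

Lemma orbit_radius_bounds : 0 < orbit_radius R s /\ orbit_radius R s <= 1 / 48.
Proof.
have sR : (1 : R) <= s%:R by rewrite ler1n.
rewrite /orbit_radius invr_gt0; split; first by lra.
rewrite mul1r lef_pV2 ?posrE; lra.
Qed.

Lemma max_radius_gt0 : 0 < max_radius.
Proof.
have [h _] := orbit_radius_bounds; have h2 := orbit_const_ge.
have : (1 : R) <= 4 ^+ s by apply: exprn_ege1; lra.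
move: h2; set X := 4 ^+ s => h2 X1.
by rewrite divr_gt0//; lra.
Qed.

Section DyadicMeans.
Variables (k : nat) (i : int).
Local Notation p := (2 * i + 1).
Local Notation q := (2 ^ k)%N.
Let beta : R := 2 * pi * p%:~R / q%:R.

(** Each step advances q th by a multiple of 2 pi, so nothing averages out: the value is 1 from 0
    and -1 from pi/q. *)
Lemma mean_cos_eq (th0 : R) : mean_cos q beta th0 q = cos (q%:R * th0).
Proof.
have q0 : q%:R != 0 :> R by rewrite pnatr_eq0 expn_eq0.
rewrite /mean_cos (eq_bigr (fun=> cos (q%:R * th0))).
  by rewrite sumr_const card_ord -[cos _ *+ q]mulr_natl mulKf.
move=> l _; rewrite /angle mulrDr /beta.
have -> : q%:R * (2 * pi * p%:~R / q%:R * l.+1%:R) = 2 * pi * (p * l.+1%:Z)%:~R :> R.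
  by rewrite intrM; field.
exact: cos_period.
Qed.

(** The two starting angles differ by pi/q, and 2^j pi/q is a multiple of 2 pi. *)
Lemma mean_cos_gt j : (k < j)%N ->
  mean_cos q beta 0 (2 ^ j) = mean_cos q beta (pi / q%:R) (2 ^ j).
Proof.
move=> kj; have q0 : q%:R != 0 :> R by rewrite pnatr_eq0 expn_eq0.
rewrite /mean_cos; congr (_ * _); apply: eq_bigr => l _.
rewrite /angle add0r mulrDr (addrC (_ * (pi / _))).
have [e jE] : exists e, j = (k + e.+1)%N by exists (j - k).-1; lia.
have -> : (2 ^ j)%:R * (pi / q%:R) = 2 * pi * (2 ^ e)%:Z%:~R :> R.
  by rewrite jE expnD expnS !natrM -pmulrn; field.
by rewrite cos_period.
Qed.

(** With e = k - j - 1, an advance of 2^e steps adds p pi to 2^j th. As p is odd, this changes the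
    sign of the cosine and the terms cancel in pairs. *)
Lemma mean_cos_lt (th0 : R) j : (j < k)%N -> mean_cos q beta th0 (2 ^ j) = 0.
Proof.
move=> jk; have [e kE] : exists e, k = (j + e.+1)%N.
  by exists (k - j).-1; lia.
have qE : q = (2 ^ j * (2 ^ e + 2 ^ e))%N by rewrite kE expnD expnS mul2n addnn.
have j0 : (2 ^ j)%:R != 0 :> R by rewrite pnatr_eq0 expn_eq0.
have e0 : (2 ^ e)%:R != 0 :> R by rewrite pnatr_eq0 expn_eq0.
pose f (l : nat) := cos ((2 ^ j)%:R * angle beta th0 l.+1).
suff h l : f (l + 2 ^ e)%N = - f l.
  by have := sum_alternating (2 ^ j) h; rewrite -qE /mean_cos => ->; rewrite mulr0.
rewrite /f /angle -addSn natrD mulrDr.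
have -> : (2 ^ j)%:R * th0 + (2 ^ j)%:R * (beta * (l.+1%:R + (2 ^ e)%:R)) =
   (2 ^ j)%:R * (th0 + beta * l.+1%:R) + pi + 2 * pi * i%:~R :> R.
  have -> : beta = 2 * pi * p%:~R / ((2 ^ j)%:R * (2 * (2 ^ e)%:R)).
    by rewrite /beta {1}kE expnD expnS !natrM.
  by rewrite intrD intrM; field; rewrite j0 e0.
by rewrite cos_period cosDpi.
Qed.

End DyadicMeans.

Lemma resonance k : 16 / 2 ^+ k <= max_radius ^+ s.*2 -> (s.*2 < 2 ^ k)%N ->
  exists (c : ipseries R) (rk : R) (r0 r1 : Par -> R),
  [/\ 0 < rk, rk ^+ s.*2 <= 16 / 2 ^+ k,
      forall a, Sigma s a ->
        [/\ ps_converges s c a, ps_val s c a != 0 -> r0 a != r1 a,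
            0 < r0 a <= 2 * rk, 0 < r1 a <= 2 * rk &
            forall r, Num.min (r0 a) (r1 a) <= r <= Num.max (r0 a) (r1 a) ->
              periodic_point_on_circle s alpha a r] &
      forall j, (s.*2 < 2 ^ j)%N -> (c (monoX (2 ^ j, 0)%N) != 0) = (j == k)].
Proof.
move=> hk sk; pose q := (2 ^ k)%N.
have qE : q%:R = 2 ^+ k :> R by rewrite natrX.
have q_gt0 : (0 < q)%N by rewrite expn_gt0.
have q0 : 0 < q%:R :> R by rewrite ltr0n.
have [pi0 pi4] : 0 < pi :> R /\ pi < 4 :> R.
  by split; [exact: pi_gt0|have := @pihalf_lt2 R; lra].
(* The odd numerator P lies above q alpha / (2 pi) by at most 2: strictness gives d > 0, and the gap
   gives q d <= 4 pi < 16. *)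
have [i [pi1 pi2]] := dyadic_above (q%:R * alpha / (2 * pi)).
set P : R := (2 * i + 1)%:~R in pi1 pi2.
pose beta : R := 2 * pi * P / q%:R.
pose d := beta - alpha.
have qdE : q%:R * d = 2 * pi * (P - q%:R * alpha / (2 * pi)).
  rewrite /d /beta mulrBr [RHS]mulrBr; congr (_ - _).
    by rewrite mulrC mulfVK// lt0r_neq0.
  by rewrite [RHS]mulrC mulfVK// lt0r_neq0// mulr_gt0.
have qd16 : q%:R * d <= 16.
  rewrite qdE; have : 2 * pi * (P - q%:R * alpha / (2 * pi)) <= 2 * pi * 2.
    by rewrite ler_wpM2l//; lra.
  by lra.
have d0 : 0 < d.
  have : 0 < q%:R * d by rewrite qdE mulr_gt0//; lra.
  by rewrite pmulr_rgt0.
have s0 : 0 < s.*2%:R :> R by rewrite ltr0n double_gt0.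
(* The radius at which the unperturbed twist rotates by exactly [beta]. *)
pose rk := d `^ (s.*2%:R^-1).
have rk0 : 0 < rk by exact: powR_gt0.
have rkd : rk ^+ s.*2 = d.
  rewrite -powR_mulrn ?(ltW rk0)// /rk -powRrM mulVf ?lt0r_neq0//.
  by rewrite powRr1// ltW.
have d16 : d <= 16 / 2 ^+ k by rewrite -qE ler_pdivlMr// mulrC.
have rk_max : rk <= max_radius.
  rewrite leNgt; apply/negP => lt.
  have : max_radius ^+ s.*2 < rk ^+ s.*2.
    by rewrite ltr_pXn2r ?nnegrE ?(ltW max_radius_gt0) ?(ltW rk0)// double_gt0.
  by rewrite rkd; lra.
have oc := orbit_const_ge; have [or0 or1] := orbit_radius_bounds.
have X1 : (1 : R) <= 4 ^+ s by apply: exprn_ege1; lra.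
have rk_small : 64 * orbit_const R s * rk <= orbit_radius R s.
  move: rk_max; rewrite /max_radius ler_pdivlMr 1?mulrC//.
  by move: oc X1; set X := 4 ^+ s => oc X1; lra.
have [x0 [x0eta x0P]] := orbit_exists beta 0 s_gt0 q_gt0 rk0 d0 rkd qd16 rk_small.
have [x1 [x1eta x1P]] := orbit_exists beta (pi / q%:R) s_gt0 q_gt0 rk0 d0 rkd qd16 rk_small.
(* The common [rk] cancels: log r0 - log r1 is the difference of the two slots 0. *)
have [c cP] := rrep_sub (x0eta 0%N) (x1eta 0%N).
have abd : beta - d = alpha by rewrite /d; ring.
rewrite abd in x0P x1P.
have qb : beta * q%:R = 2 * pi * P by rewrite /beta mulfVK// lt0r_neq0.
exists c, rk, (fun a => rk * expR (x0 0%N a)), (fun a => rk * expR (x1 0%N a)).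
have rbound (x : nat -> Par -> R) a : (forall j, rrep s (orbit_radius R s) (x j)) -> Sigma s a ->
    0 < rk * expR (x 0%N a) <= 2 * rk.
  move=> xeta Sa; rewrite mulr_gt0 ?expR_gt0//= mulrC ler_wpM2r ?(ltW rk0)//.
  have hx : `|x 0%N a| <= 1 / 2.
    by apply: (le_trans (rrep_bound (xeta 0%N) Sa)); lra.
  have [h _] := expR_sub1_abs hx; have := ler_norm (expR (x 0%N a) - 1).
  by lra.
split => //.
- by rewrite rkd.
- move=> a Sa; have [cc cv] := represents_val cP Sa.
  have b0 := rbound x0 a x0eta Sa; have b1 := rbound x1 a x1eta Sa.
  split => //.
    rewrite -cv; apply: contraNneq => h.
    have /expR_inj -> : expR (x0 0%N a) = expR (x1 0%N a).
      by apply: (mulfI _ h); exact: lt0r_neq0.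
    by rewrite subrr.
  (* 128 4^s r <= 256 4^s rk, which [orbit_const_ge] bounds by orbit_const rk < 1. *)
  have sr r : 0 < r -> r <= 2 * rk -> small_radius (atil_lip_const R s) r.
    move=> r0 r1; split=> //; rewrite /atil_lip_const.
    move: oc X1; set X := 4 ^+ s => oc X1.
    have h1 : X * r <= X * (2 * rk) by rewrite ler_wpM2l//; lra.
    have h2 : 384 * X * rk <= orbit_const R s * rk by rewrite ler_wpM2r// ltW.
    by lra.
  have [st0 dq0 _ _] := x0P a Sa; have [st1 dq1 _ _] := x1P a Sa.
  move=> r /andP[r_ge r_le].
  have e0 : angle beta 0 q + dev x0 q a = angle beta 0 0 + dev x0 0 a + 2 * pi * P.
    by rewrite dq0 /dev /angle /= qb; ring.
  have e1 : angle beta (pi / q%:R) q + dev x1 q a =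
      angle beta (pi / q%:R) 0 + dev x1 0 a + 2 * pi * P.
    by rewrite dq1 /dev /angle /= qb; ring.
  move: b0 b1 => /andP[b0 b0'] /andP[b1 b1'].
  have [le01|/ltW le10] := leP (rk * expR (x0 0%N a)) (rk * expR (x1 0%N a)).
  + rewrite (min_idPl le01) in r_ge; rewrite (max_idPr le01) in r_le.
    exact: (periodic_interval s_gt0 Sa q_gt0 b0 r_ge r_le (sr _ b1 b1') st0 e0 st1 e1).
  + rewrite (min_idPr le10) in r_ge; rewrite (max_idPl le10) in r_le.
    exact: (periodic_interval s_gt0 Sa q_gt0 b1 r_ge r_le (sr _ b0 b0') st1 e1 st0 e0).
move=> j sj.
have x0P' a : Sigma s a -> [/\ dev x0 q a = 0,
    nu s d (x0 0%N) a = mean q (incr s beta d rk 0 x0) a &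
    forall l, (0 < l <= q)%N ->
      x0 l a = l%:R * nu s d (x0 0%N) a + \sum_(m < l) incr s beta d rk 0 x0 m a].
  by move=> Sa; have [_ h1 h2 h3] := x0P a Sa.
have x1P' a : Sigma s a -> [/\ dev x1 q a = 0,
    nu s d (x1 0%N) a = mean q (incr s beta d rk (pi / q%:R) x1) a &
    forall l, (0 < l <= q)%N ->
      x1 l a = l%:R * nu s d (x1 0%N) a + \sum_(m < l) incr s beta d rk (pi / q%:R) x1 m a].
  by move=> Sa; have [_ h1 h2 h3] := x1P a Sa.
have [K0 K0P] := orbit_first_order s_gt0 q_gt0 rk0 d0 rkd rk_small sj x0eta x0P'.
have [K1 K1P] := orbit_first_order s_gt0 q_gt0 rk0 d0 rkd rk_small sj x1eta x1P'.
set g0 := mean_cos q beta 0 (2 ^ j) in K0P.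
set g1 := mean_cos q beta (pi / q%:R) (2 ^ j) in K1P.
pose A : R := (s%:R * d)^-1 * rk ^+ (2 ^ j).
have A0 : A != 0.
  by rewrite mulf_neq0 ?invr_eq0 ?mulf_neq0 ?expf_neq0 ?lt0r_neq0// ltr0n.
have -> : c (monoX (2 ^ j, 0)%N) = ofR (- (A * (g0 - g1))).
  apply: (coef_axis sj cP ltr01 (lexx 1) (K := K0 + K1)) => t t1.
  have -> : ofR (x0 0%N (axis_param (2 ^ j) t) - x1 0%N (axis_param (2 ^ j) t)) -
      ofR (- (A * (g0 - g1))) * (t + cj t) =
      ofR ((x0 0%N (axis_param (2 ^ j) t) + A * g0 * (2 * reC t)) -
           (x1 0%N (axis_param (2 ^ j) t) + A * g1 * (2 * reC t))).
    have -> : t + cj t = ofR (2 * reC t) by apply: complex_eqP; case: (t) => ? ? /=; ring.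
    by rewrite -ofRM -ofRB; congr ofR; ring.
  rewrite modc_ofR [leRHS]mulrDl; apply: (le_trans (ler_normB _ _)).
  exact: lerD (K0P t t1) (K1P t t1).
have -> : (ofR (- (A * (g0 - g1))) != 0) = (g0 - g1 != 0).
  rewrite eq_complex /= eqxx andbT oppr_eq0 mulf_eq0 (negbTE A0) //.
have [jk|jk|jk] := ltngtP j k.
- by rewrite /g0 /g1 !(@mean_cos_lt k i)// subrr eqxx.
- by rewrite /g0 /g1 (@mean_cos_gt k i)// subrr eqxx.
- rewrite /g0 /g1 jk !(@mean_cos_eq k i) mulr0 cos0 mulrC mulfVK ?lt0r_neq0// cospi opprK.
  by lra.
Qed.

End Resonance.

(** * Evaluation at a = 0 and assembly of the sequence H_k *)

Lemma ps_val_zero (R : realType) (s : nat) (c : ipseries R) :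
  ps_val s c (fun _ _ => 0) = c mono1.
Proof.
pose a : nat -> nat -> R[i] := fun _ _ => 0.
have mz m : Monomials s m -> m != mono1 -> mono_val a m = 0.
  move=> [fm _] m1; rewrite (mono_valE _ fm (@subset_refl _ _)).
  have [w mw] : exists w, m w != 0%N.
    apply: contrapT => no; move/eqP: m1; apply; apply/funext => w.
    by apply/eqP; apply: contrapT => /negP mw; apply: no; exists w.
  have win : w \in fset_set (msupp m) by rewrite in_fset_set//; apply: mem_set.
  by rewrite (big_fsetD1 w)//= /a expr0n (negbTE mw) mul0r.
have aux (h : R[i] -> R) : h 0 = 0 -> rsum (Monomials s) (fun m => h (ps_term c a m)) = h (c mono1).
  move=> h0.
  have e (g : R[i] -> R) : g 0 = 0 ->
      (\esum_(m in Monomials s) (Num.max (g (ps_term c a m)) 0)%:E = (Num.max (g (c mono1)) 0)%:E)%E.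
    move=> g0; rewrite esum_mkcond (@esum_single _ _ _ mono1).
    - by rewrite mem_set ?/ps_term ?mono_val1 ?mulr1//; exact: admissible_mono1.
    - case: ifP => _ //; rewrite lee_fin; exact: maxr0_ge0.
    - move=> m m1; case: ifPn => // /set_mem am.
      by rewrite /ps_term mz// mulr0 g0 maxxx.
  by rewrite /rsum e// (e (fun z => - h z)) ?h0 ?oppr0//= -maxr0B.
rewrite /ps_val -/a !aux//; by case: (c mono1).
Qed.

Unset Implicit Arguments.

Theorem theorem1p2 (R : realType) (s : nat) (alpha : R) :
  (0 < s)%N ->
  ~ (exists q : rat, alpha / (2 * pi) = ratr q) ->
  exists H : nat -> @ipseries R,
    functionally_independent s H /\
    (forall (k : nat) (a : nat -> nat -> R[i]), Sigma s a -> ps_converges s (H k) a) /\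
    forall a : nat -> nat -> R[i], Sigma s a ->
      exists I : nat -> R * R,
        (forall k : nat, ps_val s (H k) a != 0 ->
           0 < (I k).1 < (I k).2 /\
           forall r : R, (I k).1 <= r <= (I k).2 ->
             periodic_point_on_circle s alpha a r) /\
        (forall eps : R, 0 < eps ->
           exists K : nat, forall k : nat, (K <= k)%N -> ps_val s (H k) a != 0 ->
             (I k).2 < eps).
Proof.
move=> s_gt0 _.
have m0 : 0 < max_radius R s ^+ s.*2 by rewrite exprn_gt0// max_radius_gt0.
have [k1 k1P] := pow2_large (16 / max_radius R s ^+ s.*2).
have [k2 k2P] := pow2_large (s.*2%:R : R).
(* From this index on, [rk] stays below [max_radius] and the variable a_(2^k,0) is admissible. *)
pose k0 := maxn k1 k2.
have sk k : (s.*2 < 2 ^ (k + k0))%N.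
  have := k2P (k + k0)%N; rewrite -natrX ltr_nat; apply.
  by apply: leq_trans (leq_addl _ _); exact: leq_maxr.
have hk k : 16 / 2 ^+ (k + k0) <= max_radius R s ^+ s.*2.
  have h : 16 / max_radius R s ^+ s.*2 < 2 ^+ (k + k0).
    by apply: k1P; apply: leq_trans (leq_addl _ _); exact: leq_maxl.
  rewrite ler_pdivrMr ?exprn_gt0// mulrC -ler_pdivrMr//; exact: ltW.
have data k : exists x : ipseries R * R * ((nat -> nat -> R[i]) -> R) * ((nat -> nat -> R[i]) -> R),
  [/\ 0 < x.1.1.2, x.1.1.2 ^+ s.*2 <= 16 / 2 ^+ (k + k0),
      forall a, Sigma s a ->
        [/\ ps_converges s x.1.1.1 a, ps_val s x.1.1.1 a != 0 -> x.1.2 a != x.2 a,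
            0 < x.1.2 a <= 2 * x.1.1.2, 0 < x.2 a <= 2 * x.1.1.2 &
            forall r, Num.min (x.1.2 a) (x.2 a) <= r <= Num.max (x.1.2 a) (x.2 a) ->
              periodic_point_on_circle s alpha a r] &
      forall j, (s.*2 < 2 ^ j)%N -> (x.1.1.1 (monoX (2 ^ j, 0)%N) != 0) = (j == k + k0)%N].
  have [c [rk [r0 [r1 P]]]] := resonance alpha s_gt0 (hk k) (sk k).
  by exists (c, rk, r0, r1).
have [D DP] := choice data.
exists (fun k => (D k).1.1.1); split; last split.
- move=> n ks ks_inj; exists (fun q => (2 ^ (ks q + k0), 0)%N); split; last split.
  + move=> q q' /(congr1 fst) /= /eqP; rewrite eqn_exp2l// eqn_add2r => /eqP.
    exact: ks_inj.
  + by move=> q; rewrite /admissible /= addn0.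
  (* At a = 0 a first derivative is the linear coefficient of its variable, which is nonzero exactly
     for the matching exponent. *)
  + exists (fun _ _ => 0); split.
      move=> i j _; split; first by apply: complex_eqP => //=; rewrite oppr0.
      by rewrite modc0.
    pose dg p := (D (ks p)).1.1.1 (monoX (2 ^ (ks p + k0), 0)%N).
    rewrite [X in \det X](_ : _ = diag_mx (\row_p dg p)).
      rewrite det_diag; apply/prodf_neq0 => p _; rewrite mxE /dg.
      by have [_ _ _ ->] := DP (ks p).
    apply/matrixP => p q; rewrite !mxE ps_val_zero /ps_deriv mul1r.
    have -> : (fun w => mono1 w + (w == ((2 ^ (ks q + k0))%N, 0%N)))%N =
        monoX (2 ^ (ks q + k0), 0)%N by apply/funext => w; rewrite add0n.
    have [<-|pq] := eqVneq p q; first by rewrite mulr1n.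
    rewrite mulr0n; apply/eqP; apply: contraNT pq.
    have [_ _ _ ->//] := DP (ks p).
    by rewrite eqn_add2r => /eqP /ks_inj ->.
- by move=> k a Sa; have [_ _ /(_ a Sa)[]] := DP k.
move=> a Sa.
exists (fun k => (Num.min ((D k).1.2 a) ((D k).2 a), Num.max ((D k).1.2 a) ((D k).2 a))).
split.
  move=> k Hk; have [_ _ /(_ a Sa)[_ /(_ Hk) ne /andP[r0 _] /andP[r1 _] per] _] := DP k.
  split => //=; rewrite lt_min r0 r1 /=.
  rewrite lt_max !gt_min !ltxx /= orbF.
  by move: ne; rewrite neq_lt orbC.
move=> eps eps0.
have e0 : 0 < (eps / 2) ^+ s.*2 by rewrite exprn_gt0// divr_gt0.
have [K KP] := pow2_large (16 / (eps / 2) ^+ s.*2).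
(* Both endpoints are at most 2 rk, and rk^(2s) <= 16 / 2^(k + k0) tends to 0 independently of
   [a]. *)
exists K => k Kk _; have [rk0 rkb /(_ a Sa)[_ _ /andP[_ r0] /andP[_ r1] _] _] := DP k.
have rke : (D k).1.1.2 < eps / 2.
  rewrite ltNge; apply/negP => le.
  have h1 : (eps / 2) ^+ s.*2 <= (D k).1.1.2 ^+ s.*2.
    by apply: lerXn2r => //; rewrite nnegrE ltW// divr_gt0.
  have h2 : 16 / (eps / 2) ^+ s.*2 < 2 ^+ (k + k0) by apply: KP; exact: leq_trans (leq_addr _ _).
  rewrite ltr_pdivrMr// in h2.
  have h3 : (eps / 2) ^+ s.*2 <= 16 / 2 ^+ (k + k0) by apply: le_trans rkb.
  rewrite ler_pdivlMr ?exprn_gt0// in h3.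
  by rewrite mulrC in h3; have := lt_le_trans h2 h3; rewrite ltxx.
by rewrite /= gt_max; apply/andP; split; lra.
Qed.
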